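(* Let $k,\ell\ge1$ be integers and let $U\subset\mathbb{R}^2$ be a non-empty open set. Suppose $f\in\mathcal{E}'(S^k\times S^\ell)$ satisfies $f|_U=\lambda w'$ (restricted to $U$) for some $w'\in\mathcal{E}'(S^{k-1}\times S^{\ell-1})$, and the normal operator $N_{k,\ell}f$ vanishes to infinite order at some point $x_0\in U$. Then there exist $u\in\mathcal{E}'(S^{k-1}\times S^\ell)$ and $w\in\mathcal{E}'(S^{k-1}\times S^{\ell-1})$ such that $f=\mathrm{d}'u+\lambda w$.
   Context: $\mathcal{E}'(S^k\times S^\ell)$ denotes $(k+\ell)$-tensor fields on $\mathbb{R}^2$, symmetric in the first $k$ indices and symmetric in the last $\ell$ indices, whose components are compactly supported distributions. Repeated indices are summed over $\{1,2\}$. $\sigma(i_1,\dots,i_p)$ denotes symmetrization over the indicated indices (average over all permutations). Operators (acting on smooth or distributional tensor fields): $(\mathrm{d}'u)_{i_1\dots i_kj_1\dots j_\ell}=\sigma(i_1,\dots,i_k)\,\partial_{x^{i_1}}u_{i_2\dots i_kj_1\dots j_\ell}$ and $(\lambda w)_{i_1\dots i_kj_1\dots j_\ell}=\sigma(i_1,\dots,i_k)\sigma(j_1,\dots,j_\ell)\,\delta_{i_1j_1}w_{i_2\dots i_kj_2\dots j_\ell}$. For smooth compactly supported $f$ the mixed ray transform is $L_{k,\ell}f(x,\xi)=\int_{-\infty}^\infty f_{i_1\dots i_kj_1\dots j_\ell}(x+t\xi)\,\xi^{i_1}\cdots\xi^{i_k}\eta^{j_1}\cdots\eta^{j_\ell}\,dt$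 for $\xi\in\mathbb{S}^1$, $\langle x,\xi\rangle=0$, $\eta=(-\xi_2,\xi_1)$; its formal $L^2$ adjoint is $((L_{k,\ell})^*g)_{i_1\dots i_kj_1\dots j_\ell}(x)=\int_{\mathbb{S}^1}\xi^{i_1}\cdots\xi^{i_k}\eta^{j_1}\cdots\eta^{j_\ell}\,g(x-\langle x,\xi\rangle\xi,\xi)\,dS_\xi$, and $N_{k,\ell}=(L_{k,\ell})^*L_{k,\ell}$. It is given by, and extended to $f\in\mathcal{E}'(S^k\times S^\ell)$ through, the formula (sum over all $m$'s and $n$'s, $*$ denoting convolution) $$(N_{k,\ell}f)_{i_1\dots i_kj_1\dots j_\ell}=2\,f_{m_1\dots m_kn_1\dots n_\ell}*(-1)^{J_1+N_1}\frac{x_1^{I_1+J_2+M_1+N_2}\,x_2^{I_2+J_1+M_2+N_1}}{|x|^{2k+2\ell+1}},$$ where $I_1,J_1,M_1,N_1$ (resp. $I_2,J_2,M_2,N_2$) are the numbers of $1$'s (resp. $2$'s) in $(i_1,\dots,i_k)$, $(j_1,\dots,j_\ell)$, $(m_1,\dots,m_k)$, $(n_1,\dots,n_\ell)$ respectively. A function $\phi$ vanishes to infinite order at $x_0$ if $\phi$ is smooth in a neighborhood of $x_0$ and $\partial^\alpha\phi(x_0)=0$ for all multi-indices $\alpha$; for tensor fields this is required of every component. *)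

(* Defs.v *)
From HB Require Import structures.
From mathcomp Require Import all_boot all_order all_algebra.
From mathcomp Require Import fingroup perm.
From mathcomp Require Import all_classical all_reals all_analysis.

Set Implicit Arguments.
Unset Strict Implicit.
Unset Printing Implicit Defensive.

Import Order.TTheory GRing.Theory Num.Theory.
Import numFieldNormedType.Exports.
Local Open Scope classical_set_scope.
Local Open Scope ring_scope.

(* The index set {1,2} is 'I_2: index 1 is [ord0] and index 2 is [ord_max]. *)

Definition basis_vec (R : realType) (i : 'I_2) : R * R :=
  if i == ord0 then (1, 0) else (0, 1).

Definition partial (R : realType) (i : 'I_2) (f : R * R -> R) : R * R -> R :=
  fun x => 'D_(basis_vec R i) f x.

Definition iter_partial (R : realType) (s : seq 'I_2) (f : R * R -> R) :
    R * R -> R :=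
  foldr (@partial R) f s.

Definition multi_partial (R : realType) (a b : nat) (f : R * R -> R) :
    R * R -> R :=
  iter a (@partial R ord0) (iter b (@partial R ord_max) f).

(* All iterated partial derivatives, in every order of differentiation, exist
   and are continuous at the points of V (meant for V open). *)
Definition smooth_on (R : realType) (V : set (R * R)) (f : R * R -> R) : Prop :=
  forall (s : seq 'I_2) (x : R * R), V x ->
    {for x, continuous (iter_partial s f)} /\
    (forall i : 'I_2, derivable (iter_partial s f) x (basis_vec R i)).

Definition smooth (R : realType) (f : R * R -> R) : Prop := smooth_on setT f.

Definition supp (R : realType) (f : R * R -> R) : set (R * R) :=
  closure [set x | f x != 0].

Definition test_on (R : realType) (V : set (R * R)) (phi : R * R -> R) : Prop :=
  [/\ smooth phi, compact (supp phi) & supp phi `<=` V].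

(* Distributions are handled as total functionals on all functions
   R^2 -> R; the values outside the relevant class of smooth functions are
   junk, and are never used: equality and linearity are only ever required on
   smooth functions (or on test functions). *)
Definition functional (R : realType) : Type := (R * R -> R) -> R.

Definition seminorm (R : realType) (K : set (R * R)) (N : nat)
    (phi : R * R -> R) : R :=
  \sum_(a < N.+1) \sum_(b < N.+1 | (a + b <= N)%N)
    sup [set `|multi_partial a b phi x| | x in K].

(* E'(R^2) as the topological dual of C^oo(R^2). *)
Definition compact_distribution (R : realType) (u : functional R) : Prop :=
  (forall (a : R) (phi psi : R * R -> R), smooth phi -> smooth psi ->
     u (fun x => a * phi x + psi x) = a * u phi + u psi) /\
  (exists (K : set (R * R)) (N : nat) (C : R), compact K /\
     forall phi : R * R -> R, smooth phi -> `|u phi| <= C * seminorm K N phi).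

Definition partial_dist (R : realType) (i : 'I_2) (u : functional R) :
    functional R :=
  fun phi => - u (partial i phi).

(* <u * K, phi> = <u(y), int K(x - y) phi(x) dx>, for u in E'(R^2), K locally
   integrable and phi a test function. *)
Definition convolution (R : realType) (u : functional R) (K : R * R -> R) :
    functional R :=
  fun phi => u (fun y =>
    \int[((@lebesgue_measure R) \x (@lebesgue_measure R))%E]_(x in setT)
      (K (x - y) * phi x)).

Definition tensor (R : realType) (k l : nat) : Type :=
  k.-tuple 'I_2 -> l.-tuple 'I_2 -> functional R.

Definition permute (n : nat) (p : 'S_n) (I : n.-tuple 'I_2) : n.-tuple 'I_2 :=
  [tuple tnth I (p i) | i < n].

(* E'(S^k x S^l) *)
Definition compact_tensor (R : realType) (k l : nat) (f : tensor R k l) : Prop :=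
  (forall I J, compact_distribution (f I J)) /\
  (forall (p : 'S_k) (q : 'S_l) I J (phi : R * R -> R), smooth phi ->
     f (permute p I) (permute q J) phi = f I J phi).

Definition sym_left (R : realType) (k l : nat) (f : tensor R k l) :
    tensor R k l :=
  fun I J phi => (k`!%:R)^-1 * \sum_(p : 'S_k) f (permute p I) J phi.

Definition sym_right (R : realType) (k l : nat) (f : tensor R k l) :
    tensor R k l :=
  fun I J phi => (l`!%:R)^-1 * \sum_(q : 'S_l) f I (permute q J) phi.

Definition d' (R : realType) (k l : nat) (u : tensor R k l) :
    tensor R k.+1 l :=
  sym_left (fun I J => partial_dist (thead I) (u [tuple of behead I] J)).

Definition lambda (R : realType) (k l : nat) (w : tensor R k l) :
    tensor R k.+1 l.+1 :=
  sym_left (sym_right (fun I J phi =>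
    (thead I == thead J)%:R * w [tuple of behead I] [tuple of behead J] phi)).

Definition tensor_add (R : realType) (k l : nat) (f g : tensor R k l) :
    tensor R k l :=
  fun I J phi => f I J phi + g I J phi.

Definition tensor_eq (R : realType) (k l : nat) (f g : tensor R k l) : Prop :=
  forall I J (phi : R * R -> R), smooth phi -> f I J phi = g I J phi.

Definition tensor_eq_on (R : realType) (k l : nat) (U : set (R * R))
    (f g : tensor R k l) : Prop :=
  forall I J (phi : R * R -> R), test_on U phi -> f I J phi = g I J phi.

Definition ones (n : nat) (I : n.-tuple 'I_2) : nat := count_mem ord0 I.
Definition twos (n : nat) (I : n.-tuple 'I_2) : nat := count_mem ord_max I.

Definition normal_kernel (R : realType) (k l : nat)
    (I : k.-tuple 'I_2) (J : l.-tuple 'I_2)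
    (M : k.-tuple 'I_2) (N : l.-tuple 'I_2) (x : R * R) : R :=
  (-1) ^+ (ones J + ones N) *
  (x.1 ^+ (ones I + twos J + ones M + twos N) *
   x.2 ^+ (twos I + ones J + twos M + ones N)) /
  Num.sqrt (x.1 ^+ 2 + x.2 ^+ 2) ^+ (2 * k + 2 * l + 1).

Definition normal_operator (R : realType) (k l : nat) (f : tensor R k l) :
    tensor R k l :=
  fun I J phi =>
    2 * \sum_(M : k.-tuple 'I_2) \sum_(N : l.-tuple 'I_2)
          convolution (f M N) (normal_kernel (R := R) I J M N) phi.

(* Near x0 the distribution u is given by integration against a smooth
   function g, all of whose derivatives vanish at x0. *)
Definition vanishes_infinite_order (R : realType) (u : functional R)
    (x0 : R * R) : Prop :=
  exists (V : set (R * R)) (g : R * R -> R),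
    [/\ open V, V x0, smooth_on V g,
        forall phi : R * R -> R, test_on V phi ->
          u phi =
          \int[((@lebesgue_measure R) \x (@lebesgue_measure R))%E]_(x in V)
            (g x * phi x)
      & forall a b : nat, multi_partial a b g x0 = 0].

Definition tensor_vanishes_infinite_order (R : realType) (k l : nat)
    (f : tensor R k l) (x0 : R * R) : Prop :=
  forall I J, vanishes_infinite_order (f I J) x0.

(* Main.v *)
(* Put m = k + l + 2 and, for 0 <= j <= m, let F_j be the sum of (-1)^{#1's in N} f_{M N} over
   the pairs with #1's in M + #2's in N = j. Up to sign, (N f)_{I J} is
   2 sum_j F_j * x1^{a+j} x2^{2m-a-j} / |x|^{2m+1} with a = #1's in I + #2's in J, and the F_j
   annihilate lambda w, hence they vanish on U.

   The F_j live away from x0, so that the infinite order vanishing at x0 can be tested on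
   mollified Dirac masses at x0: F_0, .., F_m satisfy
   sum_j F_j(d^s (x1^{a+j} x2^{2m-a-j} / |x|^{2m+1})) = 0 (kernels centered at x0) for every a and
   every s. An m-fold rotation operator maps x1^j x2^{m-j} / |x|^{2m+1} to (-d2)^j d1^{m-j} |x|^-1,
   so T := sum_j F_j o (-d2)^j d1^{m-j} annihilates all derivatives of 1/|x|, hence all
   x1^b x2^c / |x|^{2(b+c)+1}, that is, all P(x/|x|^2)/|x| with P polynomial. By inversion and
   polynomial approximation these are dense near the support of T, so T = 0.

   Since sum_j F_j xi1^j xi2^{m-j} is then divisible by the symbol of d1, d2, one gets
   F_j = d1 v_{j-1} + d2 v_j with compactly supported v_j (obtained by successive integration).
   A tensor u with contractions v_j makes all the contractions of f - d'u vanish, and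
   a tensor with vanishing contractions is of the form lambda w. *)

(* Knowledge at the single point x0 suffices because the kernels have degree -1, hence are locally
   integrable, and the F_j vanish near x0: testing N f on the s-th derivative of a bump of size e
   gives the s-th moment times the mass of the bump, up to a relative error O(e), while infinite
   order vanishing makes the other side as small. The numerators have even degree 2m, so the
   reflection in the convolution costs no sign. The rotation operator keeps all its derivatives to
   the left of all its multiplications: multiplications move the index a, derivatives move s, and
   only available moments are used. Derivatives of 1/|x| reach every x1^b x2^c / |x|^(2(b+c)+1)
   because 1/|x| is not harmonic in the plane: for u + v = n - 1 the divergence of x times x1^u x2^v
   / |x|^(2n+1) is -n times that function, and -n is nonzero, so no trace term is lost. T has some
   finite order N, so density is needed in C^N; the inversion turns the part of a compact set
   outside a disc about x0 into a bounded region, where Landau kernels give polynomials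
   approximating N derivatives at once. *)
Require Import Defs.
From HB Require Import structures.
From mathcomp Require Import all_boot all_order all_algebra.
From mathcomp Require Import fingroup perm.
From mathcomp Require Import all_classical all_reals all_analysis.
From mathcomp Require Import measurable_realfun zify ring lra.
Set Implicit Arguments.
Unset Strict Implicit.
Unset Printing Implicit Defensive.
Import Order.TTheory GRing.Theory Num.Theory.
Import numFieldNormedType.Exports.
Local Open Scope classical_set_scope.
Local Open Scope ring_scope.

(** * Smooth functions on the plane *)

Section line.
Context {R : realType}.
Implicit Types (f g : R * R -> R) (x v : R * R).

Lemma is_derive_line f x v (t d : R) :
  is_derive (t *: v + x) v f d <-> is_derive t 1 (fun s => f (s *: v + x)) d.
Proof.
have E : (fun h : R => h^-1 *: ((f \o shift (t *: v + x)) (h *: v) - f (t *: v + x)))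
   = (fun h : R => h^-1 *: (((fun s => f (s *: v + x)) \o shift t) (h *: 1) - f (t *: v + x))).
  by apply/funext => h /=; rewrite [_%:A]mulr1 scalerDl addrA.
have dE : 'D_v f (t *: v + x) = 'D_1 (fun s : R => f (s *: v + x)) t.
  by rewrite /derive E.
have dbE : derivable f (t *: v + x) v = derivable (fun s : R => f (s *: v + x)) t 1.
  by rewrite /derivable E.
split=> -[dl <-].
  by apply: DeriveDef; [rewrite -dbE; exact: dl | exact: esym dE].
by apply: DeriveDef; [rewrite dbE; exact: dl | exact: dE].
Qed.

(** Locating [s] only by |s| <= |t| covers both signs of [t] in one statement. *)
Lemma MVT_line f x v (t : R) :
  (forall s : R, `|s| <= `|t| -> derivable f (s *: v + x) v) ->
  exists2 s : R, `|s| <= `|t| & f (t *: v + x) - f x = t * 'D_v f (s *: v + x).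
Proof.
move=> df.
pose g (s : R) : R := f (s *: v + x).
have dg (s : R) : `|s| <= `|t| -> is_derive s 1 g ('D_v f (s *: v + x)).
  by move=> /df /derivableP /is_derive_line.
have g0 : g 0 = f x by rewrite /g scale0r add0r.
have [t0|t0] := leP 0 t.
  have [|s st E] := @MVT_segment R g (fun s => 'D_v f (s *: v + x)) 0 t t0
    (fun s => ltac:(move=> /itvP st; apply: dg; rewrite !ger0_norm ?st //)).
    apply: derivable_within_continuous => s /itvP st.
    by have [] : is_derive s 1 g ('D_v f (s *: v + x)) by apply: dg; rewrite !ger0_norm ?st.
  move/itvP in st.
  exists s; first by rewrite !ger0_norm ?st.
  by rewrite -g0 -/(g t) E subr0 mulrC.
have [|s st E] := @MVT_segment R g (fun s => 'D_v f (s *: v + x)) t 0 (ltW t0)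
    (fun s => ltac:(move=> /itvP st; apply: dg; rewrite !ler0_norm ?st // ?(ltW t0) ?lerN2 ?st//)).
  apply: derivable_within_continuous => s /itvP st.
  have [] // : is_derive s 1 g ('D_v f (s *: v + x)).
  by apply: dg; rewrite !ler0_norm ?st ?(ltW t0) ?lerN2 ?st.
move/itvP in st.
exists s; first by rewrite !ler0_norm ?st ?(ltW t0) ?lerN2 ?st.
by rewrite -g0 -/(g t) -[LHS]opprB E sub0r mulrN mulrC opprK.
Qed.

Lemma MVT1 f (a a' b : R) :
  (forall s : R, `|s - a| <= `|a' - a| -> derivable f (s, b) (basis_vec R ord0)) ->
  exists2 s : R, `|s - a| <= `|a' - a| &
    f (a', b) - f (a, b) = (a' - a) * partial ord0 f (s, b).
Proof.
move=> df.
have E (s : R) : s *: basis_vec R ord0 + (a, b) = (s + a, b).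
  rewrite /basis_vec eqxx; congr pair => /=; first by rewrite [_%:A]mulr1.
  by rewrite scaler0 add0r.
have [s Hs] := @MVT_line f (a, b) (basis_vec R ord0) (a' - a) (fun s =>
  ltac:(move=> Hs; rewrite E; apply: df; rewrite addrK //)).
rewrite !E subrK => H; exists (s + a); rewrite ?addrK//.
Qed.

Lemma MVT2 f (a b b' : R) :
  (forall s : R, `|s - b| <= `|b' - b| -> derivable f (a, s) (basis_vec R ord_max)) ->
  exists2 s : R, `|s - b| <= `|b' - b| &
    f (a, b') - f (a, b) = (b' - b) * partial ord_max f (a, s).
Proof.
move=> df.
have E (s : R) : s *: basis_vec R ord_max + (a, b) = (a, s + b).
  rewrite /basis_vec /=; congr pair => /=; last by rewrite [_%:A]mulr1.
  by rewrite scaler0 add0r.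
have [s Hs] := @MVT_line f (a, b) (basis_vec R ord_max) (b' - b) (fun s =>
  ltac:(move=> Hs; rewrite E; apply: df; rewrite addrK //)).
rewrite !E subrK => H; exists (s + b); rewrite ?addrK//.
Qed.

End line.
Section C1.
Context {R : realType}.
Implicit Types (f g : R * R -> R) (x v : R * R).

(** The increment is split along a horizontal and a vertical side, with the mean value theorem on
    each; the remainder is then controlled by the oscillation of the two partial derivatives near
    [x]. *)
Lemma C1_is_diff f x :
  (\forall y \near x, forall i, derivable f y (basis_vec R i)) ->
  (forall i, {for x, continuous (partial i f)}) ->
  is_diff x f (fun v => v.1 * partial ord0 f x + v.2 * partial ord_max f x).
Proof.
case: x => x1 x2 df cf; set x : R * R := (x1, x2) in df cf *.
set a := partial ord0 f x; set b := partial ord_max f x.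
pose d (h : R * R) : R := h.1 * a + h.2 * b.
have lin_d : linear d by move=> k [u1 u2] [v1 v2]; rewrite /d /= /GRing.scale /=; ring.
pose L : {linear _ -> _} := HB.pack d (GRing.isLinear.Build _ _ _ _ _ lin_d).
have cL : continuous L.
  move=> y; apply: cvgD; apply: cvgM; try exact: cvg_cst; [exact: cvg_fst|exact: cvg_snd].
have EL : f \o shift x = cst (f x) + L +o_ (0 : R * R) id.
  apply/eqaddoP => e e0.
  have e20 : 0 < e / 2 by rewrite divr_gt0.
  have c0 := cf ord0; have c1 := cf ord_max.
  move/cvgrPdist_le : c0 => /(_ _ e20) c0.
  move/cvgrPdist_le : c1 => /(_ _ e20) c1.
  have [r r0 Hr] : exists2 r : R, 0 < r & forall y, ball x r y ->
      [/\ forall i, derivable f y (basis_vec R i),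
        `|a - partial ord0 f y| <= e / 2 & `|b - partial ord_max f y| <= e / 2].
    have : \forall y \near x, [/\ forall i, derivable f y (basis_vec R i),
        `|a - partial ord0 f y| <= e / 2 & `|b - partial ord_max f y| <= e / 2].
      by apply: filterS3 df c0 c1 => y H1 H2 H3; split; [exact: H1|exact: H2|exact: H3].
    by case/nbhs_ballP => r r0 H; exists r; [exact: r0|exact: H].
  apply/nbhs_ballP; exists r; first exact: r0.
  move=> -[h k] [hr kr]; move: hr kr; rewrite /ball /= !sub0r !normrN => hr kr.
  have Hr' p q : `|p - x1| <= `|h| -> `|q - x2| <= `|k| -> ball (x1, x2) r (p, q).
    by move=> H1 H2; split; rewrite /ball /= distrC; [exact: le_lt_trans H1 _ | exact: le_lt_trans H2 _].
  have [s sh Es] := @MVT1 R f x1 (h + x1) (k + x2) (fun s Hs =>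
    ltac:(rewrite addrK in Hs; apply (Hr _ (Hr' s (k + x2) Hs (ltac:(by rewrite addrK)))))).
  have [t tk Et] := @MVT2 R f x1 x2 (k + x2) (fun s Hs =>
    ltac:(rewrite addrK in Hs; apply (Hr _ (Hr' x1 s (ltac:(by rewrite subrr normr0)) Hs)))).
  rewrite addrK in sh Es; rewrite addrK in tk Et.
  have [_ Hs _] := Hr _ (Hr' s (k + x2) sh (ltac:(by rewrite addrK))).
  have [_ _ Ht] := Hr _ (Hr' x1 t (ltac:(by rewrite subrr normr0)) tk).
  rewrite -[X in `|X|]/(f (h + x1, k + x2) - (f (x1, x2) + (h * a + k * b))).
  have -> : f (h + x1, k + x2) - (f (x1, x2) + (h * a + k * b)) =
     h * (partial ord0 f (s, k + x2) - a) + k * (partial ord_max f (x1, t) - b).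
    by rewrite !mulrBr -Es -Et; ring.
  rewrite (le_trans (ler_normD _ _))// !normrM.
  (* The norm on the product is the maximum norm, so each of the two errors may use up e / 2 of
     it. *)
  rewrite (distrC _ a) (distrC _ b) -[X in e * X]/(Num.max `|h| `|k|).
  have Hh : `|h| <= Num.max `|h| `|k| by rewrite le_max lexx.
  have Hk : `|k| <= Num.max `|h| `|k| by rewrite le_max lexx orbT.
  have := ler_pM (normr_ge0 _) (normr_ge0 _) Hh Hs.
  have := ler_pM (normr_ge0 _) (normr_ge0 _) Hk Ht.
  lra.
have dL := diff_unique cL EL.
split; last exact: dL.
by apply/diff_locallyP; rewrite dL.
Qed.

(** [g1] and [g2] are only derivable along [v], which does not make them differentiable on [W].
    Restricted to the line t v + y they are functions of one real variable, where derivable and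
    differentiable agree and the chain rule for differentials applies. *)
Lemma is_derive_comp2 (W : normedModType R) (b : R * R -> R) (g1 g2 : W -> R) (y v : W) (d1 d2 : R) :
  (\forall z \near (g1 y, g2 y), forall i, derivable b z (basis_vec R i)) ->
  (forall i, {for (g1 y, g2 y), continuous (partial i b)}) ->
  is_derive y v g1 d1 -> is_derive y v g2 d2 ->
  is_derive y v (fun z => b (g1 z, g2 z))
    (d1 * partial ord0 b (g1 y, g2 y) + d2 * partial ord_max b (g1 y, g2 y)).
Proof.
move=> db cb D1 D2.
have Db := C1_is_diff db cb.
pose g (t : R) := (g1 (t *: v + y), g2 (t *: v + y)).
have y0 : 0 *: v + y = y by rewrite scale0r add0r.
have line (h : W -> R) dh : is_derive y v h dh -> is_derive (0 : R) 1 (fun t : R => h (t *: v + y)) dh.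
  case=> dl <-; split.
    by have /derivable1P := dl.
  rewrite /derive /=.
  by under eq_fun do rewrite addr0 [_%:A]mulr1 y0.
have L1 := line _ _ D1; have L2 := line _ _ D2.
have dg1 : differentiable (fun t : R => g1 (t *: v + y)) 0 by apply/derivable1_diffP; case: L1.
have dg2 : differentiable (fun t : R => g2 (t *: v + y)) 0 by apply/derivable1_diffP; case: L2.
have dg : differentiable g 0 by exact: differentiable_pair.
have dbg : differentiable (b \o g) 0.
  by apply: differentiable_comp => //; rewrite /g y0; case: Db.
have E : 'D_1 (b \o g) 0 = d1 * partial ord0 b (g1 y, g2 y) + d2 * partial ord_max b (g1 y, g2 y).
  rewrite deriveE// diff_comp//=; last by rewrite /g y0; case: Db.
  rewrite diff_pair //= /g y0 (@diff_val _ _ _ _ _ _ _ Db) /=.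
  by rewrite -!deriveE// !derive_val.
split.
  by apply/derivable1P/derivable1_diffP.
rewrite -E /derive /=.
by under [in RHS]eq_fun do rewrite /g addr0 [_%:A]mulr1 y0.
Qed.

End C1.

(** Smoothness graded by order. Derivatives of products, inverses and composites contain these
    functions again, so their smoothness is proved by induction on the order, which the
    quantification over words in [smooth_on] does not offer. *)
Fixpoint Cn (R : realType) (n : nat) (V : set (R * R)) (f : R * R -> R) : Prop :=
  if n is n'.+1 then
    [/\ forall x, V x -> {for x, continuous f},
      forall i x, V x -> derivable f x (basis_vec R i) &
      forall i, Cn n' V (partial i f)]
  else True.

Section smooth.
Context {R : realType}.
Implicit Types (f g : R * R -> R) (x v : R * R) (V W : set (R * R)) (i : 'I_2).

Lemma I2P i : {i = ord0} + {i = ord_max}.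
Proof. by case: i => -[|[|//]] p; [left|right]; apply: val_inj. Qed.

Lemma iter_partial_rcons s i f :
  iter_partial (rcons s i) f = iter_partial s (partial i f).
Proof. by rewrite /iter_partial foldr_rcons. Qed.

Lemma iter_partial_cat s t f :
  iter_partial (s ++ t) f = iter_partial s (iter_partial t f).
Proof. by rewrite /iter_partial foldr_cat. Qed.

Lemma smooth_partial V f i : smooth_on V f -> smooth_on V (partial i f).
Proof. by move=> sf s x Vx; rewrite -iter_partial_rcons; exact: sf. Qed.

Lemma smooth_iter V f s : smooth_on V f -> smooth_on V (iter_partial s f).
Proof. by move=> sf t x Vx; rewrite -iter_partial_cat; exact: sf. Qed.

Lemma smooth_onP V f : smooth_on V f <-> forall n, Cn n V f.
Proof.
split=> [sf n|Cf s].
  elim: n f sf => [//|n IH] f sf; split=> [x Vx|i x Vx|i].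
  - by have [] := sf [::] x Vx.
  - by have [_ ] := sf [::] x Vx; exact.
  - by apply: IH; exact: smooth_partial.
elim/last_ind: s f Cf => [|s i IH] f Cf x Vx.
  by have [H1 H2 _] := Cf 1%N; split; [exact: H1|move=> i; exact: H2].
rewrite iter_partial_rcons; apply: IH => // n.
by have [_ _ ] := Cf n.+1; exact.
Qed.

Lemma CnS n V f : Cn n.+1 V f -> Cn n V f.
Proof.
elim: n f => [//|n IH] f [H1 H2 H3]; split=> [||i]; [exact: H1|exact: H2|].
exact: IH.
Qed.

Lemma open_near V x (P : R * R -> Prop) :
  open V -> V x -> (forall y, V y -> P y) -> \forall y \near x, P y.
Proof.
move=> oV Vx HP; apply: filterS (open_nbhs_nbhs (conj oV Vx)); exact: HP.
Qed.

Lemma partial_eq_on V f g i : open V -> (forall x, V x -> f x = g x) ->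
  forall x, V x -> partial i f x = partial i g x.
Proof. by move=> oV fg x Vx; apply: near_eq_derive; exact: open_near fg. Qed.

Lemma Cn_eq n V f g : open V -> (forall x, V x -> f x = g x) -> Cn n V f -> Cn n V g.
Proof.
move=> oV; elim: n f g => [//|n IH] f g fg [H1 H2 H3].
split=> [x Vx|i x Vx|i].
- rewrite /prop_for /continuous_at -fg//; apply: cvg_trans (H1 x Vx).
  by apply: near_eq_cvg; exact: open_near fg.
- by apply: near_eq_derivable (H2 i x Vx); exact: open_near fg.
- by apply: (IH (partial i f)) (H3 i); exact: partial_eq_on.
Qed.

Lemma smooth_eq V f g : open V -> (forall x, V x -> f x = g x) ->
  smooth_on V f -> smooth_on V g.
Proof.
by move=> oV fg /smooth_onP H; apply/smooth_onP => n; exact: Cn_eq fg (H n).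
Qed.

Lemma iter_partial_eq_on V f g s : open V -> (forall x, V x -> f x = g x) ->
  forall x, V x -> iter_partial s f x = iter_partial s g x.
Proof.
move=> oV; elim/last_ind: s f g => [//|s i IH] f g fg x Vx.
by rewrite !iter_partial_rcons; apply: IH => //; exact: partial_eq_on.
Qed.

Lemma smooth_sub V W f : W `<=` V -> smooth_on V f -> smooth_on W f.
Proof. by move=> WV sf s x /WV; exact: sf. Qed.

Lemma smooth_continuous V f x : smooth_on V f -> V x -> {for x, continuous f}.
Proof. by move=> sf Vx; case: (sf [::] x Vx). Qed.

Lemma smooth_derivable V f x i : smooth_on V f -> V x -> derivable f x (basis_vec R i).
Proof. by move=> sf Vx; case: (sf [::] x Vx) => _; exact. Qed.

Lemma smooth_is_derive V f x i : smooth_on V f -> V x ->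
  is_derive x (basis_vec R i) f (partial i f x).
Proof. by move=> sf Vx; apply: derivableP; exact: smooth_derivable sf Vx. Qed.

Lemma partial_cst (c : R) i : partial i (fun=> c) = fun=> 0.
Proof. by apply/funext => x; exact: derive_cst. Qed.

Lemma smooth_cst V (c : R) : smooth_on V (fun=> c).
Proof.
apply/smooth_onP => n; elim: n c => [//|n IH] c.
split=> [x _|i x _|i]; [exact: cvg_cst|exact: derivable_cst|].
by rewrite partial_cst; exact: IH.
Qed.

Lemma is_derive_fst x v : is_derive x v (fun y : R * R => y.1) v.1.
Proof.
have D (h : R) : h != 0 -> h^-1 *: ((h *: v + x).1 - x.1) = v.1.
  by move=> h0; rewrite /= addrK scalerA mulVf// scale1r.
have L : (fun h : R => h^-1 *: (((fst : R * R -> R) \o shift x) (h *: v) - fst x)) @ 0^' --> v.1.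
  apply: cvg_near_cst; near=> h; apply: D; near: h; exact: nbhs_dnbhs_neq.
split; first by apply/cvg_ex; exists v.1.
exact: cvg_lim L.
Unshelve. all: by end_near. Qed.

Lemma is_derive_snd x v : is_derive x v (fun y : R * R => y.2) v.2.
Proof.
have D (h : R) : h != 0 -> h^-1 *: ((h *: v + x).2 - x.2) = v.2.
  by move=> h0; rewrite /= addrK scalerA mulVf// scale1r.
have L : (fun h : R => h^-1 *: (((snd : R * R -> R) \o shift x) (h *: v) - snd x)) @ 0^' --> v.2.
  apply: cvg_near_cst; near=> h; apply: D; near: h; exact: nbhs_dnbhs_neq.
split; first by apply/cvg_ex; exists v.2.
exact: cvg_lim L.
Unshelve. all: by end_near. Qed.

Lemma partial_fst i : partial i (fun y : R * R => y.1) = fun=> (i == ord0)%:R.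
Proof.
apply/funext => x; rewrite /partial (@derive_val _ _ _ _ _ _ _ (is_derive_fst x _)).
by rewrite /basis_vec; case: eqP.
Qed.

Lemma partial_snd i : partial i (fun y : R * R => y.2) = fun=> (i == ord_max)%:R.
Proof.
apply/funext => x; rewrite /partial (@derive_val _ _ _ _ _ _ _ (is_derive_snd x _)).
by rewrite /basis_vec; case: (I2P i) => ->.
Qed.

Lemma smooth_fst V : smooth_on V (fun y : R * R => y.1).
Proof.
apply/smooth_onP => -[//|n]; split=> [x _|i x _|i]; first exact: cvg_fst.
  by case: (is_derive_fst x (basis_vec R i)).
by rewrite partial_fst; move: n; apply/smooth_onP; exact: smooth_cst.
Qed.

Lemma smooth_snd V : smooth_on V (fun y : R * R => y.2).
Proof.
apply/smooth_onP => -[//|n]; split=> [x _|i x _|i]; first exact: cvg_snd.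
  by case: (is_derive_snd x (basis_vec R i)).
by rewrite partial_snd; move: n; apply/smooth_onP; exact: smooth_cst.
Qed.

Lemma partialD_at f g x i : derivable f x (basis_vec R i) -> derivable g x (basis_vec R i) ->
  partial i (fun y => f y + g y) x = partial i f x + partial i g x.
Proof. exact: deriveD. Qed.

Lemma partialM_at f g x i : derivable f x (basis_vec R i) -> derivable g x (basis_vec R i) ->
  partial i (fun y => f y * g y) x = partial i f x * g x + f x * partial i g x.
Proof.
move=> df dg; rewrite [LHS](deriveM df dg) addrC; congr (_ + _).
exact: mulrC.
Qed.

Lemma CnD n V f g : open V -> Cn n V f -> Cn n V g -> Cn n V (fun x => f x + g x).
Proof.
move=> oV; elim: n f g => [//|n IH] f g [F1 F2 F3] [G1 G2 G3].
split=> [x Vx|i x Vx|i].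
- by apply: cvgD; [exact: F1|exact: G1].
- by apply: derivableD; [exact: F2|exact: G2].
apply: Cn_eq (IH _ _ (F3 i) (G3 i)) => // x Vx.
by rewrite partialD_at//; [exact: F2|exact: G2].
Qed.

Lemma CnM n V f g : open V -> Cn n V f -> Cn n V g -> Cn n V (fun x => f x * g x).
Proof.
move=> oV; elim: n f g => [//|n IH] f g Cf Cg.
have Cf' := CnS Cf; have Cg' := CnS Cg.
case: Cf Cg => [F1 F2 F3] [G1 G2 G3].
split=> [x Vx|i x Vx|i].
- by apply: cvgM; [exact: F1|exact: G1].
- by apply: derivableM; [exact: F2|exact: G2].
apply: Cn_eq (CnD oV (IH _ _ (F3 i) Cg') (IH _ _ Cf' (G3 i))) => // x Vx.
by rewrite partialM_at//; [exact: F2|exact: G2].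
Qed.

Lemma smoothD V f g : open V -> smooth_on V f -> smooth_on V g ->
  smooth_on V (fun x => f x + g x).
Proof.
by move=> oV /smooth_onP F /smooth_onP G; apply/smooth_onP => n; exact: CnD.
Qed.

Lemma smoothM V f g : open V -> smooth_on V f -> smooth_on V g ->
  smooth_on V (fun x => f x * g x).
Proof.
by move=> oV /smooth_onP F /smooth_onP G; apply/smooth_onP => n; exact: CnM.
Qed.

Lemma smoothZ V (c : R) f : open V -> smooth_on V f -> smooth_on V (fun x => c * f x).
Proof. by move=> oV; apply: smoothM => //; exact: smooth_cst. Qed.

Lemma smoothN V f : open V -> smooth_on V f -> smooth_on V (fun x => - f x).
Proof.
move=> oV sf; have -> : (fun x => - f x) = (fun x => -1 * f x).
  by apply/funext => x; rewrite mulN1r.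
exact: smoothZ.
Qed.

Lemma smoothB V f g : open V -> smooth_on V f -> smooth_on V g ->
  smooth_on V (fun x => f x - g x).
Proof. by move=> oV sf sg; exact: smoothD oV sf (smoothN oV sg). Qed.

Lemma smoothX V f n : open V -> smooth_on V f -> smooth_on V (fun x => f x ^+ n).
Proof.
move=> oV sf; elim: n => [|n IH].
  by under eq_fun do rewrite expr0; exact: smooth_cst.
by under eq_fun do rewrite exprS; exact: smoothM.
Qed.

Lemma smooth_sum V (I : Type) (r : seq I) (P : pred I) (F : I -> R * R -> R) :
  open V -> (forall j, smooth_on V (F j)) -> smooth_on V (fun x => \sum_(j <- r | P j) F j x).
Proof.
move=> oV sF; elim: r => [|j r IH].
  by apply: (smooth_eq oV _ (@smooth_cst V 0)) => x _; rewrite big_nil.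
case E : (P j); [have H := smoothD oV (sF j) IH|have H := IH];
  by apply: (smooth_eq oV _ H) => x _; rewrite big_cons E.
Qed.

Lemma partialV_at f x i : f x != 0 -> derivable f x (basis_vec R i) ->
  partial i (fun y => (f y)^-1) x = - ((f x)^-1 * (f x)^-1 * partial i f x).
Proof.
by move=> f0 df; rewrite /partial (deriveV f0 df) /GRing.scale /= expr2 invfM mulNr.
Qed.

Lemma smoothV V f : open V -> (forall x, V x -> f x != 0) -> smooth_on V f ->
  smooth_on V (fun x => (f x)^-1).
Proof.
move=> oV f0 /smooth_onP Cf; apply/smooth_onP; elim=> [//|n IH].
have [F1 F2 F3] := Cf n.+1.
split=> [x Vx|i x Vx|i].
- by apply: cvgV; [exact: f0|exact: F1].
- by apply: derivableV; [exact: f0|exact: F2].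
have H : Cn n V (fun x => - 1 * ((f x)^-1 * (f x)^-1 * partial i f x)).
  apply: (CnM oV _ (CnM oV (CnM oV IH IH) (F3 i))).
  by move: n {IH F1 F2 F3}; apply/smooth_onP; exact: smooth_cst.
by apply: Cn_eq H => // x Vx; rewrite partialV_at ?f0//; [rewrite mulN1r|exact: F2].
Qed.

Section comp.
Variables (V W : set (R * R)) (oV : open V) (oW : open W).

Lemma smooth_comp_is_derive b g1 g2 x i : smooth_on W b -> smooth_on V g1 -> smooth_on V g2 ->
  V x -> W (g1 x, g2 x) ->
  is_derive x (basis_vec R i) (fun y => b (g1 y, g2 y))
   (partial i g1 x * partial ord0 b (g1 x, g2 x) + partial i g2 x * partial ord_max b (g1 x, g2 x)).
Proof.
move=> sb s1 s2 Vx Wx; apply: is_derive_comp2.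
- by apply: open_near Wx _ => // y Wy j; exact: smooth_derivable sb Wy.
- by move=> j; apply: smooth_continuous Wx; exact: smooth_partial.
- exact: smooth_is_derive s1 Vx.
- exact: smooth_is_derive s2 Vx.
Qed.

Lemma smooth_comp b g1 g2 : smooth_on W b -> smooth_on V g1 -> smooth_on V g2 ->
  (forall x, V x -> W (g1 x, g2 x)) -> smooth_on V (fun y => b (g1 y, g2 y)).
Proof.
move=> sb s1 s2 VW; apply/smooth_onP => n; elim: n b sb => [//|n IH] b sb.
split=> [x Vx|i x Vx|i].
- have pc : (fun y => (g1 y, g2 y)) @ x --> (g1 x, g2 x).
    exact: (@cvg_pair _ _ _ (nbhs x) (nbhs (g1 x)) (nbhs (g2 x)) _ _ _ _ _ (smooth_continuous s1 Vx) (smooth_continuous s2 Vx)).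
  exact: (cvg_comp (fun y => (g1 y, g2 y)) b pc (smooth_continuous sb (VW x Vx))).
- by case: (smooth_comp_is_derive i sb s1 s2 Vx (VW x Vx)).
have H : Cn n V (fun x => partial i g1 x * partial ord0 b (g1 x, g2 x) + partial i g2 x * partial ord_max b (g1 x, g2 x)).
  have P1 := (smooth_onP _ _).1 (smooth_partial i s1) n.
  have P2 := (smooth_onP _ _).1 (smooth_partial i s2) n.
  exact: (CnD oV (CnM oV P1 (IH _ (smooth_partial _ sb))) (CnM oV P2 (IH _ (smooth_partial _ sb)))).
apply: Cn_eq H => // x Vx; apply/esym.
exact: (@derive_val _ _ _ _ _ _ _ (smooth_comp_is_derive i sb s1 s2 Vx (VW x Vx))).
Qed.

End comp.

End smooth.

(** * Symmetry of second derivatives *)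

Section schwarz.
Context {R : realType}.
Implicit Types (f g : R * R -> R) (x w v : R * R) (V W : set (R * R)) (i : 'I_2).

Lemma derive_translate f w x v : 'D_v (fun y => f (y + w)) x = 'D_v f (x + w).
Proof.
rewrite /derive.
suff -> : (fun h : R => h^-1 *: ((f \o shift (x + w)) (h *: v) - f (x + w))) =
  (fun h : R => h^-1 *: (((fun y => f (y + w)) \o shift x) (h *: v) - f (x + w))) by [].
by apply/funext => h /=; rewrite addrA.
Qed.

Lemma derivable_translate f w x v :
  derivable f (x + w) v -> derivable (fun y => f (y + w)) x v.
Proof.
rewrite /derivable.
suff -> : (fun h : R => h^-1 *: ((f \o shift (x + w)) (h *: v) - f (x + w))) =
  (fun h : R => h^-1 *: (((fun y => f (y + w)) \o shift x) (h *: v) - f (x + w))) by [].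
by apply/funext => h /=; rewrite addrA.
Qed.

(** Two mean value steps on the double difference over a square of side [h]; [i] selects the
    variable treated first. Since the left-hand side is the same for both choices, the two mixed
    derivatives agree at nearby points. *)
Lemma mixed_difference f (a b h : R) i : 0 < h ->
  (forall s t : R, `|s - a| <= h -> `|t - b| <= h ->
    forall j, derivable f (s, t) (basis_vec R j) /\
    derivable (partial i f) (s, t) (basis_vec R j)) ->
  exists s t : R, [/\ `|s - a| <= h, `|t - b| <= h &
    f (a + h, b + h) - f (a + h, b) - (f (a, b + h) - f (a, b)) =
    h * h * partial (if i == ord0 then ord_max else ord0) (partial i f) (s, t)].
Proof.
move=> h0 df.
have hh : `|h| = h by rewrite gtr0_norm.
have h_le (c : R) : `|c + h - c| <= h by rewrite addrC addKr hh.
have z_le (c : R) : `|c - c| <= h by rewrite subrr normr0 ltW.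
have ne10 : (ord_max == ord0 :> 'I_2) = false by [].
move: df; case: (I2P i) => -> df; rewrite ?eqxx ?ne10.
- pose G (y : R * R) : R := f (y + (0, h)) - f y.
  have E1 (s : R) : G (s, b) = f (s, b + h) - f (s, b).
    by rewrite /G; congr (f _ - _); congr pair; rewrite /= addr0.
  have D (s : R) : `|s - a| <= h -> derivable G (s, b) (basis_vec R ord0) /\
      partial ord0 G (s, b) = partial ord0 f (s, b + h) - partial ord0 f (s, b).
    move=> sa.
    have Es : (s, b) + (0, h) = (s, b + h) :> R * R by congr pair; rewrite /= addr0.
    have d1 : derivable (fun y => f (y + (0, h))) (s, b) (basis_vec R ord0).
      by apply: derivable_translate; rewrite Es; apply: (df s (b + h) sa (h_le b) ord0).1.
    have d2 := (df s b sa (z_le b) ord0).1.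
    split; first exact: (derivableB d1 d2).
    by rewrite /partial (deriveB d1 d2) derive_translate Es.
  have [s sa Es] := @MVT1 R G a (a + h) b (fun s Hs => (D s (le_trans Hs (h_le a))).1).
  have sa' := le_trans sa (h_le a).
  have [t tb Et] := @MVT2 R (partial ord0 f) s b (b + h)
    (fun t Ht => (df s t sa' (le_trans Ht (h_le b)) ord_max).2).
  exists s, t; split; [exact: sa'|exact: le_trans tb (h_le b)|].
  rewrite !E1 (D s sa').2 Et in Es.
  rewrite (_ : _ - _ = f (a + h, b + h) - f (a + h, b) - (f (a, b + h) - f (a, b))) in Es; last by [].
  rewrite Es.
  by rewrite !(addrC _ h) !addrK mulrA.
- pose G (y : R * R) : R := f (y + (h, 0)) - f y.
  have E1 (t : R) : G (a, t) = f (a + h, t) - f (a, t).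
    by rewrite /G; congr (f _ - _); congr pair; rewrite /= addr0.
  have D (t : R) : `|t - b| <= h -> derivable G (a, t) (basis_vec R ord_max) /\
      partial ord_max G (a, t) = partial ord_max f (a + h, t) - partial ord_max f (a, t).
    move=> tb.
    have Es : (a, t) + (h, 0) = (a + h, t) :> R * R by congr pair; rewrite /= addr0.
    have d1 : derivable (fun y => f (y + (h, 0))) (a, t) (basis_vec R ord_max).
      by apply: derivable_translate; rewrite Es; apply: (df (a + h) t (h_le a) tb ord_max).1.
    have d2 := (df a t (z_le a) tb ord_max).1.
    split; first exact: (derivableB d1 d2).
    by rewrite /partial (deriveB d1 d2) derive_translate Es.
  have [t tb Et] := @MVT2 R G a b (b + h) (fun t Ht => (D t (le_trans Ht (h_le b))).1).
  have tb' := le_trans tb (h_le b).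
  have [s sa Es] := @MVT1 R (partial ord_max f) a (a + h) t
    (fun s Hs => (df s t (le_trans Hs (h_le a)) tb' ord0).2).
  exists s, t; split; [exact: le_trans sa (h_le a)|exact: tb'|].
  rewrite !E1 (D t tb').2 Es in Et.
  rewrite (_ : _ - _ = f (a + h, b + h) - f (a, b + h) - (f (a + h, b) - f (a, b))); last by ring.
  by rewrite Et !(addrC _ h) !addrK mulrA.
Qed.

Opaque partial.

Lemma schwarz V f x : open V -> smooth_on V f -> V x ->
  partial ord0 (partial ord_max f) x = partial ord_max (partial ord0 f) x.
Proof.
move=> oV sf Vx; apply/eqP; rewrite -subr_eq0 -normr_le0.
apply/ler_addgt0Pl => e e0; rewrite addr0.
have s0 := smooth_partial ord0 sf; have s1 := smooth_partial ord_max sf.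
have s01 := smooth_partial ord0 s1; have s10 := smooth_partial ord_max s0.
have e20 : 0 < e / 2 by rewrite divr_gt0.
have /cvgrPdist_le/(_ _ e20) c01 := smooth_continuous s01 Vx.
have /cvgrPdist_le/(_ _ e20) c10 := smooth_continuous s10 Vx.
have : \forall y \near x, [/\ V y,
    `|partial ord0 (partial ord_max f) x - partial ord0 (partial ord_max f) y| <= e / 2 &
    `|partial ord_max (partial ord0 f) x - partial ord_max (partial ord0 f) y| <= e / 2].
  apply: filterS3 (open_near oV Vx (fun y Vy => Vy)) c01 c10 => y H1 H2 H3.
  by split; [exact: H1|exact: H2|exact: H3].
case/nbhs_ballP => r r0 Hr; rewrite /= in r0.
case: x Vx Hr {c01 c10} => a b Vx Hr.
pose h := r / 2.
have h0 : 0 < h by rewrite divr_gt0.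
have hr : h < r by rewrite /h ltr_pdivrMr// ltr_pMr// ltr1n.
have Hb (s t : R) : `|s - a| <= h -> `|t - b| <= h -> ball (a, b) r (s, t).
  move=> sa tb; split; rewrite /ball /= distrC.
    exact: le_lt_trans sa hr.
  exact: le_lt_trans tb hr.
have Hd i (s t : R) : `|s - a| <= h -> `|t - b| <= h ->
    forall j, derivable f (s, t) (basis_vec R j) /\
    derivable (partial i f) (s, t) (basis_vec R j).
  move=> sa tb j; have [Vst _ _] := Hr _ (Hb s t sa tb).
  split; first exact: smooth_derivable sf Vst.
  exact: (smooth_derivable (smooth_partial i sf) Vst).
have [s [t [sa tb E1]]] := mixed_difference h0 (Hd ord0).
have [s' [t' [sa' tb' E2]]] := mixed_difference h0 (Hd ord_max).
rewrite eqxx in E1; have ne10 : (ord_max == ord0 :> 'I_2) = false by [].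
rewrite ne10 in E2.
have [_ _ H1] := Hr _ (Hb s t sa tb).
have [_ H2 _] := Hr _ (Hb s' t' sa' tb').
have E : partial ord_max (partial ord0 f) (s, t) = partial ord0 (partial ord_max f) (s', t').
  have hh : h * h != 0 by rewrite mulf_neq0// gt_eqF.
  by have := E1; rewrite E2 => /(mulfI hh) ->.
rewrite E in H1.
have tri (A B C : R) : `|B - A| <= e / 2 -> `|C - A| <= e / 2 -> `|C - B| <= e.
  move=> H3 H4; apply: le_trans (ler_distD A C B) _.
  by rewrite [leRHS](splitr e) (distrC A B); exact: lerD.
exact: tri H1 H2.
Qed.

Lemma partialC V f x i j : open V -> smooth_on V f -> V x ->
  partial i (partial j f) x = partial j (partial i f) x.
Proof.
move=> oV sf Vx; case: (I2P i) => ->; case: (I2P j) => ->; [by []| |  |by []].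
  exact: schwarz oV sf Vx.
exact: esym (schwarz oV sf Vx).
Qed.

Lemma partial_iterC V f x i s : open V -> smooth_on V f -> V x ->
  partial i (iter_partial s f) x = iter_partial s (partial i f) x.
Proof.
move=> oV sf Vx; elim: s x Vx => [|j s IH] x Vx; first by rewrite /iter_partial /=.
rewrite /= (partialC _ _ oV (smooth_iter s sf) Vx).
exact: (partial_eq_on j oV IH Vx).
Qed.

Lemma multi_partialE a b f :
  multi_partial a b f = iter_partial (nseq a ord0 ++ nseq b ord_max) f.
Proof.
rewrite iter_partial_cat /multi_partial.
have E n i g : iter n (partial i) g = iter_partial (nseq n i) g.
  by elim: n => [//|n IH] /=; rewrite IH.
by rewrite !E.
Qed.

(** Sorting of words by Schwarz's theorem. It links [multi_partial], in which seminorms and infinite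
    order vanishing are stated, to words, on which induction is convenient. *)
Lemma iter_partial_multi V f x s : open V -> smooth_on V f -> V x ->
  iter_partial s f x = multi_partial (count_mem ord0 s) (count_mem ord_max s) f x.
Proof.
move=> oV sf; rewrite multi_partialE; elim: s x => [|i s IH] x Vx; first by rewrite /=.
rewrite [LHS](partial_eq_on i oV IH Vx).
case: (I2P i) => ->; first by [].
rewrite (partial_iterC _ _ oV sf Vx).
rewrite (_ : count_mem ord0 (ord_max :: s) = count_mem ord0 s); last by [].
rewrite (_ : count_mem ord_max (ord_max :: s) = (count_mem ord_max s + 1)%N); last by rewrite addnC.
by rewrite nseqD catA (iter_partial_cat (_ ++ _) (nseq 1 _)).
Qed.

End schwarz.

(** * Compactly supported distributions *)

Opaque partial smooth_on.

Section cdist.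
Context {R : realType}.
Implicit Types (f g phi psi : R * R -> R) (x v : R * R) (K V W : set (R * R)) (u w : functional R).

Lemma compact_continuous_bound K f : compact K -> (forall x, K x -> {for x, continuous f}) ->
  exists2 M, 0 <= M & forall x, K x -> `|f x| <= M.
Proof.
move=> cK cf.
have cfK : {within K, continuous f}.
  by apply: continuous_in_subspaceT => x /set_mem Kx; exact: cf.
have /ex_strict_bound_gt0[M M0 HM] : bounded_set (f @` K).
  exact/compact_bounded/continuous_compact.
exists M; first exact: ltW.
by move=> x Kx; apply/ltW/HM; exists x.
Qed.

Lemma seminorm_term K N phi a b : compact K -> smooth phi -> (a + b <= N)%N ->
  forall x, K x -> `|multi_partial a b phi x| <= seminorm K N phi.
Proof.
move=> cK sphi abN x Kx.
have sup_ge0 c d : 0 <= sup [set `|multi_partial c d phi x| | x in K].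
  apply: (@le_trans _ _ `|multi_partial c d phi x|) => //.
  apply: ub_le_sup; last by exists x.
  have sm : smooth (multi_partial c d phi) by rewrite multi_partialE; exact: smooth_iter.
  have [M _ HM] := compact_continuous_bound cK (fun y _ => smooth_continuous sm (I : setT y)).
  by exists M => _ [y Ky <-]; exact: HM.
have aN : (a < N.+1)%N by rewrite ltnS (leq_trans _ abN)// leq_addr.
have bN : (b < N.+1)%N by rewrite ltnS (leq_trans _ abN)// leq_addl.
rewrite /seminorm (bigD1 (Ordinal aN))//= (bigD1 (Ordinal bN))//=.
rewrite -addrA; apply: (@le_trans _ _ (sup [set `|multi_partial a b phi x| | x in K])).
  apply: ub_le_sup; last by exists x.
  have sm : smooth (multi_partial a b phi) by rewrite multi_partialE; exact: smooth_iter.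
  have [M _ HM] := compact_continuous_bound cK (fun y _ => smooth_continuous sm (I : setT y)).
  by exists M => _ [y Ky <-]; exact: HM.
rewrite lerDl addr_ge0// sumr_ge0// => i _; last by rewrite sumr_ge0.
Qed.

(** A supremum that does not exist has the default value 0, so every term is nonnegative in all
    cases. *)
Lemma seminorm_ge0 K N phi : 0 <= seminorm K N phi.
Proof.
apply: sumr_ge0 => a _; apply: sumr_ge0 => b _.
set E := (X in sup X); have [hE|/sup_out ->//] := pselect (has_sup E).
have [[y [x Kx xy]] ubE] := hE.
by apply: (@le_trans _ _ y); [rewrite -xy|apply: ub_le_sup => //; exists x].
Qed.

Lemma seminorm_le K N phi e : smooth phi -> 0 <= e ->
  (forall s, (size s <= N)%N -> forall x, K x -> `|iter_partial s phi x| <= e) ->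
  seminorm K N phi <= (N.+1 * N.+1)%:R * e.
Proof.
move=> sphi e0 H.
have sup_le a b : (a + b <= N)%N -> sup [set `|multi_partial a b phi x| | x in K] <= e.
  move=> abN; have [->|/set0P[y Ky]] := eqVneq K set0.
    by rewrite image_set0 sup0.
  apply: ge_sup; first by exists `|multi_partial a b phi y|, y.
  move=> _ [x Kx <-]; rewrite multi_partialE; apply: H => //.
  by rewrite size_cat !size_nseq.
apply: (@le_trans _ _ (\sum_(a < N.+1) \sum_(b < N.+1) e)).
  apply: ler_sum => a _; rewrite big_mkcond; apply: ler_sum => b _.
  by case: ifP => // abN; exact: sup_le.
by rewrite !sumr_const !card_ord -mulrnA mulr_natl.
Qed.

(** Continuity expressed by a common bound [e] of the derivatives along words of length at most [N],
    instead of suprema. The passage from [seminorm] costs the factor (N + 1)^2 of [seminorm_le],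
    which bounds the number of terms. *)
Definition bounded_dist u K N (C : R) := forall phi, smooth phi -> forall e, 0 <= e ->
  (forall s, (size s <= N)%N -> forall x, K x -> `|iter_partial s phi x| <= e) ->
  `|u phi| <= C * e.

Definition linear_dist u := forall (a : R) phi psi, smooth phi -> smooth psi ->
  u (fun x => a * phi x + psi x) = a * u phi + u psi.

Lemma compact_distributionP u : compact_distribution u <->
  linear_dist u /\ exists K N C, [/\ compact K, 0 <= C & bounded_dist u K N C].
Proof.
split=> -[lin [K [N [C]]]].
  move=> [cK H]; split=> //; exists K, N, (`|C| * (N.+1 * N.+1)%:R); split=> //.
  move=> phi sphi e e0 He; apply: le_trans (H phi sphi) _.
  rewrite -mulrA; apply: le_trans (ler_wpM2l (normr_ge0 C) (seminorm_le sphi e0 He)).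
  apply: ler_wpM2r; last exact: ler_norm.
  exact: seminorm_ge0.
move=> [cK C0 H]; split=> //; exists K, N, C; split=> // phi sphi.
apply: H => //.
  exact: seminorm_ge0.
move=> s sN x Kx; rewrite (iter_partial_multi s openT sphi I).
apply: seminorm_term => //; apply: leq_trans sN.
rewrite -(count_predC (pred1 ord0)) leq_add2l; apply/eq_leq/eq_count => i /=.
by case: (I2P i) => ->.
Qed.

Lemma linear_dist0 u : linear_dist u -> u (fun=> 0) = 0.
Proof.
move=> lin; have := lin 1 (fun=> 0) (fun=> 0) (@smooth_cst _ setT 0) (@smooth_cst _ setT 0).
have -> : (fun _ : R * R => 1 * 0 + 0) = (fun=> 0 : R) by apply/funext => x; rewrite mulr0 addr0.
by move/eqP; rewrite mul1r -subr_eq subrr eq_sym => /eqP.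
Qed.

Lemma linear_distD u phi psi : linear_dist u -> smooth phi -> smooth psi ->
  u (fun x => phi x + psi x) = u phi + u psi.
Proof.
move=> lin sp sq; have := lin 1 _ _ sp sq; rewrite mul1r => <-.
by congr u; apply/funext => x; rewrite mul1r.
Qed.

Lemma linear_distZ u a phi : linear_dist u -> smooth phi ->
  u (fun x => a * phi x) = a * u phi.
Proof.
move=> lin sp; have := lin a _ _ sp (@smooth_cst _ setT 0); rewrite (linear_dist0 lin) addr0 => <-.
by congr u; apply/funext => x; rewrite addr0.
Qed.

Lemma linear_distN u phi : linear_dist u -> smooth phi -> u (fun x => - phi x) = - u phi.
Proof.
move=> lin sp; rewrite -[RHS]mulN1r -linear_distZ//.
by congr u; apply/funext => x; rewrite mulN1r.
Qed.

Lemma linear_distB u phi psi : linear_dist u -> smooth phi -> smooth psi ->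
  u (fun x => phi x - psi x) = u phi - u psi.
Proof.
move=> lin sp sq; rewrite -(linear_distN lin sq).
exact: (linear_distD lin sp (smoothN openT sq)).
Qed.

Lemma linear_dist_sum u (I : Type) (r : seq I) (P : pred I) (F : I -> R * R -> R) :
  linear_dist u -> (forall j, smooth (F j)) ->
  u (fun x => \sum_(j <- r | P j) F j x) = \sum_(j <- r | P j) u (F j).
Proof.
move=> lin sF; elim: r => [|j r IH].
  rewrite [RHS]big_nil; apply: etrans (linear_dist0 lin); congr u; apply/funext => x; by rewrite big_nil.
rewrite big_cons -IH; case E : (P j).
  rewrite -linear_distD//; last exact: smooth_sum openT sF.
  by congr u; apply/funext => x; rewrite big_cons E.
by congr u; apply/funext => x; rewrite big_cons E.
Qed.

Lemma compact_dist0 : compact_distribution (fun _ : R * R -> R => 0 : R).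
Proof.
apply/compact_distributionP; split; first by move=> *; rewrite mulr0 addr0.
exists set0, 0%N, 0; split=> //; first exact: compact0.
by move=> phi _ e e0 _; rewrite normr0 mul0r.
Qed.

Lemma compact_distD u w : compact_distribution u -> compact_distribution w ->
  compact_distribution (fun phi => u phi + w phi).
Proof.
move=> /compact_distributionP[lu [K [N [C [cK C0 H]]]]].
move=> /compact_distributionP[lw [K' [N' [C' [cK' C0' H']]]]].
apply/compact_distributionP; split.
  by move=> a phi psi sp sq; rewrite lu// lw// mulrDr addrACA.
exists (K `|` K'), (maxn N N'), (C + C'); split; [exact: compactU|exact: addr_ge0|].
move=> phi sp e e0 He; rewrite mulrDl (le_trans (ler_normD _ _))//; apply: lerD.
  by apply: H => // s sN x Kx; apply: He; [rewrite leq_max sN|left].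
by apply: H' => // s sN x Kx; apply: He; [rewrite leq_max sN orbT|right].
Qed.

Lemma compact_distZ a u : compact_distribution u ->
  compact_distribution (fun phi => a * u phi).
Proof.
move=> /compact_distributionP[lu [K [N [C [cK C0 H]]]]].
apply/compact_distributionP; split.
  by move=> b phi psi sp sq; rewrite lu// mulrDr mulrCA.
exists K, N, (`|a| * C); split=> //; first exact: mulr_ge0.
by move=> phi sp e e0 He; rewrite normrM -mulrA ler_wpM2l//; exact: H.
Qed.

Lemma compact_dist_sum (I : Type) (r : seq I) (P : pred I) (F : I -> functional R) :
  (forall j, compact_distribution (F j)) ->
  compact_distribution (fun phi => \sum_(j <- r | P j) F j phi).
Proof.
move=> cF; elim: r => [|j r IH].
  rewrite (_ : (fun phi => _) = (fun _ : R * R -> R => 0)); first exact: compact_dist0.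
  by apply/funext => phi; rewrite big_nil.
have H := compact_distD (cF j) IH.
have -> : (fun phi => \sum_(k <- j :: r | P k) F k phi) =
    if P j then fun phi => F j phi + \sum_(k <- r | P k) F k phi
    else fun phi => \sum_(k <- r | P k) F k phi.
  by apply/funext => phi; rewrite big_cons; case: (P j).
by case: (P j); [exact: H|exact: IH].
Qed.

Lemma partialD f g i : smooth f -> smooth g ->
  partial i (fun x => f x + g x) = (fun x => partial i f x + partial i g x).
Proof.
move=> sf sg; apply/funext => x.
exact: partialD_at (smooth_derivable sf I) (smooth_derivable sg I).
Qed.

Lemma partialM f g i : smooth f -> smooth g ->
  partial i (fun x => f x * g x) = (fun x => partial i f x * g x + f x * partial i g x).
Proof.
move=> sf sg; apply/funext => x.
exact: partialM_at (smooth_derivable sf I) (smooth_derivable sg I).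
Qed.

Lemma partialZ (a : R) f i : smooth f ->
  partial i (fun x => a * f x) = (fun x => a * partial i f x).
Proof.
move=> sf; rewrite (partialM _ (@smooth_cst _ setT a) sf) partial_cst.
by apply/funext => x; rewrite mul0r add0r.
Qed.

Lemma partialZD (a : R) f g i : smooth f -> smooth g ->
  partial i (fun x => a * f x + g x) = (fun x => a * partial i f x + partial i g x).
Proof. by move=> sf sg; rewrite (partialD _ (smoothZ a openT sf) sg) (partialZ a _ sf). Qed.

Lemma iter_partialZD (a : R) f g s : smooth f -> smooth g ->
  iter_partial s (fun x => a * f x + g x) = (fun x => a * iter_partial s f x + iter_partial s g x).
Proof.
move=> sf sg; elim: s => [//|i s IH] /=.
by rewrite IH (partialZD a _ (smooth_iter s sf) (smooth_iter s sg)).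
Qed.

Lemma iter_partialB f g s : smooth f -> smooth g ->
  iter_partial s (fun x => f x - g x) = (fun x => iter_partial s f x - iter_partial s g x).
Proof.
move=> sf sg; have := iter_partialZD (-1) s sg sf.
have -> : (fun x => -1 * g x + f x) = (fun x => f x - g x).
  by apply/funext => x; rewrite mulN1r addrC.
by move=> ->; apply/funext => x; rewrite mulN1r addrC.
Qed.

Lemma compact_partial_dist i u : compact_distribution u ->
  compact_distribution (partial_dist i u).
Proof.
move=> /compact_distributionP[lu [K [N [C [cK C0 H]]]]].
apply/compact_distributionP; split.
  move=> a phi psi sp sq; rewrite /partial_dist partialZD//.
  by rewrite (lu a _ _ (smooth_partial i sp) (smooth_partial i sq)) opprD mulrN.
exists K, N.+1, C; split=> // phi sp e e0 He.
rewrite /partial_dist normrN; apply: (H _ (smooth_partial i sp) e e0).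
by move=> s sN x Kx; rewrite -iter_partial_rcons; apply: He; rewrite ?size_rcons.
Qed.

(** A Leibniz estimate, pointwise in [x]: only the derivatives of [phi] at the same point and up to
    the same order enter. The induction peels off the innermost letter, after which [f] and its two
    partial derivatives are needed one order lower, whence the three constants. *)
Lemma mul_bound K f N : compact K -> smooth f -> exists2 C, 0 <= C &
  forall phi, smooth phi -> forall e, 0 <= e -> forall s x, (size s <= N)%N -> K x ->
  (forall t, (size t <= size s)%N -> `|iter_partial t phi x| <= e) ->
  `|iter_partial s (fun x => f x * phi x) x| <= C * e.
Proof.
move=> cK; elim: N f => [|N IH] f sf;
  have [M M0 HM] := compact_continuous_bound cK (fun y _ => smooth_continuous sf (I : setT y)).
  exists M => // phi sp e e0 [|//] x _ Kx H; rewrite /= normrM.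
  by apply: ler_pM => //; [exact: HM|exact: (H [::])].
have [C0 C00 H0] := IH _ (smooth_partial ord0 sf).
have [C1 C10 H1] := IH _ (smooth_partial ord_max sf).
have [C2 C20 H2] := IH _ sf.
exists (M + (C0 + C1 + C2)); first by rewrite !addr_ge0.
move=> phi sp e e0 s x; rewrite mulrDl; case/lastP: s => [|s i] sN Kx H.
  rewrite -[leLHS]addr0 /= normrM; apply: lerD; last by rewrite mulr_ge0// !addr_ge0.
  by apply: ler_pM => //; [exact: HM|exact: (H [::])].
have spi := smooth_partial i sp; have sfi := smooth_partial i sf.
rewrite -[leLHS]add0r; apply: lerD; first exact: mulr_ge0.
rewrite size_rcons ltnS in sN.
rewrite iter_partial_rcons partialM//.
have -> : (fun x => partial i f x * phi x + f x * partial i phi x) =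
   (fun x => 1 * (partial i f x * phi x) + f x * partial i phi x).
  by apply/funext => y; rewrite mul1r.
rewrite (iter_partialZD 1 s (smoothM openT sfi sp) (smoothM openT sf spi)).
rewrite mul1r mulrDl (le_trans (ler_normD _ _))//; apply: lerD; last first.
  apply: (H2 _ spi e e0 s x sN Kx) => t ts; rewrite -iter_partial_rcons; apply: H.
  by rewrite !size_rcons.
have Ht t : (size t <= size s)%N -> `|iter_partial t phi x| <= e.
  by move=> ts; apply: H; rewrite size_rcons ltnW.
have HC (C : R) : 0 <= C -> 0 <= C * e by move=> ?; exact: mulr_ge0.
rewrite mulrDl; case: (I2P i) => ->.
  by apply: le_trans (H0 _ sp e e0 s x sN Kx Ht) _; rewrite lerDl HC.
by apply: le_trans (H1 _ sp e e0 s x sN Kx Ht) _; rewrite lerDr HC.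
Qed.

End cdist.

(** * Integrals depending on parameters *)

Section measurable_plane.
Context {R : realType}.

(** An open set is the union of the open squares with rational centre and half-side that it
    contains. Squares not contained are replaced by the empty set, so that the union runs over all
    rational triples. *)
Lemma open_measurable_plane (U : set (R * R)) : open U -> measurable U.
Proof.
move=> oU.
pose B (a b r : rat) : set (R * R) :=
  `]ratr a - ratr r, ratr a + ratr r[%classic `*` `]ratr b - ratr r, ratr b + ratr r[%classic.
have -> : U = \bigcup_a \bigcup_b \bigcup_r (if `[< B a b r `<=` U >] then B a b r else set0).
  apply/seteqP; split=> [[x y] Uxy|z [a _ [b _ [r _]]]]; last first.
    by case: asboolP => // BU /BU.
  have /nbhs_ballP[e /= e0 He] : nbhs (x, y) U by exact: open_nbhs_nbhs.
  have e20 : 0 < e / 2 by rewrite divr_gt0.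
  have [r rI] : exists r : rat, ratr r \in `]0, e / 2[.
    by have [r H] := rat_in_itvoo e20; exists r.
  have r0 : 0 < ratr r :> R by rewrite (itvP rI).
  have [a aI] : exists a : rat, ratr a \in `](x - ratr r), (x + ratr r)[.
    by have [|a H] := @rat_in_itvoo R (x - ratr r) (x + ratr r); [lra|exists a].
  have [b bI] : exists a : rat, ratr a \in `](y - ratr r), (y + ratr r)[.
    by have [|b H] := @rat_in_itvoo R (y - ratr r) (y + ratr r); [lra|exists b].
  move: rI aI bI; rewrite !in_itv /= => /andP[r1 r2] /andP[a1 a2] /andP[b1 b2].
  exists a => //; exists b => //; exists r => //; case: asboolP => [_|[]].
    by split; rewrite /= in_itv /=; apply/andP; split; lra.
  move=> [s t] [/=]; rewrite !in_itv /= => /andP[s1 s2] /andP[t1 t2].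
  by apply: He; split; rewrite /ball /= ltr_norml; apply/andP; split; lra.
do 3 (apply: bigcupT_measurable_rat => ?).
case: asboolP => _; last exact: measurable0.
by apply: measurableX; exact: measurable_itv.
Qed.

Lemma continuous_measurable_plane (f : R * R -> R) : continuous f -> measurable_fun setT f.
Proof.
move=> /continuousP cf; apply: (measurability _ (measurable_realfun.RGenOpens.measurableE R)).
move=> _ [_ [a [b ->] <-]]; rewrite setTI; apply: open_measurable_plane.
by apply: cf; exact: interval_open.
Qed.

Lemma compact_box (r : R) : compact [set x : R * R | `|x.1| <= r /\ `|x.2| <= r].
Proof.
have -> : [set x : R * R | `|x.1| <= r /\ `|x.2| <= r] = `[- r, r]%classic `*` `[- r, r]%classic.
  by apply/seteqP; split=> -[x y] /=; rewrite !in_itv /= -!ler_norml.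
by apply: compact_setX; exact: segment_compact.
Qed.

Lemma is_derive_slice1 (f : R * R -> R) (a b d : R) :
  is_derive (a, b) (basis_vec R ord0) f d <-> is_derive a 1 (fun t => f (t, b)) d.
Proof.
have E (s : R) : s *: basis_vec R ord0 + (0, b) = (s, b).
  rewrite /basis_vec eqxx; congr pair => /=; first by rewrite addr0 [_%:A]mulr1.
  by rewrite scaler0 add0r.
have := @is_derive_line R f (0, b) (basis_vec R ord0) a d; rewrite E.
by have -> : (fun s : R => f (s *: basis_vec R ord0 + (0, b))) = (fun s => f (s, b))
  by apply/funext => s; rewrite E.
Qed.

Lemma is_derive_slice2 (f : R * R -> R) (a b d : R) :
  is_derive (a, b) (basis_vec R ord_max) f d <-> is_derive b 1 (fun t => f (a, t)) d.
Proof.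
have E (s : R) : s *: basis_vec R ord_max + (a, 0) = (a, s).
  rewrite /basis_vec /=; congr pair => /=; last by rewrite addr0 [_%:A]mulr1.
  by rewrite scaler0 add0r.
have := @is_derive_line R f (a, 0) (basis_vec R ord_max) b d; rewrite E.
by have -> : (fun s : R => f (s *: basis_vec R ord_max + (a, 0))) = (fun s => f (a, s))
  by apply/funext => s; rewrite E.
Qed.

(** Bounded partial derivatives give a Lipschitz estimate along the two sides of a rectangle. In
    [smooth_param] this yields the continuity of parameter integrals from a bound on their
    derivatives. *)
Lemma bounded_partial_continuous (f : R * R -> R) (x : R * R) (r C : R) : 0 < r ->
  (forall y, ball x r y -> forall i, derivable f y (basis_vec R i) /\ `|partial i f y| <= C) ->
  {for x, continuous f}.
Proof.
move=> r0 H.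
suff near_le e : 0 < e -> \forall y \near x, `|f x - f y| <= e.
  by apply/cvgrPdist_le => e; exact: near_le.
move=> e0.
have C0 : 0 <= C by apply: le_trans (H x (ballxx _ r0) ord0).2.
pose d := Num.min (r / 2) (e / 2 / (C + 1)).
have d0 : 0 < d by rewrite lt_min !divr_gt0// ltr_wpDl.

apply/nbhs_ballP; exists d; first exact: d0.
case: x H => a b H -[a' b'] [/=]; rewrite /ball /= => Ha Hb.
have dr : d < r.
  by apply: le_lt_trans (_ : r / 2 < r); [rewrite ge_min lexx|lra].
have dC : C * d <= e / 2.
  apply: (@le_trans _ _ ((C + 1) * d)); first by rewrite ler_pM2r//; lra.
  rewrite -ler_pdivlMl; last by lra.
  by rewrite mulrC ge_min lexx orbT.
have Hball (s t : R) : `|s - a| <= d -> `|t - b| <= d -> ball (a, b) r (s, t).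
  by move=> H1 H2; split; rewrite /ball /= distrC; [exact: le_lt_trans H1 _|exact: le_lt_trans H2 _].
rewrite distrC in Ha; rewrite distrC in Hb.
have z : `|b - b| <= d by rewrite subrr normr0 ltW.
have [s Hs Es] := @MVT1 R f a a' b' (fun s Hs => (H _ (Hball s b' (le_trans Hs (ltW Ha)) (ltW Hb)) ord0).1).
have z' : `|a - a| <= d by rewrite subrr normr0 ltW.
have [t Ht Et] := @MVT2 R f a b b' (fun s Hs => (H _ (Hball a s z' (le_trans Hs (ltW Hb))) ord_max).1).
have Bs := (H _ (Hball s b' (le_trans Hs (ltW Ha)) (ltW Hb)) ord0).2.
have Bt := (H _ (Hball a t z' (le_trans Ht (ltW Hb))) ord_max).2.
have -> : f (a, b) - f (a', b') = - ((f (a', b') - f (a, b')) + (f (a, b') - f (a, b))) by ring.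
rewrite Es Et normrN (le_trans (ler_normD _ _))// [leRHS](splitr e) !normrM.
by apply: lerD; apply: le_trans dC; rewrite mulrC; apply: ler_pM => //; exact: ltW.
Qed.

End measurable_plane.

Lemma smooth_is_derive_comp2 (R : realType) (W : normedModType R) (b : R * R -> R)
    (g1 g2 : W -> R) (y v : W) (d1 d2 : R) : smooth b ->
  is_derive y v g1 d1 -> is_derive y v g2 d2 ->
  is_derive y v (fun z => b (g1 z, g2 z))
    (d1 * partial ord0 b (g1 y, g2 y) + d2 * partial ord_max b (g1 y, g2 y)).
Proof.
move=> sb; apply: is_derive_comp2.
  by apply: filterE => z i; exact: (smooth_derivable sb (I : setT z)).
by move=> i; exact: (smooth_continuous (smooth_partial i sb) (I : setT _)).
Qed.

Section param_integral.
Context {R : realType} d {Y : measurableType d} (mu : {measure set Y -> \bar R}).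
Variables (D : set Y) (p q al be : Y -> R) (B : R).
Hypotheses (mD : measurable D) (mp : measurable_fun setT p) (mq : measurable_fun setT q)
  (mal : measurable_fun setT al) (mbe : measurable_fun setT be).
Hypotheses (pB : forall z, D z -> `|p z| <= B) (qB : forall z, D z -> `|q z| <= B)
  (alB : forall z, D z -> `|al z| <= B) (beB : forall z, D z -> `|be z| <= B).

(** The affine arguments cover primitives, with p = q = 0 and scaling factors [al], [be], as well as
    convolutions, with p and q the coordinates of the integration variable and al = be = 1 or -1,
    according to whether the derivatives fall on the test function or on the kernel. *)
Definition param_integral (w : Y -> R) (b : R * R -> R) (x : R * R) : R :=
  \int[mu]_(z in D) (w z * b (p z + al z * x.1, q z + be z * x.2)).

Implicit Types (w : Y -> R) (b : R * R -> R) (x : R * R).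

Lemma integrable_mul_bounded w (h : Y -> R) (C : R) : mu.-integrable D (EFin \o w) ->
  measurable_fun D h -> (forall z, D z -> `|h z| <= C) ->
  mu.-integrable D (EFin \o (fun z => w z * h z)).
Proof.
move=> iw mh hC.
have mw : measurable_fun D w by apply/measurable_EFinP; exact: measurable_int iw.
have := integrableZl mD C iw; apply: le_integrable => //.
  by apply/measurable_EFinP; exact: measurable_funM.
move=> z Dz; rewrite /= lee_fin !normrM mulrC ler_wpM2r//.
exact: le_trans (hC z Dz) (ler_norm _).
Qed.

Lemma measurable_param b x : continuous b ->
  measurable_fun setT (fun z => b (p z + al z * x.1, q z + be z * x.2)).
Proof.
move=> cb; apply: (measurableT_comp (continuous_measurable_plane cb)).
by apply: measurable_fun_pair; apply: measurable_funD => //; apply: measurable_funM.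
Qed.

Lemma smooth_continuousT b : smooth b -> continuous b.
Proof. by move=> sb x; exact: smooth_continuous sb (I : setT x). Qed.

Lemma param_bound b r : continuous b -> exists2 C, 0 <= C &
  forall x z, `|x.1| <= r -> `|x.2| <= r -> D z ->
   `|b (p z + al z * x.1, q z + be z * x.2)| <= C.
Proof.
move=> cb; have [C C0 HC] := compact_continuous_bound (@compact_box R (B + B * r)) (fun y _ => cb y).
exists C => // x z x1 x2 Dz; apply: HC; split => /=.
  apply: le_trans (ler_normD _ _) _; apply: lerD; first exact: pB.
  by rewrite normrM; apply: ler_pM => //; exact: alB.
apply: le_trans (ler_normD _ _) _; apply: lerD; first exact: qB.
by rewrite normrM; apply: ler_pM => //; exact: beB.
Qed.

Lemma integrable_param w b x : mu.-integrable D (EFin \o w) -> continuous b ->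
  mu.-integrable D (EFin \o (fun z => w z * b (p z + al z * x.1, q z + be z * x.2))).
Proof.
move=> iw cb; have [C C0 HC] := @param_bound b (Num.max `|x.1| `|x.2|) cb.
apply: (@integrable_mul_bounded _ _ C) => //.
  by apply: measurable_funTS; exact: measurable_param.
by move=> z Dz; apply: HC => //; rewrite le_max lexx ?orbT.
Qed.

Lemma param_integral_bound w b x C : mu.-integrable D (EFin \o w) -> continuous b ->
  (forall z, D z -> `|b (p z + al z * x.1, q z + be z * x.2)| <= C) ->
  `|param_integral w b x| <= (\int[mu]_(z in D) `|w z|) * C.
Proof.
move=> iw cb HC; have iwb := integrable_param x iw cb.
apply: le_trans (le_normr_Rintegral mD iwb) _.
rewrite -RintegralZr//; last exact: integrable_norm.
apply: le_Rintegral => //; first exact: integrable_norm.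
  have := integrableZr mD C (integrable_norm iw).
  by apply: eq_integrable.
by move=> z Dz; rewrite normrM ler_wpM2l//; exact: HC.
Qed.

Lemma is_derive_param1 w b (x1 x2 : R) : mu.-integrable D (EFin \o w) -> smooth b ->
  is_derive (x1, x2) (basis_vec R ord0) (param_integral w b)
    (param_integral (fun z => w z * al z) (partial ord0 b) (x1, x2)).
Proof.
move=> iw sb; apply/is_derive_slice1.
pose f (t : R) z : R := w z * b (p z + al z * t, q z + be z * x2).
have Df (t : R) z : is_derive t 1 (f ^~ z) (w z * al z * partial ord0 b (p z + al z * t, q z + be z * x2)).
  have D1 : is_derive t 1 (fun s : R => p z + al z * s) (al z).
    have H1 := is_deriveD (is_derive_cst (p z) t 1)
      (is_deriveM (is_derive_cst (al z) t 1) (is_derive_id t 1)).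
    by apply: is_derive_eq H1 _; rewrite /GRing.scale /= mulr1 mulr0 addr0 add0r.
  have D2 : is_derive t 1 (fun s : R => q z + be z * x2) 0 by exact: is_derive_cst.
  have D3 := smooth_is_derive_comp2 sb D1 D2.
  have D4 := is_deriveM (is_derive_cst (w z) t 1) D3.
  apply: is_derive_eq D4 _; rewrite /GRing.scale /=; ring.
have d1f (t : R) z : partial1of2 f t z = w z * al z * partial ord0 b (p z + al z * t, q z + be z * x2).
  by rewrite partial1of2E; exact: (@derive_val _ _ _ _ _ _ _ (Df t z)).
have ia : x1 \in `]x1 - 1, x1 + 1[ by rewrite in_itv /=; apply/andP; split; lra.
have cb := smooth_continuousT sb.
have c0b := smooth_continuousT (smooth_partial ord0 sb).
(* The radius |x1| + 1 serves every t in ]x1 - 1, x1 + 1[, so [G] below dominates the derivative on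
   the whole interval. *)
have [C C0 HC] := @param_bound _ (Num.max (`|x1| + 1) `|x2|) c0b.
have iwa : mu.-integrable D (EFin \o (fun z => w z * al z)).
  by apply: integrable_mul_bounded iw _ alB; exact: measurable_funTS.
have intf (t : R) : `](x1 - 1), (x1 + 1)[%classic t -> mu.-integrable D (EFin \o f t).
  by move=> _; exact: (integrable_param (t, x2) iw cb).
pose G z : R := `|w z * al z| * C.
have G0 z : 0 <= G z by exact: mulr_ge0.
have iG : mu.-integrable D (EFin \o G).
  have := integrableZr mD C (integrable_norm iwa).
  by apply: eq_integrable.
have Gub (t : R) z : `](x1 - 1), (x1 + 1)[%classic t -> D z -> `|partial1of2 f t z| <= G z.
  rewrite /= in_itv /= => /andP[t1 t2] Dz; rewrite d1f normrM ler_wpM2l//.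
  apply: (HC (t, x2) z) => //=; last by rewrite le_max lexx orbT.
  rewrite le_max; apply/orP; left.
  rewrite -[t](subrK x1) addrC (le_trans (ler_normD _ _))// lerD2l ler_norml.
  by apply/andP; split; lra.
have der (t : R) z : `](x1 - 1), (x1 + 1)[%classic t -> D z -> derivable (f^~ z) t 1.
  by move=> _ _; case: (Df t z).
have R1 := derivable_under_integral mD ia intf der G0 iG Gub.
have R2 := differentiation_under_integral mD ia intf der G0 iG Gub.
split; first exact: R1.
rewrite -derive1E R2 /param_integral; apply: eq_Rintegral => z _; exact: d1f.
Qed.

End param_integral.

Section smooth_param.
Context {R : realType} d {Y : measurableType d} (mu : {measure set Y -> \bar R}).
Variables (D : set Y) (p q al be : Y -> R) (B : R).
Hypotheses (mD : measurable D) (mp : measurable_fun setT p) (mq : measurable_fun setT q)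
  (mal : measurable_fun setT al) (mbe : measurable_fun setT be).
Hypotheses (pB : forall z, D z -> `|p z| <= B) (qB : forall z, D z -> `|q z| <= B)
  (alB : forall z, D z -> `|al z| <= B) (beB : forall z, D z -> `|be z| <= B).
Implicit Types (w : Y -> R) (b : R * R -> R) (x : R * R).
Local Notation PI := (param_integral mu D p q al be).

Lemma smooth_swap b : smooth b -> smooth (fun x => b (x.2, x.1)).
Proof.
by move=> sb; apply: (smooth_comp openT openT sb (@smooth_snd _ setT) (@smooth_fst _ setT)).
Qed.

(** This is the first-variable case for [b] with its two arguments exchanged, and with [p], [al]
    exchanged for [q], [be]. *)
Lemma is_derive_param2 w b (x1 x2 : R) : mu.-integrable D (EFin \o w) -> smooth b ->
  is_derive (x1, x2) (basis_vec R ord_max) (PI w b)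
    (PI (fun z => w z * be z) (partial ord_max b) (x1, x2)).
Proof.
move=> iw sb; apply/is_derive_slice2.
have /is_derive_slice1 := is_derive_param1 mD mq mp mbe mal qB pB beB alB x2 x1 iw (smooth_swap sb).
by congr (is_derive _ _ _ _).
Qed.

Lemma partial_param i w b : mu.-integrable D (EFin \o w) -> smooth b ->
  partial i (PI w b) = PI (fun z => w z * (if i == ord0 then al z else be z)) (partial i b).
Proof.
move=> iw sb; apply/funext => -[x1 x2]; case: (I2P i) => ->.
  exact: (@derive_val _ _ _ _ _ _ _ (is_derive_param1 mD mp mq mal mbe pB qB alB beB x1 x2 iw sb)).
exact: (@derive_val _ _ _ _ _ _ _ (is_derive_param2 x1 x2 iw sb)).
Qed.

Lemma integrable_weight (i : 'I_2) w : mu.-integrable D (EFin \o w) ->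
  mu.-integrable D (EFin \o (fun z => w z * (if i == ord0 then al z else be z))).
Proof.
by move=> iw; case: (i == ord0); apply: (integrable_mul_bounded mD iw (C := B)) => //; exact: measurable_funTS.
Qed.

(** Parameter integrals are closed under differentiation: [b] becomes a partial derivative and [w]
    is multiplied by [al] or [be]. The induction on the order therefore runs over all [w] and
    [b]. *)
Lemma smooth_param w b : mu.-integrable D (EFin \o w) -> smooth b -> smooth (PI w b).
Proof.
move=> iw sb; apply/smooth_onP => n; elim: n w b iw sb => [//|n IH] w b iw sb.
have der i x : derivable (PI w b) x (basis_vec R i).
  case: x => x1 x2; case: (I2P i) => ->.
    by case: (is_derive_param1 mD mp mq mal mbe pB qB alB beB x1 x2 iw sb).
  by case: (is_derive_param2 x1 x2 iw sb).
split=> [x _|i x _|i]; [|exact: der|]; last first.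
  by rewrite partial_param//; apply: IH; [exact: integrable_weight|exact: smooth_partial].
have bnd i : exists C, forall y, ball x 1 y -> `|partial i (PI w b) y| <= C.
  have cb := smooth_continuousT (smooth_partial i sb).
  have [C C0 HC] := param_bound pB qB alB beB (Num.max (`|x.1| + 1) (`|x.2| + 1)) cb.
  exists ((\int[mu]_(z in D) `|w z * (if i == ord0 then al z else be z)|) * C) => y [y1 y2].
  rewrite partial_param//; apply: (param_integral_bound mD mp mq mal mbe pB qB alB beB (integrable_weight i iw) cb).
  have near_le (s t : R) : ball s 1 t -> `|t| <= `|s| + 1.
    rewrite /ball /= distrC => H; rewrite -[t](subrK s) addrC.
    by apply: le_trans (ler_normD _ _) _; rewrite lerD2l ltW.
  move=> z Dz; apply: HC Dz; rewrite le_max.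
    by apply/orP; left; exact: near_le y1.
  by apply/orP; right; exact: near_le y2.
have [C0 H0] := bnd ord0; have [C1 H1] := bnd ord_max.
apply: (@bounded_partial_continuous _ _ _ 1 (Num.max C0 C1)) => // y xy i.
split; first exact: der.
by rewrite le_max; case: (I2P i) => ->; apply/orP; [left; exact: H0|right; exact: H1].
Qed.

End smooth_param.

(** * Division by a first order symbol *)

Section antiderivative.
Context {R : realType}.
Implicit Types (phi psi : R * R -> R) (x : R * R) (i j : 'I_2).
Local Notation mu := (@lebesgue_measure R).

Definition xcoord i (x : R * R) : R := if i == ord0 then x.1 else x.2.

Local Notation Y := (measurableTypeR R).
Let sc i j (s : Y) : R := if i == j then s else 1.
Local Notation D := (`[0, 1]%classic : set Y).
Local Notation PI i := (@param_integral R _ Y mu D (cst 0) (cst 0) (sc i ord0) (sc i ord_max)).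

(** The primitive in direction [i] that vanishes for x_i = 0, with the interval from 0 to x_i
    rescaled to [0, 1]: the domain of integration is fixed and [param_integral] applies. *)
Definition antiderivative i phi (x : R * R) : R := xcoord i x * PI i (cst 1) phi x.

Let mD : measurable D. Proof. exact: measurable_itv. Qed.
Let m0 : measurable_fun (setT : set Y) (cst 0 : Y -> R). Proof. exact: measurable_cst. Qed.
Let msc i j : measurable_fun (setT : set Y) (sc i j).
Proof. by rewrite /sc; case: (i == j); [exact: measurable_id|exact: measurable_cst]. Qed.
Let b0 : forall s : Y, D s -> `|(cst 0 : Y -> R) s| <= 1.
Proof. by move=> s _; rewrite normr0. Qed.
Let bsc i j : forall s : Y, D s -> `|sc i j s| <= 1.
Proof.
move=> s /=; rewrite in_itv /= => /andP[s0 s1]; rewrite /sc; case: ifP => _.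
  by rewrite ger0_norm.
by rewrite normr1.
Qed.
Let i1 : mu.-integrable D (EFin \o (cst 1 : Y -> R)).
Proof.
apply: continuous_compact_integrable; first exact: segment_compact.
by apply: continuous_subspaceT => s; exact: cvg_cst.
Qed.

Lemma smooth_coord i : smooth (xcoord i).
Proof. by rewrite /xcoord; case: (i == ord0); [exact: smooth_fst|exact: smooth_snd]. Qed.

Lemma partial_coord i j : partial j (xcoord i) = fun=> (i == j)%:R.
Proof.
rewrite /xcoord; case: (I2P i) => ->; case: (I2P j) => -> /=;
  by rewrite ?partial_fst ?partial_snd.
Qed.

Let smoothPI i w phi : mu.-integrable D (EFin \o w) -> smooth phi -> smooth (PI i w phi).
Proof. exact: (smooth_param mD m0 m0 (msc i ord0) (msc i ord_max) b0 b0 (@bsc i ord0) (@bsc i ord_max)). Qed.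

Let partialPI i j w phi : mu.-integrable D (EFin \o w) -> smooth phi ->
  partial j (PI i w phi) = PI i (fun s => w s * sc i j s) (partial j phi).
Proof.
move=> iw sp; rewrite (partial_param mD m0 m0 (msc i ord0) (msc i ord_max) b0 b0 (@bsc i ord0) (@bsc i ord_max) j iw sp).
by case: (I2P j) => ->.
Qed.

Let iweight i j w : mu.-integrable D (EFin \o w) -> mu.-integrable D (EFin \o (fun s => w s * sc i j s)).
Proof.
move=> iw; apply: (integrable_mul_bounded mD iw (C := 1)); last exact: bsc.
by apply: measurable_funTS; exact: msc.
Qed.

Lemma smooth_antiderivative i phi : smooth phi -> smooth (antiderivative i phi).
Proof. by move=> sp; apply: (smoothM openT (smooth_coord i) (smoothPI i i1 sp)). Qed.

Let iPI i w phi x : mu.-integrable D (EFin \o w) -> smooth phi ->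
  mu.-integrable D (EFin \o (fun z => w z * phi (cst 0 z + sc i ord0 z * x.1, cst 0 z + sc i ord_max z * x.2))).
Proof.
move=> iw sp.
exact: (integrable_param mD m0 m0 (msc i ord0) (msc i ord_max) b0 b0 (@bsc i ord0) (@bsc i ord_max) x iw (smooth_continuousT sp)).
Qed.

Lemma antiderivativeZD i (a : R) phi psi : smooth phi -> smooth psi ->
  antiderivative i (fun x => a * phi x + psi x) =
  fun x => a * antiderivative i phi x + antiderivative i psi x.
Proof.
move=> sp sq; apply/funext => x; rewrite /antiderivative mulrCA -mulrDr; congr (_ * _).
have ip := iPI i x i1 sp; have iq := iPI i x i1 sq.
rewrite /param_integral -(RintegralZl _ mD ip) -(RintegralD mD _ iq).
  by apply: eq_Rintegral => s _; rewrite mulrDr; congr (_ + _); rewrite mulrCA.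
exact: (eq_integrable _ _ _ _ (integrableZl mD a ip)).
Qed.

Lemma partial_antiderivative_neq i j phi : i != j -> smooth phi ->
  partial j (antiderivative i phi) = antiderivative i (partial j phi).
Proof.
move=> /negbTE ij sp; rewrite /antiderivative.
rewrite (partialM _ (smooth_coord i) (smoothPI i i1 sp)) partial_coord ij.
apply/funext => x; rewrite mul0r add0r (partialPI _ _ i1 sp); congr (_ * PI i _ _ _).
by apply/funext => s; rewrite /sc ij mulr1.
Qed.

(** The derivative is the integral over s in [0, 1] of phi + s x_i d_i phi at the scaled point. This
    integrand is the s-derivative of s phi(scaled point), so the fundamental theorem of calculus
    leaves the value at s = 1. *)
Lemma partial_antiderivative i phi : smooth phi -> partial i (antiderivative i phi) = phi.
Proof.
move=> sp; rewrite /antiderivative.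
rewrite (partialM _ (smooth_coord i) (smoothPI i i1 sp)) partial_coord eqxx.
apply/funext => x; rewrite mul1r (partialPI _ _ i1 sp).
have spi := smooth_partial i sp.
have ip := iPI i x i1 sp; have iq := iPI i x (iweight i i i1) spi.
rewrite {1 2}/param_integral -(RintegralZl _ mD iq) -(RintegralD mD ip); last first.
  exact: (eq_integrable _ _ _ _ (integrableZl mD _ iq)).
pose g1 s : R := 0 + sc i ord0 s * x.1.
pose g2 s : R := 0 + sc i ord_max s * x.2.
have Dsc j (s : R) : is_derive s 1 (sc i j) (i == j)%:R.
  by rewrite /sc; case: (i == j); [exact: is_derive_id|exact: is_derive_cst].
have D1 (s : R) : is_derive s 1 g1 ((i == ord0)%:R * x.1).
  have H := is_deriveD (is_derive_cst 0 s 1) (is_deriveM (Dsc ord0 s) (is_derive_cst x.1 s 1)).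
  by apply: is_derive_eq H _; rewrite /GRing.scale /= mulr0 !add0r mulrC.
have D2 (s : R) : is_derive s 1 g2 ((i == ord_max)%:R * x.2).
  have H := is_deriveD (is_derive_cst 0 s 1) (is_deriveM (Dsc ord_max s) (is_derive_cst x.2 s 1)).
  by apply: is_derive_eq H _; rewrite /GRing.scale /= mulr0 !add0r mulrC.
have Dphi psi (s : R) : smooth psi -> is_derive s 1 (fun s => psi (g1 s, g2 s))
    (xcoord i x * partial i psi (g1 s, g2 s)).
  move=> sq; have H := smooth_is_derive_comp2 sq (D1 s) (D2 s).
  apply: is_derive_eq H _; rewrite /xcoord.
  by case: (I2P i) => -> /=; rewrite !mul1r !mul0r ?addr0 ?add0r.
have cphi psi (s : R) : smooth psi -> {for s, continuous (fun s => psi (g1 s, g2 s))}.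
  move=> sq; apply/differentiable_continuous/derivable1_diffP.
  by case: (Dphi psi s sq).
pose f (s : R) : R := phi (g1 s, g2 s) + s * (xcoord i x * partial i phi (g1 s, g2 s)).
pose F (s : R) : R := s * phi (g1 s, g2 s).
have DF (s : R) : is_derive s 1 F (f s).
  have H := is_deriveM (is_derive_id s 1) (Dphi phi s sp).
  by apply: is_derive_eq H _; rewrite /GRing.scale /= mulr1 addrC.
have cf : continuous f.
  move=> s; apply: cvgD; first exact: cphi.
  apply: cvgM; first exact: cvg_id.
  by apply: cvgM; [exact: cvg_cst|exact: cphi].
have cF : continuous F.
  by move=> s; apply: cvgM; [exact: cvg_id|exact: cphi].
have FTC := @continuous_FTC2 R f F 0 1 ltr01 (continuous_subspaceT cf).
transitivity (\int[mu]_(s in D) f s).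
  apply: eq_Rintegral => s _; rewrite /f /cst !mul1r; congr (_ + _).
  by rewrite {1}/sc eqxx mulrCA.
rewrite /Rintegral FTC //=.
- rewrite /F mul1r mul0r subr0 /g1 /g2 /sc !add0r; case: x {ip iq g1 g2 D1 D2 Dphi cphi f F DF cf cF FTC} => a b /=.
  by case: (i == ord0); case: (i == ord_max); rewrite !mul1r.
- split; first by move=> s _; case: (DF s).
    exact/cvg_at_right_filter/cF.
  exact/cvg_at_left_filter/cF.
- by move=> s _; rewrite derive1E; exact: (@derive_val _ _ _ _ _ _ _ (DF s)).
Qed.

Let iterPI i s w phi : mu.-integrable D (EFin \o w) -> (forall z, D z -> `|w z| <= 1) -> smooth phi ->
  exists w', [/\ mu.-integrable D (EFin \o w'), forall z, D z -> `|w' z| <= 1 &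
    iter_partial s (PI i w phi) = PI i w' (iter_partial s phi)].
Proof.
elim/last_ind: s w phi => [|s j IH] w phi iw bw sp; first by exists w.
have bw' z : D z -> `|w z * sc i j z| <= 1.
  move=> Dz; rewrite normrM -[leRHS]mul1r; apply: ler_pM => //; first exact: bw.
  exact: bsc.
have [w' [iw' bw'' E]] := IH _ _ (iweight i j iw) bw' (smooth_partial j sp).
exists w'; split=> //.
by rewrite !iter_partial_rcons -E (partialPI _ _ iw sp).
Qed.

Lemma compact_subbox (K : set (R * R)) : compact K ->
  exists2 r, 0 <= r & K `<=` [set x : R * R | `|x.1| <= r /\ `|x.2| <= r].
Proof.
move=> cK.
have [a a0 Ha] := compact_continuous_bound cK (fun y _ => smooth_continuousT (@smooth_fst R setT) (x := y)).
have [b b0' Hb] := compact_continuous_bound cK (fun y _ => smooth_continuousT (@smooth_snd R setT) (x := y)).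
exists (Num.max a b); first by rewrite le_max a0.
move=> x Kx; split; first by rewrite le_max Ha.
by rewrite le_max Hb// orbT.
Qed.

(** Scaling a coordinate by s in [0, 1] preserves a box centred at 0, so a box around [K] serves as
    [K']. The weights created by differentiation stay at most 1 in absolute value, and the order
    does not grow. *)
Lemma antiderivative_bound i (K : set (R * R)) N : compact K -> exists K' C,
  [/\ compact K', 0 <= C & forall phi, smooth phi -> forall e, 0 <= e ->
    (forall s, (size s <= N)%N -> forall x, K' x -> `|iter_partial s phi x| <= e) ->
    forall s, (size s <= N)%N -> forall x, K x ->
      `|iter_partial s (antiderivative i phi) x| <= C * e].
Proof.
move=> cK; have [r r0 Kr] := compact_subbox cK.
have [C C0 HC] := mul_bound N cK (smooth_coord i).
exists [set x : R * R | `|x.1| <= r /\ `|x.2| <= r], C; split=> //; first exact: compact_box.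
move=> phi sp e e0 He s sN x Kx.
apply: (HC _ (smoothPI i i1 sp) e e0 s x sN Kx) => t ts.
have [w [iw bw ->]] := iterPI i t i1 (fun z _ => ltac:(by rewrite normr1)) sp.
have st := smooth_iter t sp.
apply: le_trans (param_integral_bound mD m0 m0 (msc i ord0) (msc i ord_max) b0 b0 (@bsc i ord0) (@bsc i ord_max) iw (smooth_continuousT st) (C := e) _) _.
  have [x1 x2] := Kr x Kx.
  have scr j (a z : R) : D z -> `|a| <= r -> `|0 + sc i j z * a| <= r.
    move=> Dz ar; rewrite add0r normrM -[leRHS]mul1r; apply: ler_pM => //; exact: bsc.
  move=> z Dz; apply: He; first exact: leq_trans ts sN.
  by split; apply: scr.
rewrite ler_piMl//.
have H : mu (`[0, 1]%classic : set R) = 1%:E.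
  by rewrite lebesgue_measure_itv/= lte_fin ltr01/= oppr0 adde0.
apply: le_trans (le_Rintegral mD (integrable_norm iw) i1 bw) _.
by rewrite Rintegral_cst// mul1r; rewrite (congr1 fine H).
Qed.

Lemma compact_antiderivative_dist i (u : functional R) : compact_distribution u ->
  compact_distribution (fun phi => - u (antiderivative i phi)).
Proof.
move=> /compact_distributionP[lu [K [N [C [cK C0 H]]]]].
apply/compact_distributionP; split.
  move=> a phi psi sp sq; rewrite antiderivativeZD//.
  by rewrite (lu a _ _ (smooth_antiderivative i sp) (smooth_antiderivative i sq)) opprD mulrN.
have [K' [C' [cK' C0' H']]] := antiderivative_bound i N cK.
exists K', N, (C * C'); split=> //; first exact: mulr_ge0.
move=> phi sp e e0 He; rewrite normrN -mulrA.
apply: (H _ (smooth_antiderivative i sp)); first exact: mulr_ge0.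
by move=> s sN x Kx; apply: H'.
Qed.

End antiderivative.

Section division.
Context {R : realType}.
Implicit Types (phi psi : R * R -> R) (x : R * R) (i : 'I_2).

Lemma partialB phi psi i : smooth phi -> smooth psi ->
  partial i (fun x => phi x - psi x) = (fun x => partial i phi x - partial i psi x).
Proof. by move=> sp sq; exact: (iter_partialB [:: i] sp sq). Qed.

Lemma partialCT phi i (j : 'I_2) : smooth phi -> partial i (partial j phi) = partial j (partial i phi).
Proof. by move=> sp; apply/funext => x; exact: (partialC i j openT sp I). Qed.

Lemma partial_iterCT phi i s : smooth phi ->
  partial i (iter_partial s phi) = iter_partial s (partial i phi).
Proof. by move=> sp; apply/funext => x; exact: (partial_iterC i s openT sp I). Qed.

Lemma smooth_multi a b phi : smooth phi -> smooth (multi_partial a b phi).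
Proof. by move=> sp; rewrite multi_partialE; exact: smooth_iter. Qed.

Lemma multi_partialSl a b phi :
  multi_partial a.+1 b phi = partial ord0 (multi_partial a b phi).
Proof. by []. Qed.

Lemma multi_partialSr a b phi :
  multi_partial a b.+1 phi = multi_partial a b (partial ord_max phi).
Proof. by rewrite /multi_partial -iterSr. Qed.

Lemma iter_partial_cst0 s : iter_partial s (fun _ : R * R => 0 : R) = fun=> 0.
Proof. by elim: s => [//|i s IH] /=; rewrite IH partial_cst. Qed.

Lemma iter_partialZ (c : R) f s : smooth f ->
  iter_partial s (fun x => c * f x) = fun x => c * iter_partial s f x.
Proof.
move=> sf; apply/funext => y.
have := iter_partialZD c s sf (@smooth_cst R setT 0); rewrite iter_partial_cst0.
move=> /(congr1 (fun f => f y)); rewrite addr0 => <-.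
by congr (iter_partial s _ y); apply/funext => z; rewrite addr0.
Qed.

Lemma multi_partial_cst0 a b : multi_partial a b (fun _ : R * R => 0 : R) = fun=> 0.
Proof. by rewrite multi_partialE iter_partial_cst0. Qed.

Lemma antiderivative0 i : antiderivative i (fun _ : R * R => 0 : R) = fun=> 0.
Proof.
have s0 := @smooth_cst R setT 0; have := antiderivativeZD i 1 s0 s0.
have -> : (fun _ : R * R => 1 * 0 + 0) = (fun=> 0 : R) by apply/funext => x; rewrite mulr0 addr0.
move=> H; apply/funext => x; have := congr1 (fun f => f x) H.
by rewrite /= mul1r => /eqP; rewrite -subr_eq subrr => /eqP.
Qed.

Lemma iter_antiderivative n phi : smooth phi -> partial ord_max phi = (fun=> 0) ->
  exists psi, [/\ smooth psi, partial ord_max psi = (fun=> 0) &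
    multi_partial n 0 psi = phi].
Proof.
elim: n phi => [|n IH] phi sp p0; first by exists phi.
have sa := smooth_antiderivative ord0 sp.
have [|psi [sq q0 E]] := IH _ sa.
  by rewrite partial_antiderivative_neq// p0 antiderivative0.
by exists psi; split=> //; rewrite multi_partialSl E partial_antiderivative.
Qed.

(* [F_0, .., F_m] are the coefficients of a form in (xi1, xi2); the hypothesis says that the
   form vanishes at (d1, d2)^perp, the conclusion that it is divisible by xi1 d1 + xi2 d2. *)
Lemma division m (F : nat -> functional R) :
  (forall j, compact_distribution (F j)) ->
  (forall phi, smooth phi ->
    \sum_(0 <= j < m.+1) (-1) ^+ j * F j (multi_partial (m - j) j phi) = 0) ->
  exists v : nat -> functional R, (forall j, compact_distribution (v j)) /\
    forall j phi, (j <= m)%N -> smooth phi ->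
      F j phi = (if j is j'.+1 then - v j' (partial ord0 phi) else 0) +
                (if (j < m)%N then - v j (partial ord_max phi) else 0).
Proof.
elim: m F => [|m IH] F cF HF.
  exists (fun _ _ => 0); split; first by move=> _; exact: compact_dist0.
  move=> [|//] phi _ sp; have := HF phi sp.
  by rewrite big_nat1 expr0 mul1r addr0.
have lF j : linear_dist (F j) by case/compact_distributionP: (cF j).
pose v0 : functional R := fun phi => - F 0%N (antiderivative ord_max phi).
have cv0 : compact_distribution v0 by exact: compact_antiderivative_dist.
(* Such an [r] is d1^(m+1) psi with psi independent of x2. Tested on [psi], the hypothesis keeps
   only its term j = 0, since all other terms contain d2 psi = 0. *)
have Fr r : smooth r -> partial ord_max r = (fun=> 0) -> F 0%N r = 0.
  move=> sr r0; have [psi [sq q0 <-]] := iter_antiderivative m.+1 sr r0.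
  have := HF psi sq; rewrite big_nat_recl// expr0 mul1r subn0.
  rewrite big1_seq ?addr0 // => j _.
  by rewrite multi_partialSr q0 multi_partial_cst0 linear_dist0// mulr0.
(* Hence F_0 phi depends on d2 phi only, which says that F_0 = d2 v_0. *)
have F0E phi : smooth phi -> F 0%N phi = F 0%N (antiderivative ord_max (partial ord_max phi)).
  move=> sp; have sa := smooth_antiderivative ord_max (smooth_partial ord_max sp).
  apply/eqP; rewrite -subr_eq0 -(linear_distB (lF 0%N) sp sa); apply/eqP/Fr.
    exact: smoothB openT sp sa.
  rewrite (partialB _ sp sa) (partial_antiderivative _ (smooth_partial ord_max sp)).
  by apply/funext => x; rewrite subrr.
(* The coefficients F_1 - d1 v_0, F_2, ... of a form of one degree less. *)
pose F' j : functional R := fun phi =>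
  F j.+1 phi + (if j == 0%N then 1 else 0) * v0 (partial ord0 phi).
have [|phi sp|v [cv Hv]] := IH F'.
- move=> j; apply: compact_distD; first exact: cF.
  have -> : (fun phi => (if j == 0%N then 1 else 0) * v0 (partial ord0 phi)) =
      (fun phi => (if j == 0%N then -1 else 0) * partial_dist ord0 v0 phi).
    by apply/funext => phi; rewrite /partial_dist; case: ifP => _; rewrite ?mul0r// mul1r mulN1r opprK.
  by apply: compact_distZ; exact: compact_partial_dist.
(* Since d2 chi = phi, testing the hypothesis on [chi] removes one d2 from every term with j >=
   1. *)
- pose chi := antiderivative ord_max phi.
  have sc : smooth chi := smooth_antiderivative ord_max sp.
  have pc : partial ord_max chi = phi by exact: partial_antiderivative.
  have := HF chi sc; rewrite big_nat_recl// expr0 mul1r subn0 => HF0.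
  have Hv0 : v0 (partial ord0 (multi_partial m 0 phi)) = - F 0%N (multi_partial m.+1 0 chi).
    have E : partial ord_max (multi_partial m.+1 0 chi) = partial ord0 (multi_partial m 0 phi).
      rewrite multi_partialSl (partialCT ord_max ord0 (smooth_multi m 0 sc)).
      by rewrite !multi_partialE (partial_iterCT _ _ sc) pc.
    by rewrite /v0 (F0E _ (smooth_multi m.+1 0 sc)) E.
  have -> : \sum_(0 <= j < m.+1) (-1) ^+ j * F' j (multi_partial (m - j) j phi) =
     \sum_(0 <= j < m.+1) (-1) ^+ j * F j.+1 (multi_partial (m - j) j phi) +
     v0 (partial ord0 (multi_partial m 0 phi)).
    rewrite big_nat_recl// [X in _ = X + _]big_nat_recl// /F' eqxx expr0 !mul1r subn0.
    rewrite addrAC; congr (_ + _ + _); apply: eq_bigr => j _.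
    by rewrite mul0r addr0.
  rewrite Hv0; apply/eqP; rewrite subr_eq0 eq_sym -subr_eq0 -[X in _ == X]HF0; apply/eqP.
  congr (_ + _); rewrite -sumrN; apply: eq_bigr => j _.
  by rewrite exprS mulN1r mulNr subSS multi_partialSr pc.
exists (fun j => if j is j'.+1 then v j' else v0); split; first by case.
move=> [|j] phi jm sp.
  by rewrite add0r /v0 opprK F0E.
have := Hv j phi jm sp; rewrite /F' => /eqP; rewrite eq_sym -subr_eq => /eqP <-.
rewrite ltnS; case: j jm => [|j] jm /=.
  by rewrite mul1r add0r addrC.
by rewrite mul0r subr0.
Qed.

End division.

(** * Bump functions *)

Section bump.
Context {R : realType}.
Implicit Types (g : R * R -> R) (x : R * R) (V : set (R * R)).

Lemma is_derive_comp1 (h : R -> R) g x v (d e : R) :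
  is_derive (g x) 1 h d -> is_derive x v g e -> is_derive x v (fun y => h (g y)) (d * e).
Proof.
move=> Dh Dg.
have x0 : (0 : R) *: v + x = x by rewrite scale0r add0r.
have Dl : is_derive (0 : R) 1 (fun t : R => g (t *: v + x)) e.
  by apply/is_derive_line; rewrite x0.
suff : is_derive (0 : R) 1 (fun t : R => h (g (t *: v + x))) (d * e).
  by move/(is_derive_line (fun y => h (g y)) x v 0 (d * e)); rewrite x0.
have Dh' : is_derive (g (0 *: v + x)) 1 h d by rewrite x0.
have dl : derivable (fun t : R => g (t *: v + x)) 0 1 by case: Dl.
have dh : derivable h (g (0 *: v + x)) 1 by case: Dh'.
split.
  apply/derivable1_diffP.
  have gl := (derivable1_diffP _ _).1 dl; have hl := (derivable1_diffP _ _).1 dh.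
  exact: (differentiable_comp gl hl).
have := derive1_comp dl dh; rewrite !derive1E => ->.
by rewrite (@derive_val _ _ _ _ _ _ _ Dl) (@derive_val _ _ _ _ _ _ _ Dh').
Qed.

(** The functions t^-k exp(-1/t), extended by 0: derivatives are linear combinations within the
    family, so smoothness follows for all k together. *)
Definition flat (k : nat) (t : R) : R := if 0 < t then (t^-1) ^+ k * expR (- t^-1) else 0.

Lemma flat_ge0 k t : 0 <= flat k t.
Proof.
rewrite /flat; case: ifP => // t0; apply: mulr_ge0; last exact: expR_ge0.
by rewrite exprn_ge0// invr_ge0 ltW.
Qed.

Lemma flat_gt0 k t : 0 < t -> 0 < flat k t.
Proof. by move=> t0; rewrite /flat t0 mulr_gt0 ?expR_gt0// exprn_gt0// invr_gt0. Qed.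

Lemma flat_eq0 k t : t <= 0 -> flat k t = 0.
Proof. by rewrite /flat leNgt => /negbTE ->. Qed.

(** For t > 0 and s = 1/t this is s^(k+2) <= (k+2)! exp s. The quadratic bound makes the difference
    quotient at 0 tend to 0. *)
Lemma flat_bound k t : `|flat k t| <= k.+2`!%:R * t ^+ 2.
Proof.
rewrite ger0_norm ?flat_ge0//; case: (ltP 0 t) => t0; last first.
  by rewrite flat_eq0// mulr_ge0// sqr_ge0.
rewrite /flat t0.
have f0 : 0 < (k.+2)`!%:R :> R by rewrite ltr0n fact_gt0.
have [s s0 ts] : exists2 s : R, 0 < s & t = s^-1 by exists t^-1; rewrite ?invr_gt0// invrK.
rewrite ts invrK expRN ler_pdivrMr ?expR_gt0//.
have H : s ^+ k.+2 <= k.+2`!%:R * expR s.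
  rewrite -ler_pdivrMl// mulrC; apply: le_trans (expR_ge1Dxn k.+1 (ltW s0)).
  by rewrite lerDr.
have E : k.+2`!%:R * s^-1 ^+ 2 * expR s = k.+2`!%:R * expR s / s ^+ 2.
  by rewrite exprVn mulrAC.
by rewrite E ler_pdivlMr ?exprn_gt0// -exprD addn2.
Qed.

Lemma is_derive_flat k (t : R) : is_derive t 1 (flat k) (flat k.+2 t - k%:R * flat k.+1 t).
Proof.
case: (ltgtP t 0) => t0.
- have -> : flat k.+2 t - k%:R * flat k.+1 t = 0.
    by rewrite !flat_eq0 ?(ltW t0)// mulr0 subrr.
  apply: (near_eq_is_derive _ (is_derive_cst (0 : R) t 1)).
  near=> s; rewrite flat_eq0// ltW//; near: s; exact: lt_nbhsl.
- have tn0 : t != 0 by rewrite gt_eqF.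
  have Di : is_derive t 1 (fun s : R => s^-1) (- (t^-1) ^+ 2).
    split; first exact: derivableV.
    by rewrite deriveV// derive_id /GRing.scale /= mulr1 exprVn.
  have De : is_derive t 1 (fun s : R => expR (- s^-1)) (expR (- t^-1) * (t^-1) ^+ 2).
    have dN := is_deriveN Di.
    have d1 : derivable (fun s : R => - s^-1) t 1 by case: dN.
    have d2 : derivable (@expR R) (- t^-1) 1 by case: (is_derive_expR (- t^-1)).
    split.
      apply/derivable1_diffP.
      have g1 := (derivable1_diffP _ _).1 d1; have g2 := (derivable1_diffP _ _).1 d2.
      exact: (differentiable_comp g1 g2).
    have := derive1_comp d1 d2; rewrite !derive1E => ->.
    rewrite (@derive_val _ _ _ _ _ _ _ (is_derive_expR (- t^-1))).
    by rewrite (@derive_val _ _ _ _ _ _ _ dN) opprK.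
  have D := is_deriveM (is_deriveX k Di) De.
  apply: (@near_eq_is_derive _ _ _ ((fun s : R => s^-1) ^+ k * (fun s : R => expR (- s^-1)))).
    near=> s; rewrite /flat ifT; last by near: s; exact: lt_nbhsr.
    by rewrite /GRing.mul /= exprfctE.
  apply: is_derive_eq D _.
  rewrite /flat t0 /GRing.scale /= exprfctE /=.
  set s := t^-1; set E := expR (- s); case: k => [|k] /=; first by ring.
  by rewrite -natr1 !exprS; ring.
- rewrite t0.
  have -> : flat k.+2 0 - k%:R * flat k.+1 0 = 0 by rewrite !flat_eq0// mulr0 subrr.
  have L : (fun h : R => h^-1 *: ((flat k \o shift 0) (h *: 1) - flat k 0)) @ 0^' --> (0 : R).
    apply/cvgrPdist_le => e e0.
    set C : R := k.+2`!%:R.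
    have C0 : 0 < C by rewrite ltr0n fact_gt0.
    near=> h.
    rewrite sub0r normrN /= addr0 [h *: 1]mulr1 (flat_eq0 _ (lexx 0)) subr0.
    rewrite /GRing.scale /= normrM.
    apply: (@le_trans _ _ (C * `|h|)).
      apply: le_trans (ler_wpM2l (normr_ge0 _) (flat_bound k h)) _.
      have [->|h0] := eqVneq h 0; first by rewrite normr0 expr0n /= !mulr0.
      rewrite -real_normK ?num_real// normfV expr2 mulrCA mulKf ?normr_eq0//.
    rewrite mulrC -ler_pdivlMr//; near: h.
    apply: dnbhs0_le; exact: divr_gt0.
  split; first by apply/cvg_ex; exists 0.
  exact: cvg_lim L.
Unshelve. all: by end_near. Qed.

Lemma smooth_flat V k g : open V -> smooth_on V g -> smooth_on V (fun x => flat k (g x)).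
Proof.
move=> oV sg; apply/smooth_onP => n; elim: n k => [//|n IH] k.
have D i x : V x -> is_derive x (basis_vec R i) (fun y => flat k (g y))
    ((flat k.+2 (g x) - k%:R * flat k.+1 (g x)) * partial i g x).
  move=> Vx; apply: is_derive_comp1 (is_derive_flat _ _) _.
  exact: smooth_is_derive sg Vx.
split=> [x Vx|i x Vx|i]; last first.
- have H : Cn n V (fun x => (flat k.+2 (g x) + - k%:R * flat k.+1 (g x)) * partial i g x).
    have Cc := (smooth_onP _ _).1 (@smooth_cst R V (- k%:R)) n.
    have Cg := (smooth_onP _ _).1 (smooth_partial i sg) n.
    exact: (CnM oV (CnD oV (IH k.+2) (CnM oV Cc (IH k.+1))) Cg).
  apply: (Cn_eq oV _ H) => x Vx; rewrite mulNr; apply/esym.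
  exact: (@derive_val _ _ _ _ _ _ _ (D i x Vx)).
- by case: (D i x Vx).
- have fc : {for g x, continuous (flat k)}.
    apply/differentiable_continuous/derivable1_diffP.
    by case: (is_derive_flat k (g x)).
  exact: (cvg_comp g (flat k) (smooth_continuous sg Vx) fc).
Qed.

Definition sqdist (c x : R * R) : R := (x.1 - c.1) ^+ 2 + (x.2 - c.2) ^+ 2.

Lemma smooth_sqdist c : smooth (sqdist c).
Proof.
have s1 : smooth (fun x : R * R => x.1 - c.1).
  exact: (smoothB openT (@smooth_fst R setT) (@smooth_cst R setT c.1)).
have s2 : smooth (fun x : R * R => x.2 - c.2).
  exact: (smoothB openT (@smooth_snd R setT) (@smooth_cst R setT c.2)).
exact: (smoothD openT (smoothX 2 openT s1) (smoothX 2 openT s2)).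
Qed.

Lemma open_sqdist_lt c (r : R) : open [set x | sqdist c x < r].
Proof.
have -> : [set x | sqdist c x < r] = sqdist c @^-1` [set t | t < r] by [].
by have /continuousP := smooth_continuousT (smooth_sqdist c); apply; exact: open_lt.
Qed.

Lemma open_sqdist_gt c (r : R) : open [set x | r < sqdist c x].
Proof.
have -> : [set x | r < sqdist c x] = sqdist c @^-1` [set t | r < t] by [].
by have /continuousP := smooth_continuousT (smooth_sqdist c); apply; exact: open_gt.
Qed.

(** [a] and [b] are squared radii, being compared with [sqdist]. For a < b the two terms of the
    denominator never vanish together. *)
Definition cutoff (a b : R) (c x : R * R) : R :=
  flat 0 (b - sqdist c x) / (flat 0 (b - sqdist c x) + flat 0 (sqdist c x - a)).

Section cutoff.
Variables (a b : R) (c : R * R) (ab : a < b).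

Lemma cutoff_den_gt0 x : 0 < flat 0 (b - sqdist c x) + flat 0 (sqdist c x - a).
Proof.
have [sb|sb] := ltP (sqdist c x) b.
  by apply: ltr_wpDr; [exact: flat_ge0|rewrite flat_gt0// subr_gt0].
apply: ltr_wpDl; first exact: flat_ge0.
by rewrite flat_gt0// subr_gt0 (lt_le_trans ab).
Qed.

Lemma smooth_cutoff : smooth (cutoff a b c).
Proof.
have sb : smooth (fun x => flat 0 (b - sqdist c x)).
  exact: (smooth_flat 0 openT (smoothB openT (@smooth_cst R setT b) (smooth_sqdist c))).
have sa : smooth (fun x => flat 0 (sqdist c x - a)).
  exact: (smooth_flat 0 openT (smoothB openT (smooth_sqdist c) (@smooth_cst R setT a))).
apply: (smoothM openT sb (smoothV openT _ (smoothD openT sb sa))) => x _.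
by rewrite gt_eqF// cutoff_den_gt0.
Qed.

Lemma cutoff1 x : sqdist c x <= a -> cutoff a b c x = 1.
Proof.
move=> xa; rewrite /cutoff (flat_eq0 0 (t := sqdist c x - a)) ?subr_le0// addr0 divff//.
by rewrite gt_eqF// flat_gt0// subr_gt0 (le_lt_trans xa).
Qed.

Lemma cutoff0 x : b <= sqdist c x -> cutoff a b c x = 0.
Proof. by move=> xb; rewrite /cutoff flat_eq0 ?mul0r// subr_le0. Qed.

Lemma cutoff_ge0 x : 0 <= cutoff a b c x.
Proof. by rewrite divr_ge0 ?flat_ge0// ltW// cutoff_den_gt0. Qed.

End cutoff.

Lemma test_onI (K V : set (R * R)) (phi : R * R -> R) : compact K -> smooth phi ->
  (forall x, ~ K x -> phi x = 0) -> K `<=` V -> test_on V phi.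
Proof.
move=> cK sp phi0 KV.
have clK : closed K by apply: compact_closed => //; exact: norm_hausdorff.
have suppK : supp phi `<=` K.
  have -> : K = closure K by exact/closure_id.
  by apply: closure_subset => x /= /eqP px; apply: contrapT => /phi0.
split=> //; last exact: subset_trans KV.
by apply: subclosed_compact cK suppK; exact: closed_closure.
Qed.

Lemma sqdist_box r c x : 0 <= r -> sqdist c x <= r ^+ 2 -> `|x.1 - c.1| <= r /\ `|x.2 - c.2| <= r.
Proof.
move=> r0 H; split; rewrite -(ler_sqr (normr_ge0 _)) ?nnegrE// real_normK ?num_real//.
  by apply: le_trans H; rewrite lerDl sqr_ge0.
by apply: le_trans H; rewrite lerDr sqr_ge0.
Qed.

Lemma compact_disc r c : 0 <= r -> compact [set x | sqdist c x <= r ^+ 2].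
Proof.
move=> r0; apply: (@subclosed_compact _ _ [set x : R * R | `|x.1| <= `|c.1| + `|c.2| + r /\ `|x.2| <= `|c.1| + `|c.2| + r]).
- have -> : [set x | sqdist c x <= r ^+ 2] = sqdist c @^-1` [set t | t <= r ^+ 2] by [].
  apply: preimage_closed; last exact: closed_le.
  by move=> x _; exact: smooth_continuousT (smooth_sqdist c) x.
- exact: compact_box.
move=> x /(sqdist_box r0)[x1 x2]; split.
  rewrite -(subrK c.1 x.1) (le_trans (ler_normD _ _))//.
  by have := normr_ge0 c.2; lra.
rewrite -(subrK c.2 x.2) (le_trans (ler_normD _ _))//.
by have := normr_ge0 c.1; lra.
Qed.

End bump.

(** * Convolutions on the plane *)

Section plane_integral.
Context {R : realType}.
Local Notation Y := (measurableTypeR R).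
Local Notation mu := (@lebesgue_measure R).
Local Notation mu2 := (mu \x mu)%E.

Lemma measurable_translate (c : R) : measurable_fun (setT : set Y) (fun x : Y => (x + c : Y)).
Proof. by apply: measurable_funD; [exact: measurable_id|exact: measurable_cst]. Qed.

(** The pushforward under a translation agrees with Lebesgue measure on half-open intervals, hence
    everywhere by uniqueness. The plane case follows by uniqueness of the product measure. *)
Lemma lebesgue_translate (c : R) (A : set Y) : measurable A ->
  mu ((fun x : Y => (x + c : Y)) @^-1` A) = mu A.
Proof.
move=> mA; pose m' := measure_function_pushforward__canonical__measure_function_Measure mu (measurable_translate c).
have := @lebesgue_measure_unique R m' _ A mA; move=> ->//.
move=> _ [[a b] _ <-] /=.
have -> : pushforward mu (fun x : Y => (x + c : Y)) `]a, b] = mu (`]a - c, b - c]%classic : set R).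
  rewrite /pushforward; congr (mu _); apply/seteqP; split=> x /=;
    by rewrite !in_itv /= => /andP[H1 H2]; apply/andP; split; lra.
rewrite [LHS](lebesgue_measure_itv `]a, b]) [RHS](lebesgue_measure_itv `]a - c, b - c]) /=.
rewrite !lte_fin ltrD2r; case: ifP => // _.
by congr EFin; ring.
Qed.

Lemma measurable_translate2 (w : R * R) :
  measurable_fun (setT : set (Y * Y)) (fun x : Y * Y => (x + w : Y * Y)).
Proof.
apply: measurable_fun_pair.
  by apply: measurable_funD; [exact: measurable_fst|exact: measurable_cst].
by apply: measurable_funD; [exact: measurable_snd|exact: measurable_cst].
Qed.

Lemma plane_translate (w : R * R) (A : set (Y * Y)) : measurable A ->
  mu2 ((fun x : Y * Y => (x + w : Y * Y)) @^-1` A) = mu2 A.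
Proof.
move=> mA; pose m' := measure_function_pushforward__canonical__measure_function_Measure mu2 (measurable_translate2 w).
apply/esym; apply: (@product_measure_unique _ _ _ _ _ mu mu m' _ A mA) => B C mB mC.
rewrite /= /pushforward.
have -> : (fun x : Y * Y => (x + w : Y * Y)) @^-1` (B `*` C) =
  ((fun x : Y => (x + w.1 : Y)) @^-1` B) `*` ((fun x : Y => (x + w.2 : Y)) @^-1` C) by [].
have mpre (c : R) (D : set Y) : measurable D -> measurable ((fun x : Y => (x + c : Y)) @^-1` D).
  by move=> mD; rewrite -[X in measurable X]setTI; exact: measurable_translate.
rewrite [LHS]product_measure1E; [|exact: mpre|exact: mpre].
congr (_ * _)%E; exact: lebesgue_translate.
Qed.

Lemma Rintegral_translate (w : R * R) (f : Y * Y -> R) : measurable_fun setT f ->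
  mu2.-integrable setT (EFin \o (fun x : Y * Y => f (x + w))) ->
  \int[mu2]_(x in setT) f x = \int[mu2]_(x in setT) f (x + w).
Proof.
move=> mf intf; congr fine.
have mw := measurable_translate2 w.
have mf' : measurable_fun setT (EFin \o f) by exact/measurable_EFinP.
pose sh (x : Y * Y) : Y * Y := x + w.
transitivity (\int[pushforward mu2 sh]_(x in setT) (EFin \o f) x)%E.
  apply: eq_measure_integral => A mA _; apply/esym; exact: plane_translate.
by rewrite (integral_pushforward mw mf') // preimage_setT.
Qed.

Definition plane_box (r : R) : set (Y * Y) := `[- r, r]%classic `*` `[- r, r]%classic.

Lemma plane_boxE r (x : R * R) : plane_box r x <-> `|x.1| <= r /\ `|x.2| <= r.
Proof. by rewrite /plane_box /= !in_itv /= -!ler_norml. Qed.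

Lemma measurable_plane_box r : measurable (plane_box r).
Proof. by apply: measurableX; exact: measurable_itv. Qed.

Lemma plane_box_measure r : 0 <= r -> mu2 (plane_box r) = (4 * r ^+ 2)%:E.
Proof.
move=> r0; rewrite [LHS]product_measure1E; [|exact: measurable_itv|exact: measurable_itv].
have H : mu (`[- r, r]%classic : set R) = (2 * r)%:E.
  rewrite [LHS](lebesgue_measure_itv `[- r, r]) /= lte_fin.
  by case: ltP => r0'; congr EFin; lra.
transitivity ((2 * r)%:E * (2 * r)%:E)%E; first by congr (_ * _)%E; exact: H.
by rewrite -EFinM; congr EFin; ring.
Qed.

Definition inv_norm (x : R * R) : R := (Num.sqrt (x.1 ^+ 2 + x.2 ^+ 2))^-1.

Lemma inv_norm_ge0 x : 0 <= inv_norm x.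
Proof. by rewrite invr_ge0 sqrtr_ge0. Qed.

Lemma measurable_inv_norm : measurable_fun (setT : set (Y * Y)) inv_norm.
Proof.
have -> : inv_norm = (fun x : R * R => (Num.sqrt (x.1 ^+ 2 + x.2 ^+ 2)) `^ (-1)).
  by apply/funext => x; rewrite powR_inv1// sqrtr_ge0.
apply: (measurableT_comp (measurable_powR (-1))).
apply: (measurableT_comp (continuous_measurable_fun (@sqrt_continuous R))).
apply: continuous_measurable_plane; apply: smooth_continuousT.
exact: (smoothD openT (smoothX 2 openT (@smooth_fst R setT)) (smoothX 2 openT (@smooth_snd R setT))).
Qed.

Lemma inv_norm_le (x : R * R) (t : R) : 0 < t -> t <= `|x.1| \/ t <= `|x.2| -> inv_norm x <= t^-1.
Proof.
move=> t0 tx; have st : t <= Num.sqrt (x.1 ^+ 2 + x.2 ^+ 2).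
  rewrite -(ger0_norm (ltW t0)) -sqrtr_sqr ler_sqrt ?addr_ge0 ?sqr_ge0//.
  by case: tx => tx; [apply: (@le_trans _ _ (x.1 ^+ 2)); last by rewrite lerDl sqr_ge0|
    apply: (@le_trans _ _ (x.2 ^+ 2)); last by rewrite lerDr sqr_ge0];
   rewrite -[leRHS]real_normK ?num_real// ler_sqr ?nnegrE// ltW.
by rewrite lef_pV2// posrE (lt_le_trans t0).
Qed.

(* Dyadic decomposition: the layer [r 2^-(n+1) <= |x| <= r 2^-n] has measure O(4^-n)
   and [1/|x| = O(2^n)] on it. *)
Lemma inv_norm_dyadic r (x : R * R) : 0 < r -> plane_box r x -> (x.1 != 0) || (x.2 != 0) ->
  exists n, plane_box (r / 2 ^+ n) x /\ inv_norm x <= 2 ^+ n.+1 / r.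
Proof.
move=> r0 /plane_boxE[x1 x2] xn0.
pose s := Num.max `|x.1| `|x.2|.
have s0 : 0 < s by rewrite lt_max !normr_gt0.
have sr : s <= r by rewrite ge_max x1 x2.
have p2 n : 0 < 2 ^+ n :> R by rewrite exprn_gt0.
have exN : exists n, r / 2 ^+ n.+1 <= s.
  have [n Hn] : exists n : nat, r / s < n%:R.
    by exists (Num.bound (r / s)); apply: archi_boundP; rewrite divr_ge0 ?ltW.
  exists n; rewrite ler_pdivrMr// mulrC -ler_pdivrMr// ltW// (lt_le_trans Hn)//.
  rewrite exprS; apply: (@le_trans _ _ (2 ^+ n)); last by have := p2 n; lra.
  by rewrite -natrX ler_nat ltnW// ltn_expl.
case: (ex_minnP exN) => n Hn minn; exists n; split.
  apply/plane_boxE.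
  have sn : s <= r / 2 ^+ n.
    case: n {Hn} minn => [|n] minn; first by rewrite expr0 divr1.
    by rewrite leNgt; apply/negP => /ltW /minn; rewrite ltnn.
  by split; apply: le_trans sn; rewrite le_max lexx ?orbT.
have q0 : 0 < r / 2 ^+ n.+1 by rewrite divr_gt0.
have -> : 2 ^+ n.+1 / r = (r / 2 ^+ n.+1)^-1 by rewrite invf_div.
apply: inv_norm_le => //.
by move: Hn; rewrite /s le_max => /orP.
Qed.

(** By the dyadic layers, 1/|x| is dominated by the sum over n of 2^(n+1)/r times the indicator of
    the box of half-side r/2^n; the integrals form a geometric series. *)
Lemma integrable_inv_norm r : 0 < r -> mu2.-integrable (plane_box r) (EFin \o inv_norm).
Proof.
move=> r0; have mB := measurable_plane_box.
apply/integrableP; split.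
  by apply/measurable_EFinP; apply: measurable_funTS; exact: measurable_inv_norm.
have p2 n : 0 < 2 ^+ n :> R by rewrite exprn_gt0.
pose f n (x : Y * Y) : \bar R := ((2 ^+ n.+1 / r) * \1_(plane_box (r / 2 ^+ n)) x)%:E.
have f0 n x : (0 <= f n x)%E.
  by rewrite lee_fin mulr_ge0// divr_ge0// ltW.
have mf n : measurable_fun (plane_box r) (f n).
  apply/measurable_EFinP; apply: measurable_funM; first exact: measurable_cst.
  by apply: measurable_indic; exact: mB.
apply: (@le_lt_trans _ _ (\int[mu2]_(x in plane_box r) (\sum_(n <oo) f n x))%E).
  apply: ge0_le_integral => //.
  - apply: measurableT_comp => //; apply/measurable_EFinP; apply: measurable_funTS.
    exact: measurable_inv_norm.
  - by apply: ge0_emeasurable_sum.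
  move=> x Bx; rewrite /= ger0_norm ?inv_norm_ge0//.
  have [xn0|] := boolP ((x.1 != 0) || (x.2 != 0)); last first.
    rewrite negb_or !negbK => /andP[/eqP x1 /eqP x2].
    rewrite /inv_norm x1 x2 expr0n /= addr0 sqrtr0 invr0.
    by apply: nneseries_ge0 => n _ _.
  have [n [Bn Hn]] := inv_norm_dyadic r0 Bx xn0.
  apply: (@le_trans _ _ (f n x)).
    by rewrite lee_fin indicE mem_set// mulr1.
  apply: le_trans (nneseries_lim_ge (m := 0) n.+1 (fun k _ _ => f0 k x)).
  by rewrite big_nat_recr//= leeDr// sume_ge0.
rewrite integral_nneseries//.
(* 2^(n+1)/r times the area 4 (r/2^n)^2 equals 16 r / 2^(n+1), the form summed by
   [epsilon_trick0]. *)
apply: (@le_lt_trans _ _ (\sum_(n <oo) ((16 * r) / (2 ^ n.+1)%:R)%:E)%E); last first.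
  apply: le_lt_trans (epsilon_trick0 _ _) (ltry _).
  by rewrite mulr_ge0// ltW.
apply: lee_nneseries => n _; first by move=> _; exact: integral_ge0.
rewrite /f (@integralZl_indic _ _ _ _ _ _ (fun=> plane_box (r / 2 ^+ n)) (2 ^+ n.+1 / r)) //; last first.
  by move=> H; exfalso; move: H; apply/negP; rewrite -leNgt divr_ge0// ltW.
rewrite integral_indic//.
have rn : 0 <= r / 2 ^+ n by rewrite divr_ge0// ltW.
apply: (@le_trans _ _ ((2 ^+ n.+1 / r)%:E * mu2 (plane_box (r / 2 ^+ n)))%E).
  apply: lee_wpmul2l; first by rewrite lee_fin divr_ge0// ltW.
  apply: le_measure; rewrite ?inE//; first exact: measurableI.
rewrite plane_box_measure// -EFinM lee_fin natrX.
have r0' : r != 0 by rewrite gt_eqF.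
have p0' : (2 : R) ^+ n != 0 by rewrite gt_eqF.
by rewrite !exprS le_eqVlt; apply/orP; left; apply/eqP; field; rewrite r0' p0'.
Qed.

End plane_integral.

Section plane_convolution.
Context {R : realType}.
Local Notation Y := (measurableTypeR R).
Local Notation mu := (@lebesgue_measure R).
Local Notation mu2 := (mu \x mu)%E.
Implicit Types (L G phi : R * R -> R) (x y : R * R) (r : R).

(** The function to which [convolution] applies its distribution. The kernel sits at x - y with x
    integrated, so as a function of y this is a convolution with the reflected kernel. *)
Definition plane_conv L phi y : R := \int[mu2]_(x in setT) (L (x - y) * phi x).

Definition vanishes_off_box r phi := forall x, ~ plane_box r x -> phi x = 0.

Lemma smooth_local phi : (forall x, exists V, [/\ open V, V x & smooth_on V phi]) -> smooth phi.
Proof.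
Transparent smooth_on.
by move=> H s x _; have [V [_ Vx sV]] := H x; exact: sV.
Opaque smooth_on.
Qed.

Lemma vanishes_off_box_partial r phi i : vanishes_off_box r phi -> vanishes_off_box r (partial i phi).
Proof.
move=> v x Bx.
have cB : compact (plane_box r : set (R * R)).
  have -> : plane_box r = [set x : R * R | `|x.1| <= r /\ `|x.2| <= r] :> set (R * R).
    by apply/seteqP; split=> y /plane_boxE.
  exact: compact_box.
have clB : closed (plane_box r : set (R * R)) by apply: compact_closed cB; exact: norm_hausdorff.
have oV : open (~` (plane_box r : set (R * R))) by exact: closed_openC.
by rewrite (partial_eq_on i oV (g := fun=> 0) v Bx) partial_cst.
Qed.

Lemma vanishes_off_box_iter r phi s : vanishes_off_box r phi -> vanishes_off_box r (iter_partial s phi).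
Proof. by move=> v; elim: s => [//|i s IH]; exact: vanishes_off_box_partial. Qed.

Lemma vanishes_off_box_test V phi : test_on V phi -> exists2 r, 0 < r & vanishes_off_box r phi.
Proof.
case=> _ cs _; have [r r0 Hr] := compact_subbox cs.
exists (r + 1); first by rewrite ltr_wpDl.
move=> x nB; apply/eqP; apply: contrapT => /negP px; apply: nB.
have /Hr[x1 x2] : supp phi x by exact: subset_closure.
by apply/plane_boxE; split; lra.
Qed.

Lemma integrable_box_cst r (c : R) : mu2.-integrable (plane_box r) (EFin \o cst c).
Proof.
have mB := @measurable_plane_box R r.
apply/integrableP; split; first exact/measurable_EFinP/measurable_cst.
rewrite (eq_integral (cst `|c|%:E)) ?integral_cst//.
have [r0|r0] := leP 0 r.
  have -> : (`|c|%:E * mu2 (plane_box r) = (`|c| * (4 * r ^+ 2))%:E)%E.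
    by rewrite EFinM; congr (_ * _)%E; exact: plane_box_measure.
  exact: ltry.
have -> : plane_box r = set0 :> set (Y * Y).
  rewrite -subset0 => x /plane_boxE[x1 _].
  by have := le_lt_trans (le_trans (normr_ge0 _) x1) r0; rewrite ltxx.
by rewrite measure0 mule0.
Qed.

Lemma integrable_box_continuous r phi : continuous phi -> mu2.-integrable (plane_box r) (EFin \o phi).
Proof.
move=> cp; have mB := @measurable_plane_box R r.
have [C C0 HC] := compact_continuous_bound (@compact_box R r) (fun y _ => cp y).
have := @integrable_mul_bounded R _ _ mu2 _ mB (cst 1) phi C (integrable_box_cst r 1)
  (measurable_funTS (continuous_measurable_plane cp)) (fun z Bz => HC z ((plane_boxE r z).1 Bz)).
by apply: eq_integrable => // z _; rewrite /= mul1r.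
Qed.

Lemma Rintegral_box r (f : Y * Y -> R) : vanishes_off_box r f ->
  \int[mu2]_(x in setT) f x = \int[mu2]_(x in plane_box r) f x.
Proof.
move=> v; rewrite [RHS]Rintegral_mkcond; congr (Rintegral _ _ _); apply/funext => x.
rewrite patchE; case: ifPn => // /negP; rewrite inE; exact: v.
Qed.

Lemma integrable_setT_box r (f : Y * Y -> R) : vanishes_off_box r f ->
  mu2.-integrable (plane_box r) (EFin \o f) -> mu2.-integrable setT (EFin \o f).
Proof.
move=> v; have mB := @measurable_plane_box R r.
move/(integrable_mkcond _ mB); apply: eq_integrable => // x _.
rewrite patchE; case: ifPn => // /negP; rewrite inE => /v /= ->.
by [].
Qed.

Let m1 : measurable_fun (setT : set (Y * Y)) (fst : Y * Y -> R). Proof. exact: measurable_fst. Qed.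
Let m2 : measurable_fun (setT : set (Y * Y)) (snd : Y * Y -> R). Proof. exact: measurable_snd. Qed.
Let mc (c : R) : measurable_fun (setT : set (Y * Y)) (cst c : Y * Y -> R). Proof. exact: measurable_cst. Qed.

Local Notation PI r c := (@param_integral R _ (Y * Y)%type mu2 (plane_box r) fst snd (cst c) (cst c)).

Let bfst r (z : Y * Y) : plane_box r z -> `|z.1| <= Num.max r 1.
Proof. by move=> /plane_boxE[z1 _]; rewrite le_max z1. Qed.
Let bsnd r (z : Y * Y) : plane_box r z -> `|z.2| <= Num.max r 1.
Proof. by move=> /plane_boxE[_ z1]; rewrite le_max z1. Qed.
Let bcst r (c : R) (z : Y * Y) : `|c| <= 1 -> plane_box r z -> `|(cst c : Y * Y -> R) z| <= Num.max r 1.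
Proof. by move=> c1 _; rewrite le_max c1 orbT. Qed.

Let N1 : `|1 : R| <= 1. Proof. by rewrite normr1. Qed.

Let smoothPI r c w b : `|c| <= 1 -> mu2.-integrable (plane_box r) (EFin \o w) -> smooth b -> smooth (PI r c w b).
Proof.
move=> c1; exact: (smooth_param (measurable_plane_box r) m1 m2 (mc c) (mc c) (@bfst r) (@bsnd r)
  (fun z => bcst c1) (fun z => bcst c1)).
Qed.

Let partialPI r c i w b : `|c| <= 1 -> mu2.-integrable (plane_box r) (EFin \o w) -> smooth b ->
  partial i (PI r c w b) = PI r c (fun z => w z * c) (partial i b).
Proof.
move=> c1 iw sb; rewrite (partial_param (measurable_plane_box r) m1 m2 (mc c) (mc c) (@bfst r) (@bsnd r)
  (fun z => bcst c1) (fun z => bcst c1) i iw sb).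
by case: (I2P i) => ->.
Qed.

Section singular.
Variables (L : R * R -> R) (mL : measurable_fun (setT : set (Y * Y)) L).
Hypothesis iL : forall r, 0 < r -> mu2.-integrable (plane_box r) (EFin \o L).

Let shift_param phi y z : phi (z + y) =
  phi (z.1 + (cst 1 : R -> R) z.1 * y.1, z.2 + (cst 1 : R -> R) z.2 * y.2).
Proof. by congr phi; case: z => a b; case: y => c d; rewrite /= !mul1r. Qed.

Lemma vanishes_off_box_shift r s phi y : vanishes_off_box r phi -> plane_box s y ->
  vanishes_off_box (r + s) (fun z => L z * phi (z + y)).
Proof.
move=> v By z nB; rewrite v ?mulr0// => /plane_boxE[z1 z2]; apply: nB.
case/plane_boxE: By => y1 y2; apply/plane_boxE.
have tri (a b : R) : `|a + b| <= r -> `|b| <= s -> `|a| <= r + s.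
  by move=> H1 H2; rewrite -(addrK b a) (le_trans (ler_normB _ _))// lerD.
by split; [exact: tri z1 y1|exact: tri z2 y2].
Qed.

Lemma integrable_shift r s phi y : smooth phi -> vanishes_off_box r phi ->
  0 < r -> plane_box s y -> mu2.-integrable setT (EFin \o (fun z => L z * phi (z + y))).
Proof.
move=> sp v r0 By.
have s0 : 0 <= s by case/plane_boxE: By => y1 _; exact: le_trans y1.
have rs0 : 0 < r + s by rewrite ltr_wpDr.
apply: (integrable_setT_box (vanishes_off_box_shift v By)).
have := integrable_param (measurable_plane_box (r + s)) m1 m2 (mc 1) (mc 1) (@bfst (r + s)) (@bsnd (r + s))
  (fun z => bcst N1) (fun z => bcst N1) y (iL rs0) (smooth_continuousT sp).
by apply: eq_integrable; [exact: measurable_plane_box|move=> z _; rewrite /= shift_param].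
Qed.

(** Translation by [y] moves the parameter from the possibly singular kernel into the smooth [phi].
    The scalar is carried along because extracting it uses the integrability established for the
    translated form. *)
Lemma plane_convZ_shift (c : R) r s phi y : smooth phi -> vanishes_off_box r phi ->
  0 < r -> plane_box s y ->
  plane_conv (fun x => c * L x) phi y = c * \int[mu2]_(z in setT) (L z * phi (z + y)).
Proof.
move=> sp v r0 By; have iT := integrable_shift sp v r0 By.
have my : measurable_fun (setT : set (Y * Y)) (fun x : Y * Y => (x - y : Y * Y)) by exact: measurable_translate2.
have mf : measurable_fun (setT : set (Y * Y)) (fun x => c * L (x - y) * phi x).
  apply: measurable_funM; last exact: continuous_measurable_plane (smooth_continuousT sp).
  by apply: measurable_funM; [exact: measurable_cst|exact: (measurableT_comp mL my)].
have eqf : (fun x => c * L (x + y - y) * phi (x + y)) = (fun x => c * (L x * phi (x + y))).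
  by apply/funext => x; rewrite addrK mulrA.
rewrite /plane_conv (@Rintegral_translate R y _ mf) eqf; first exact: RintegralZl measurableT iT.
by have := integrableZl measurableT c iT; apply: eq_integrable.
Qed.

Lemma plane_conv_shift r s phi y : smooth phi -> vanishes_off_box r phi ->
  0 < r -> plane_box s y ->
  plane_conv L phi y = \int[mu2]_(z in setT) (L z * phi (z + y)).
Proof.
move=> sp v r0 By; rewrite -[RHS]mul1r -(plane_convZ_shift 1 sp v r0 By).
by apply: eq_Rintegral => x _; rewrite mul1r.
Qed.

(** As long as [y] stays in the box of half-side [s], the translated integrand lives in the fixed
    box of half-side r + s. *)
Lemma plane_conv_param r s phi y : smooth phi -> vanishes_off_box r phi ->
  0 < r -> plane_box s y -> plane_conv L phi y = PI (r + s) 1 L phi y.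
Proof.
move=> sp v r0 By; rewrite (plane_conv_shift sp v r0 By) (Rintegral_box (vanishes_off_box_shift v By)).
by rewrite /param_integral; apply: eq_Rintegral => z _; rewrite shift_param.
Qed.

Lemma open_inner_box s : open [set y : R * R | `|y.1| < s /\ `|y.2| < s].
Proof.
have -> : [set y : R * R | `|y.1| < s /\ `|y.2| < s] = ball (0 : R * R) s.
  by apply/seteqP; split=> -[a b] /= [H1 H2]; split; move: H1 H2; rewrite /ball /= !sub0r !normrN.
exact: ball_open.
Qed.

Lemma inner_boxS s (y : R * R) : `|y.1| < s /\ `|y.2| < s -> plane_box s y.
Proof. by case=> y1 y2; apply/plane_boxE; split; exact: ltW. Qed.

Lemma inner_box_ex (y : R * R) : exists2 s, 0 < s & `|y.1| < s /\ `|y.2| < s.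
Proof.
have := normr_ge0 y.1; have := normr_ge0 y.2; move=> H1 H2.
by exists (`|y.1| + `|y.2| + 1); [lra|split; lra].
Qed.

Lemma plane_convZ (c : R) r phi : smooth phi -> 0 < r -> vanishes_off_box r phi ->
  plane_conv (fun x => c * L x) phi = fun y => c * plane_conv L phi y.
Proof.
move=> sp r0 v; apply/funext => y; have [s s0 /inner_boxS By] := inner_box_ex y.
by rewrite (plane_convZ_shift c sp v r0 By) (plane_conv_shift sp v r0 By).
Qed.

(* The derivatives fall on the test function, so that the kernel may be singular. *)
Lemma smooth_plane_conv r phi : smooth phi -> 0 < r -> vanishes_off_box r phi ->
  smooth (plane_conv L phi).
Proof.
move=> sp r0 v; apply: smooth_local => y; have [s s0 ys] := inner_box_ex y.
exists [set y : R * R | `|y.1| < s /\ `|y.2| < s]; split; [exact: open_inner_box|exact: ys|].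
have sP : smooth (PI (r + s) 1 L phi).
  by apply: smoothPI; rewrite ?normr1//; apply: iL; exact: addr_gt0.
have sP' : smooth_on [set y : R * R | `|y.1| < s /\ `|y.2| < s] (PI (r + s) 1 L phi).
  exact: smooth_sub (@subsetT _ _) sP.
have E z : `|z.1| < s /\ `|z.2| < s -> PI (r + s) 1 L phi z = plane_conv L phi z.
  by move=> Bz; apply/esym; exact: (plane_conv_param sp v r0 (inner_boxS Bz)).
exact: (smooth_eq (@open_inner_box s) E sP').
Qed.

Lemma partial_plane_conv r phi i : smooth phi -> 0 < r -> vanishes_off_box r phi ->
  partial i (plane_conv L phi) = plane_conv L (partial i phi).
Proof.
move=> sp r0 v; apply/funext => y; have [s s0 ys] := inner_box_ex y.
have irs : mu2.-integrable (plane_box (r + s)) (EFin \o L) by apply: iL; exact: addr_gt0.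
rewrite (partial_eq_on i (@open_inner_box s) (g := PI (r + s) 1 L phi) _ ys); last first.
  by move=> z Bz; rewrite (plane_conv_param sp v r0 (inner_boxS Bz)).
rewrite (partialPI i N1 irs sp).
rewrite (plane_conv_param (smooth_partial i sp) (vanishes_off_box_partial i v) r0 (inner_boxS ys)).
have -> : (fun z => L z * 1) = L by apply/funext => z; rewrite mulr1.
reflexivity.
Qed.

Lemma iter_plane_conv r phi s : smooth phi -> 0 < r -> vanishes_off_box r phi ->
  iter_partial s (plane_conv L phi) = plane_conv L (iter_partial s phi).
Proof.
move=> sp r0 v; elim: s => [//|i s IH] /=.
by rewrite IH (partial_plane_conv i (smooth_iter s sp) r0 (vanishes_off_box_iter s v)).
Qed.

End singular.

Section regular.
Variables (r : R) (phi : R * R -> R) (sphi : smooth phi) (v : vanishes_off_box r phi).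

Let iphi : mu2.-integrable (plane_box r) (EFin \o phi).
Proof. by apply: integrable_box_continuous; exact: smooth_continuousT. Qed.

Let N11 : `|-1 : R| <= 1. Proof. by rewrite normrN normr1. Qed.

Lemma plane_conv_regular G : plane_conv G phi = PI r (-1) phi G.
Proof.
apply/funext => y; rewrite /plane_conv (@Rintegral_box r); last first.
  by move=> x /v ->; rewrite mulr0.
apply: eq_Rintegral => z _; rewrite mulrC; congr (_ * G _).
by case: z => a b; case: y => c d; rewrite /= !mulN1r.
Qed.

Lemma smooth_plane_conv_regular G : smooth G -> smooth (plane_conv G phi).
Proof. by move=> sG; rewrite plane_conv_regular; exact: smoothPI. Qed.

Lemma partial_plane_conv_regular G i : smooth G ->
  partial i (plane_conv G phi) = fun y => - plane_conv (partial i G) phi y.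
Proof.
move=> sG; rewrite plane_conv_regular (partialPI _ N11 iphi sG); apply/funext => y.
rewrite plane_conv_regular.
have H := integrable_param (measurable_plane_box r) m1 m2 (mc (-1)) (mc (-1)) (@bfst r) (@bsnd r)
    (fun z => bcst N11) (fun z => bcst N11) y iphi (smooth_continuousT (smooth_partial i sG)).
rewrite /param_integral -[RHS]mulN1r -(RintegralZl _ (measurable_plane_box r) H).
by apply: eq_Rintegral => z _; rewrite mulrN1 mulNr; apply/esym; exact: mulN1r.
Qed.

(** For a smooth kernel the derivatives in y fall on [G], each with a sign because y enters through
    x - y. *)
Lemma iter_plane_conv_regular G s : smooth G ->
  iter_partial s (plane_conv G phi) = fun y => (-1) ^+ size s * plane_conv (iter_partial s G) phi y.
Proof.
move=> sG; elim: s => [|i s IH] /=.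
  by apply/funext => y; rewrite mul1r.
have sIG := smooth_iter s sG.
rewrite IH (partialZ _ i (smooth_plane_conv_regular sIG)) (partial_plane_conv_regular i sIG).
by apply/funext => y; rewrite exprS mulN1r mulrN mulNr.
Qed.

End regular.

End plane_convolution.

(** * Homogeneous functions on the punctured plane *)

Section punctured.
Context {R : realType}.
Variable x0 : R * R.
Implicit Types (f g h : R * R -> R) (x y : R * R) (b c n m : nat) (i : 'I_2).

Definition punctured : set (R * R) := [set y | y <> x0].
Local Notation Om := punctured.

Lemma open_punctured : open Om.
Proof.
have -> : Om = ~` [set x0] by [].
apply: closed_openC; apply: compact_closed; first exact: norm_hausdorff.
exact: compact_set1.
Qed.
Let oOm : open Om := open_punctured.

Definition cc i (y : R * R) : R := xcoord i y - xcoord i x0.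
Definition rinv (y : R * R) : R := (Num.sqrt (sqdist x0 y))^-1.
(** The kernels of the normal operator are, up to sign, those with b + c = 2m and n = 2m + 1,
    centred at the origin. At [x0] itself [rinv] is 0, the inverse of 0. *)
Definition mono b c n (y : R * R) : R := cc ord0 y ^+ b * cc ord_max y ^+ c * rinv y ^+ n.

Lemma smooth_cc V i : open V -> smooth_on V (cc i).
Proof.
move=> oV; apply: (smoothB oV); first exact: smooth_sub (@subsetT _ _) (smooth_coord i).
exact: smooth_cst.
Qed.

Lemma partial_cc i j y : partial j (cc i) y = (i == j)%:R.
Proof.
have dc := smooth_derivable (smooth_coord (R := R) i) (I : setT y).
rewrite /cc (partialD_at (dc j) (derivable_cst _ _ _)) partial_cst addr0.
by rewrite partial_coord.
Qed.

Lemma sqdistE y : sqdist x0 y = cc ord0 y ^+ 2 + cc ord_max y ^+ 2.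
Proof. by []. Qed.

Lemma sqdist_gt0 y : Om y -> 0 < sqdist x0 y.
Proof.
move=> yx; rewrite lt_neqAle addr_ge0 ?sqr_ge0// andbT eq_sym paddr_eq0 ?sqr_ge0//.
apply/negP => /andP[]; rewrite !sqrf_eq0 !subr_eq0 => /eqP e1 /eqP e2; apply: yx.
by case: y x0 e1 e2 => a b [c d] /= -> ->.
Qed.

Lemma rinv_neq0 y : Om y -> rinv y != 0.
Proof. by move=> yx; rewrite invr_eq0 gt_eqF// sqrtr_gt0 sqdist_gt0. Qed.

Lemma rinv_sqr y : Om y -> rinv y ^+ 2 * (cc ord0 y ^+ 2 + cc ord_max y ^+ 2) = 1.
Proof.
move=> yx; rewrite exprVn sqr_sqrtr ?ltW ?sqdist_gt0// -sqdistE mulVf//.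
by rewrite gt_eqF// sqdist_gt0.
Qed.

Lemma is_derive_rinv y i : Om y -> is_derive y (basis_vec R i) rinv (- (cc i y * rinv y ^+ 3)).
Proof.
move=> yx; have s0 := sqdist_gt0 yx.
have Ds := smooth_is_derive i (smooth_sqdist x0) (I : setT y).
have Dq : is_derive (sqdist x0 y) 1 (@Num.sqrt R) (2 * Num.sqrt (sqdist x0 y))^-1 by exact: is_derive1_sqrt.
have Dsq := is_derive_comp1 Dq Ds.
have q0 : Num.sqrt (sqdist x0 y) != 0 by rewrite gt_eqF// sqrtr_gt0.
have [dsq vsq] := Dsq.
have E : partial i (sqdist x0) y = 2 * cc i y.
  have -> : sqdist x0 = fun y => cc ord0 y * cc ord0 y + cc ord_max y * cc ord_max y.
    by apply/funext => z; rewrite sqdistE !expr2.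
  have d0 := smooth_derivable (smooth_cc ord0 openT) (I : setT y).
  have d1 := smooth_derivable (smooth_cc ord_max openT) (I : setT y).
  rewrite (partialD_at (derivableM (d0 i) (d0 i)) (derivableM (d1 i) (d1 i))).
  rewrite (partialM_at (d0 i) (d0 i)) (partialM_at (d1 i) (d1 i)) !partial_cc.
  by case: (I2P i) => -> /=; ring.
pose q (y : R * R) : R := Num.sqrt (sqdist x0 y).
have dV := @derivableV _ _ q y (basis_vec R i) q0 dsq.
have vV := @deriveV _ _ q y (basis_vec R i) q0 dsq.
rewrite vsq E in vV.
split; first exact: dV.
apply: etrans vV _; rewrite /GRing.scale /= /rinv; rewrite /q; move: q0; move: (Num.sqrt _) => t t0.
by field.
Qed.

Lemma smooth_rinv : smooth_on Om rinv.
Proof.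
apply/smooth_onP; elim=> [//|n IH]; split=> [y yx|i y yx|i].
- have cs : {for y, continuous (fun y => Num.sqrt (sqdist x0 y))}.
    apply: (cvg_comp (sqdist x0) (@Num.sqrt R) (smooth_continuous (smooth_sqdist x0) (I : setT y))).
    exact: sqrt_continuous.
  apply: cvgV => //; by rewrite gt_eqF// sqrtr_gt0 sqdist_gt0.
- by case: (is_derive_rinv i yx).
have Cc := (smooth_onP _ _).1 (smoothN oOm (smooth_cc i oOm)) n.
have C3 := CnM oOm IH (CnM oOm IH IH).
apply: (Cn_eq oOm _ (CnM oOm Cc C3)) => y yx; apply/esym.
rewrite [LHS](@derive_val _ _ _ _ _ _ _ (is_derive_rinv i yx)).
by rewrite -mulNr !exprS expr0 mulr1.
Qed.

Lemma smooth_mono b c n : smooth_on Om (mono b c n).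
Proof.
apply: (smoothM oOm (smoothM oOm (smoothX b oOm (smooth_cc _ oOm)) (smoothX c oOm (smooth_cc _ oOm)))).
exact: (smoothX n oOm smooth_rinv).
Qed.

Lemma partialX_at f n i y : derivable f y (basis_vec R i) ->
  partial i (fun y => f y ^+ n) y = n%:R * f y ^+ n.-1 * partial i f y.
Proof.
Transparent partial.
by move=> df; have := deriveX n df; rewrite exprfctE.
Opaque partial.
Qed.

Lemma partial_mono b c n i y : Om y -> partial i (mono b c n) y =
  (if i == ord0 then b%:R * mono b.-1 c n y else c%:R * mono b c.-1 n y)
  - n%:R * (cc i y * mono b c n.+2 y).
Proof.
move=> yx.
have d0 := smooth_derivable (smoothX b oOm (smooth_cc ord0 oOm)) yx.
have d1 := smooth_derivable (smoothX c oOm (smooth_cc ord_max oOm)) yx.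
have dr := smooth_derivable (smoothX n oOm smooth_rinv) yx.
have e0 := smooth_derivable (smooth_cc ord0 oOm) yx.
have e1 := smooth_derivable (smooth_cc ord_max oOm) yx.
have er := smooth_derivable smooth_rinv yx.
have d01 := smooth_derivable (smoothM oOm (smoothX b oOm (smooth_cc ord0 oOm))
  (smoothX c oOm (smooth_cc ord_max oOm))) yx.
rewrite (partialM_at (d01 i) (dr i)) (partialM_at (d0 i) (d1 i)).
rewrite (partialX_at b (e0 i)) (partialX_at c (e1 i)) (partialX_at n (er i)) !partial_cc.
rewrite [partial i rinv y](@derive_val _ _ _ _ _ _ _ (is_derive_rinv i yx)) /mono.
have -> : n%:R * rinv y ^+ n.-1 * (- (cc i y * rinv y ^+ 3)) = - (n%:R * (cc i y * rinv y ^+ n.+2)).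
  by case: n {dr} => [|n] /=; rewrite ?mul0r ?oppr0// !exprS; ring.
by case: (I2P i) => -> /=; ring.
Qed.

(** Homogeneity of degree [d] off [x0], encoded by Euler's relation, which is the form that the
    divergence computations use. *)
Definition homog (d : R) g := smooth_on Om g /\
  forall y, Om y -> cc ord0 y * partial ord0 g y + cc ord_max y * partial ord_max g y = d * g y.

Lemma homog_mono b c n : homog (b%:R + c%:R - n%:R) (mono b c n).
Proof.
split; first exact: smooth_mono.
move=> y yx; rewrite !partial_mono//= /mono.
have r1 := rinv_sqr yx.
set X := cc ord0 y in r1 *; set Z := cc ord_max y in r1 *; set r := rinv y in r1 *.
have Xb : X * (b%:R * (X ^+ b.-1 * Z ^+ c * r ^+ n)) = b%:R * (X ^+ b * Z ^+ c * r ^+ n).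
  by case: b => [|b] /=; [rewrite !mul0r mulr0|rewrite exprS; ring].
have Zc : Z * (c%:R * (X ^+ b * Z ^+ c.-1 * r ^+ n)) = c%:R * (X ^+ b * Z ^+ c * r ^+ n).
  by case: c {Xb} => [|c] /=; [rewrite !mul0r mulr0|rewrite exprS; ring].
rewrite !mulrBr Xb Zc.
have -> : r ^+ n.+2 = r ^+ n * r ^+ 2 by rewrite -exprD addn2.
transitivity ((b%:R + c%:R) * (X ^+ b * Z ^+ c * r ^+ n) -
   n%:R * (X ^+ b * Z ^+ c * r ^+ n) * (r ^+ 2 * (X ^+ 2 + Z ^+ 2))); first by ring.
by rewrite r1; ring.
Qed.

Lemma homogM d g i : homog d g -> homog (d + 1) (fun y => cc i y * g y).
Proof.
move=> [sg Hg]; split; first exact: (smoothM oOm (smooth_cc _ oOm) sg).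
move=> y yx; have dg := smooth_derivable sg yx; have dc := smooth_derivable (smooth_cc i oOm) yx.
rewrite !(partialM_at (dc _) (dg _)) !partial_cc.
have -> : (d + 1) * (cc i y * g y) = cc i y * (d * g y) + cc i y * g y by ring.
rewrite -(Hg y yx).
by case: (I2P i) => -> /=; ring.
Qed.

(** Formally (d1 x2 - d2 x1)^n with all derivatives placed to the left of all multiplications; this
    differs from the n-th power of the rotation field. In this order the multiplications act
    directly on the kernel and merely shift its exponents. *)
Fixpoint rotop n g : R * R -> R :=
  if n is n'.+1 then
    fun y => partial ord0 (rotop n' (fun y => cc ord_max y * g y)) y
           - partial ord_max (rotop n' (fun y => cc ord0 y * g y)) y
  else g.

Lemma smooth_ccM i g : smooth_on Om g -> smooth_on Om (fun y => cc i y * g y).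
Proof. by move=> sg; exact: (smoothM oOm (smooth_cc _ oOm) sg). Qed.

Lemma smooth_rotop n g : smooth_on Om g -> smooth_on Om (rotop n g).
Proof.
elim: n g => [//|n IH] g sg /=.
have s0 := smooth_partial ord0 (IH _ (smooth_ccM ord_max sg)).
have s1 := smooth_partial ord_max (IH _ (smooth_ccM ord0 sg)).
exact: (smoothB oOm s0 s1).
Qed.

Lemma rotop_eq n f g : (forall y, Om y -> f y = g y) -> forall y, Om y -> rotop n f y = rotop n g y.
Proof.
elim: n f g => [//|n IH] f g fg y yx /=.
congr (_ - _); apply: (partial_eq_on _ oOm) => //; apply: IH => z zx; by rewrite fg.
Qed.

Lemma partialZD_on (a : R) f g i y : smooth_on Om f -> smooth_on Om g -> Om y ->
  partial i (fun y => a * f y + g y) y = a * partial i f y + partial i g y.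
Proof.
move=> sf sg yx.
have df : derivable f y (basis_vec R i) := smooth_derivable sf yx.
have dg : derivable g y (basis_vec R i) := smooth_derivable sg yx.
have daf : derivable (fun y => a * f y) y (basis_vec R i) := smooth_derivable (smoothZ a oOm sf) yx.
rewrite (partialD_at daf dg) (partialM_at (derivable_cst a _ _) df) partial_cst.
by rewrite mul0r add0r.
Qed.

Lemma rotopZD n (a : R) f g y : smooth_on Om f -> smooth_on Om g -> Om y ->
  rotop n (fun y => a * f y + g y) y = a * rotop n f y + rotop n g y.
Proof.
elim: n f g y => [//|n IH] f g y sf sg yx /=.
have E i j : partial j (rotop n (fun y => cc i y * (a * f y + g y))) y =
    a * partial j (rotop n (fun y => cc i y * f y)) y + partial j (rotop n (fun y => cc i y * g y)) y.
  have sif := smooth_ccM i sf; have sig := smooth_ccM i sg.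
  rewrite -(partialZD_on a j (smooth_rotop n sif) (smooth_rotop n sig) yx).
  apply: (partial_eq_on j oOm _ yx) => z zx.
  rewrite -IH//; apply: rotop_eq zx => t _; ring.
by rewrite !E; ring.
Qed.

(* Homogeneity of degree -n-2 makes [y g] divergence free after the n rotations. *)
Lemma rotop_euler n g : homog (- n.+2%:R) g -> forall y, Om y ->
  partial ord0 (rotop n (fun y => cc ord0 y * g y)) y +
  partial ord_max (rotop n (fun y => cc ord_max y * g y)) y = 0.
Proof.
elim: n g => [|n IH] g Hg y yx.
  case: Hg => sg Hg /=.
  have dg := smooth_derivable sg yx.
  have dc i j : derivable (cc i) y (basis_vec R j) := smooth_derivable (smooth_cc i oOm) yx.
  rewrite !(partialM_at (dc _ _) (dg _)) !partial_cc /=.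
  have := Hg y yx; lra.
have [sg _] := Hg.
have Hi i : homog (- n.+2%:R) (fun y => cc i y * g y).
  have := homogM i Hg; congr (homog _ _).
  by rewrite -[n.+3%:R]natr1; ring.
pose a i j := rotop n (fun y => cc i y * (cc j y * g y)).
have sa i j : smooth_on Om (a i j) by apply: smooth_rotop; do 2 apply: smooth_ccM.
have aC : a ord_max ord0 = a ord0 ord_max.
  by congr (rotop n _); apply/funext => z; rewrite mulrCA.
(* Once partial derivatives are commuted, the claim for n + 1 is d1 of [Z0] minus d2 of [Z1]. *)
have Z0 z : Om z -> partial ord0 (a ord0 ord_max) z + partial ord_max (a ord_max ord_max) z = 0.
  by move=> zx; exact: (IH _ (Hi ord_max) z zx).
have Z1 z : Om z -> partial ord0 (a ord0 ord0) z + partial ord_max (a ord_max ord0) z = 0.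
  by move=> zx; exact: (IH _ (Hi ord0) z zx).
have P0 : partial ord0 (fun z => partial ord0 (a ord0 ord_max) z + partial ord_max (a ord_max ord_max) z) y = 0.
  by rewrite (partial_eq_on ord0 oOm (g := fun=> 0) Z0 yx) partial_cst.
have P1 : partial ord_max (fun z => partial ord0 (a ord0 ord0) z + partial ord_max (a ord_max ord0) z) y = 0.
  by rewrite (partial_eq_on ord_max oOm (g := fun=> 0) Z1 yx) partial_cst.
have sp i j k : smooth_on Om (partial k (a i j)) by exact: smooth_partial.
have dp i j k l : derivable (partial k (a i j)) y (basis_vec R l) := smooth_derivable (sp i j k) yx.
rewrite (partialD_at (dp _ _ _ _) (dp _ _ _ _)) in P0.
rewrite (partialD_at (dp _ _ _ _) (dp _ _ _ _)) in P1.
have B i j k l q : partial i (fun z => partial ord0 (a j k) z - partial ord_max (a l q) z) y =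
    partial i (partial ord0 (a j k)) y - partial i (partial ord_max (a l q)) y.
  have dN : derivable (fun z => - partial ord_max (a l q) z) y (basis_vec R i) :=
    smooth_derivable (smoothN oOm (sp l q ord_max)) yx.
  rewrite (partialD_at (dp _ _ _ _) dN); congr (_ + _).
  have := partialZD_on (-1) i (sp l q ord_max) (@smooth_cst R Om 0) yx.
  rewrite partial_cst addr0 mulN1r => <-.
  by congr (partial i _ y); apply/funext => z; rewrite mulN1r addr0.
rewrite /= -/(a ord_max ord0) -/(a ord0 ord0) -/(a ord_max ord_max) -/(a ord0 ord_max).
rewrite !B.
have C1 := partialC ord0 ord_max oOm (sa ord0 ord0) yx.
have C2 := partialC ord0 ord_max oOm (sa ord_max ord_max) yx.
have fin (t1 t2 t3 t4 : R) : t1 + t4 = 0 -> t3 + t2 = 0 -> t1 - t3 + (t4 - t2) = 0.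
  by move=> H1 H2; rewrite addrACA -opprD H1 H2 subrr.
rewrite aC in P1; rewrite aC C1 -C2; exact: fin P0 P1.
Qed.

(** For the step to n + 1 the monomial is written x_i q with q of degree -n - 3. In the rotation,
    x_i^2 q is replaced by |x|^2 q minus the square of the other coordinate times q; by
    [rotop_euler] the latter cancels the mixed term, and one derivative of the case n remains. *)
Lemma rotop_mono n b c : (b + c = n)%N -> forall y, Om y ->
  rotop n (mono b c n.*2.+1) y = (-1) ^+ b * multi_partial c b rinv y.
Proof.
elim: n b c => [|n IH] b c bc y yx.
  move: bc => /eqP; rewrite addn_eq0 => /andP[/eqP -> /eqP ->].
  by rewrite /= /mono !expr0 !mul1r expr1.
have r1 := rinv_sqr.
pose q b' c' := mono b' c' n.*2.+3.
have Hq b' c' i : (b' + c' = n)%N -> homog (- n.+2%:R) (fun y => cc i y * q b' c' y).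
  move=> E; have := homogM i (homog_mono b' c' n.*2.+3); congr (homog _ _).
  have -> : n.*2.+3%:R = n%:R + n%:R + 3 :> R by rewrite -addnn -(addn3 (n + n)) !natrD.
  have -> : n.+2%:R = n%:R + 2 :> R by rewrite -addn2 natrD.
  by rewrite -natrD E; ring.
have sq b' c' : smooth_on Om (q b' c') by exact: smooth_mono.
have Eq b' c' z : Om z -> q b' c' z * (cc ord0 z ^+ 2 + cc ord_max z ^+ 2) = mono b' c' n.*2.+1 z.
  move=> zx; rewrite /q /mono.
  have -> : rinv z ^+ n.*2.+3 = rinv z ^+ n.*2.+1 * rinv z ^+ 2 by rewrite -exprD addn2.
  have E3 : rinv z ^+ 2 * (cc ord0 z ^+ 2 + cc ord_max z ^+ 2) = 1 := rinv_sqr zx.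
  rewrite mulrA -(mulrA _ (rinv z ^+ 2)) E3; ring.
rewrite doubleS; case: b bc => [|b] bc.
  case: c bc => [//|c] bc; have {}bc : (0 + c = n)%N by case: bc.
  have Es z : Om z -> mono 0 c.+1 n.*2.+3 z = cc ord_max z * q 0%N c z.
    by move=> _; rewrite /q /mono exprS; ring.
  rewrite (rotop_eq n.+1 Es yx) /= mul1r.
  have E1 := rotop_euler (Hq 0%N c ord0 bc) yx.
  have -> : partial ord0 (rotop n (fun z => cc ord_max z * (cc ord_max z * q 0%N c z))) y =
      partial ord0 (rotop n (mono 0 c n.*2.+1)) y -
      partial ord0 (rotop n (fun z => cc ord0 z * (cc ord0 z * q 0%N c z))) y.
    have s1 := smooth_ccM ord0 (smooth_ccM ord0 (sq 0%N c)).
    have := partialZD_on (-1) ord0 (smooth_rotop n s1) (smooth_rotop n (smooth_mono 0 c n.*2.+1)) yx.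
    rewrite mulN1r addrC => <-; apply: (partial_eq_on ord0 oOm _ yx) => z zx.
    rewrite -(rotopZD n (-1) s1 (smooth_mono 0 c n.*2.+1) zx); apply: (rotop_eq n _ zx) => t tx.
    by rewrite -(Eq _ _ t tx); ring.
  have E2 : rotop n (fun z => cc ord_max z * (cc ord0 z * q 0%N c z)) =
            rotop n (fun z => cc ord0 z * (cc ord_max z * q 0%N c z)).
    by congr (rotop n _); apply/funext => z; rewrite mulrCA.
  rewrite E2 in E1.
  rewrite -addrA -opprD E1 oppr0 addr0.
  apply: (partial_eq_on ord0 oOm _ yx) => z zx.
  by rewrite (IH _ _ bc z zx) expr0 mul1r.
have {}bc : (b + c = n)%N by case: bc.
have Es z : Om z -> mono b.+1 c n.*2.+3 z = cc ord0 z * q b c z.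
  by move=> _; rewrite /q /mono exprS; ring.
rewrite (rotop_eq n.+1 Es yx) /=.
have E1 := rotop_euler (Hq b c ord_max bc) yx.
have -> : partial ord_max (rotop n (fun z => cc ord0 z * (cc ord0 z * q b c z))) y =
    partial ord_max (rotop n (mono b c n.*2.+1)) y -
    partial ord_max (rotop n (fun z => cc ord_max z * (cc ord_max z * q b c z))) y.
  have s1 := smooth_ccM ord_max (smooth_ccM ord_max (sq b c)).
  have := partialZD_on (-1) ord_max (smooth_rotop n s1) (smooth_rotop n (smooth_mono b c n.*2.+1)) yx.
  rewrite mulN1r addrC => <-; apply: (partial_eq_on ord_max oOm _ yx) => z zx.
  rewrite -(rotopZD n (-1) s1 (smooth_mono b c n.*2.+1) zx); apply: (rotop_eq n _ zx) => t tx.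
  by rewrite -(Eq _ _ t tx); ring.
have E2 : rotop n (fun z => cc ord_max z * (cc ord0 z * q b c z)) =
          rotop n (fun z => cc ord0 z * (cc ord_max z * q b c z)).
  by congr (rotop n _); apply/funext => z; rewrite mulrCA.
rewrite E2 opprB addrCA addrA [X in X + _]addrC E1 add0r exprS mulN1r mulNr; congr (- _).
rewrite (partial_eq_on ord_max oOm (g := fun z => (-1) ^+ b * multi_partial c b rinv z) _ yx); last first.
  by move=> z zx; rewrite IH.
have sm : smooth_on Om (multi_partial c b rinv).
  by rewrite multi_partialE; exact: smooth_iter smooth_rinv.
have := partialZD_on ((-1) ^+ b) ord_max sm (@smooth_cst R Om 0) yx.
rewrite partial_cst addr0 => E3.
transitivity (partial ord_max (fun z => (-1) ^+ b * multi_partial c b rinv z + 0) y).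
  by congr (partial ord_max _ y); apply/funext => z; rewrite addr0.
rewrite E3; congr (_ * _).
rewrite multi_partialSr !multi_partialE.
exact: (partial_iterC ord_max _ oOm smooth_rinv yx).
Qed.

End punctured.

(** * Functionals on functions smooth away from a point *)

Section punctured_functional.
Context {R : realType}.
Variable x0 : R * R.
Implicit Types (f g h : R * R -> R) (y : R * R) (b c n m e : nat) (i : 'I_2) (l : functional R).
Local Notation Om := (punctured x0).
Let oOm : open Om := @open_punctured R x0.

(** Insensitivity to the value at [x0] is part of the notion, because the identities between kernels
    hold off [x0] only. *)
Definition punctured_functional l :=
  (forall (a : R) f g, smooth_on Om f -> smooth_on Om g ->
     l (fun y => a * f y + g y) = a * l f + l g) /\
  (forall f g, smooth_on Om f -> (forall y, Om y -> f y = g y) -> l f = l g).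

Lemma iter_partialZD_on (a : R) f g s y : smooth_on Om f -> smooth_on Om g -> Om y ->
  iter_partial s (fun y => a * f y + g y) y = a * iter_partial s f y + iter_partial s g y.
Proof.
move=> sf sg; elim: s y => [//|i s IH] y yx /=.
rewrite (partial_eq_on i oOm IH yx).
exact: (partialZD_on a i (smooth_iter s sf) (smooth_iter s sg) yx).
Qed.

Section one.
Variables (l : functional R) (Hl : punctured_functional l).

Lemma punctured0 : l (fun=> 0) = 0.
Proof.
have [lin _] := Hl; have s0 := @smooth_cst R Om 0; have := lin 1 _ _ s0 s0.
have -> : (fun _ : R * R => 1 * 0 + 0) = (fun=> 0 : R) by apply/funext => x; rewrite mulr0 addr0.
by move/eqP; rewrite mul1r -subr_eq subrr eq_sym => /eqP.
Qed.

Lemma puncturedZ (a : R) f : smooth_on Om f -> l (fun y => a * f y) = a * l f.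
Proof.
have [lin _] := Hl; move=> sf; have := lin a _ _ sf (@smooth_cst R Om 0).
rewrite punctured0 addr0 => <-.
by congr l; apply/funext => y; rewrite addr0.
Qed.

Lemma punctured_comb s (a a' : R) f g h : smooth_on Om f -> smooth_on Om g -> smooth_on Om h ->
  (forall y, Om y -> f y = a * g y + a' * h y) ->
  l (iter_partial s f) = a * l (iter_partial s g) + a' * l (iter_partial s h).
Proof.
move=> sf sg sh E; have [lin ext] := Hl.
have sg' := smooth_iter s sg; have sh' := smooth_iter s sh.
rewrite -(puncturedZ a' sh') -(lin a _ _ sg' (smoothZ a' oOm sh')).
apply: ext; first exact: smooth_iter.
move=> y yx.
rewrite (iter_partial_eq_on s oOm E yx) (iter_partialZD_on a s sg (smoothZ a' oOm sh) yx).
congr (_ + _).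
have := iter_partialZD_on a' s sh (@smooth_cst R Om 0) yx.
rewrite iter_partial_cst0 addr0 => <-.
by congr (iter_partial s _ y); apply/funext => z; rewrite addr0.
Qed.

Hypothesis l_rinv : forall s, l (iter_partial s (rinv x0)) = 0.

(** Induction on n = b + c. Differentiating x1^u x2^v / |x|^(2n+1) with u + v = n gives the
    functions wanted for n + 1, together with monomials of degree n - 1 over the same power of |x|,
    which are not of the required form; [Q] obtains those as divergences of functions of level n. *)
Lemma punctured_mono b c s : l (iter_partial s (mono x0 b c (b + c).*2.+1)) = 0.
Proof.
suff H n b' c' s' : (b' + c' = n)%N -> l (iter_partial s' (mono x0 b' c' n.*2.+1)) = 0.
  exact: H.
elim: n b' c' s' => [|n IH] b' c' s' bc.
  have {}bc : b' = 0%N /\ c' = 0%N by move/eqP: bc; rewrite addn_eq0 => /andP[/eqP ? /eqP ?].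
  rewrite bc.1 bc.2.
  have -> : mono x0 0 0 0.*2.+1 = rinv x0; last exact: l_rinv.
  by apply/funext => y; rewrite /mono !expr0 !mul1r expr1.
have sm a1 a2 a3 : smooth_on Om (mono x0 a1 a2 a3) by exact: smooth_mono.
have r1 y : Om y -> rinv x0 y ^+ 2 * (cc x0 ord0 y ^+ 2 + cc x0 ord_max y ^+ 2) = 1.
  exact: rinv_sqr.
(* The divergence of x times x1^u x2^v / |x|^(2n+1) has the factor (u + 1) + (v + 1) - (2n + 1) =
   -n. *)
have Q u v t : (u + v).+1 = n -> l (iter_partial t (mono x0 u v n.*2.+1)) = 0.
  move=> uv; have n0 : n%:R != 0 :> R by rewrite pnatr_eq0 -uv.
  have s0 := smooth_partial ord0 (sm u.+1 v n.*2.+1).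
  have s1 := smooth_partial ord_max (sm u v.+1 n.*2.+1).
  rewrite (@punctured_comb t (- n%:R^-1) (- n%:R^-1) _ _ _ (sm _ _ _) s0 s1).
    by rewrite -!iter_partial_rcons !IH ?mulr0 ?addr0// -?uv ?addSn ?addnS.
  move=> y yx; rewrite !partial_mono//=.
  set M := mono x0 u v n.*2.+1 y.
  have M0 : cc x0 ord0 y * mono x0 u.+1 v n.*2.+3 y + cc x0 ord_max y * mono x0 u v.+1 n.*2.+3 y = M.
    rewrite /M /mono; have -> : rinv x0 y ^+ n.*2.+3 = rinv x0 y ^+ n.*2.+1 * rinv x0 y ^+ 2.
      by rewrite -exprD addn2.
    transitivity (cc x0 ord0 y ^+ u * cc x0 ord_max y ^+ v * rinv x0 y ^+ n.*2.+1 *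
      (rinv x0 y ^+ 2 * (cc x0 ord0 y ^+ 2 + cc x0 ord_max y ^+ 2))).
      by rewrite !exprS; ring.
    by rewrite r1// mulr1.
  move: M0; set A1 := cc x0 ord0 y * _; set A2 := cc x0 ord_max y * _ => M0.
  have -> : A2 = M - A1 by rewrite -M0 addrC addKr.
  have -> : n.*2.+1%:R = n%:R + n%:R + 1 :> R by rewrite -addnn -(addn1 (n + n)) !natrD.
  have -> : v.+1%:R = n%:R + 1 - u.+1%:R :> R.
    by rewrite -uv !(natrD, =^~ natr1); ring.
  by field.
have N0 : n.*2.+1%:R != 0 :> R by rewrite pnatr_eq0.
have step i (u v : nat) t : (u + v)%N = n ->
    (forall y, Om y -> mono x0 b' c' n.*2.+3 y = cc x0 i y * mono x0 u v n.*2.+3 y) ->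
    l (iter_partial t (mono x0 b' c' n.*2.+3)) = 0.
  move=> uv E.
  pose w := if i == ord0 then u else v.
  pose h := if i == ord0 then mono x0 u.-1 v n.*2.+1 else mono x0 u v.-1 n.*2.+1.
  have sh : smooth_on Om h by rewrite /h; case: ifP.
  rewrite (@punctured_comb t (w%:R / n.*2.+1%:R) (- n.*2.+1%:R^-1) _ h (partial i (mono x0 u v n.*2.+1)));
    [|exact: sm|exact: sh|exact: smooth_partial|]; last first.
    move=> y yx; rewrite E// partial_mono// /w /h.
    by case: (i == ord0); field.
  rewrite -iter_partial_rcons (IH _ _ _ uv) mulr0 addr0 /w /h.
  case: (I2P i) => -> /=.
    case: u uv {E w h sh} => [|u] uv; first by rewrite !mul0r.
    by rewrite Q ?mulr0// -uv.
  case: v uv {E w h sh} => [|v] uv; first by rewrite !mul0r.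
  by rewrite Q ?mulr0// -uv addnS.
rewrite doubleS; case: b' bc step => [|b'] bc step.
  case: c' bc step => [//|c'] bc step; apply: (step ord_max 0%N c'); first by case: bc.
  by move=> y _; rewrite /mono exprS; ring.
apply: (step ord0 b' c'); first by case: bc.
by move=> y _; rewrite /mono exprS; ring.
Qed.

End one.

Section many.
Variables (m : nat) (l : nat -> functional R) (Hl : forall j, punctured_functional (l j)).
Hypothesis moments : forall a s, (a <= m)%N ->
  \sum_(0 <= j < m.+1) l j (iter_partial s (mono x0 (a + j) (m - a + (m - j)) m.*2.+1)) = 0.

Let k j := mono x0 j (m - j) m.*2.+1.

(** Unfolding one rotation trades it for one coordinate factor and one derivative; when no rotation
    is left, e + e' = m and the hypothesis applies with a = e. *)
Lemma rotop_moments n e e' s : (e + e' + n = m)%N ->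
  \sum_(0 <= j < m.+1) l j (iter_partial s
     (rotop x0 n (fun y => cc x0 ord0 y ^+ e * cc x0 ord_max y ^+ e' * k j y))) = 0.
Proof.
elim: n e e' s => [|n IH] e e' s E.
  have em : (e <= m)%N by rewrite -E -addnA leq_addr.
  rewrite -[RHS](moments s em); apply: eq_bigr => j _; congr (l j (iter_partial s _)).
  have -> : e' = (m - e)%N by rewrite -E addn0 addKn.
  by apply/funext => y; rewrite /k /mono !exprD /=; ring.
have sc a b j : smooth_on Om (fun y => cc x0 ord0 y ^+ a * cc x0 ord_max y ^+ b * k j y).
  apply: (smoothM oOm (smoothM oOm _ _) (smooth_mono _ _ _));
    exact: (smoothX _ oOm (smooth_cc _ _ oOm)).
have E1 : (e + e'.+1 + n = m)%N by rewrite -E addnS addSnnS.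
have E0 : (e.+1 + e' + n = m)%N by rewrite -E addSn addSnnS.
have := IH e e'.+1 (rcons s ord0) E1; have := IH e.+1 e' (rcons s ord_max) E0.
move=> H0 H1.
have sr a b j i : smooth_on Om (partial i (rotop x0 n (fun y => cc x0 ord0 y ^+ a * cc x0 ord_max y ^+ b * k j y))).
  exact: (smooth_partial i (smooth_rotop n (sc a b j))).
have Ej j : l j (iter_partial s (rotop x0 n.+1 (fun y => cc x0 ord0 y ^+ e * cc x0 ord_max y ^+ e' * k j y))) =
   1 * l j (iter_partial (rcons s ord0) (rotop x0 n (fun y => cc x0 ord0 y ^+ e * cc x0 ord_max y ^+ e'.+1 * k j y))) +
   -1 * l j (iter_partial (rcons s ord_max) (rotop x0 n (fun y => cc x0 ord0 y ^+ e.+1 * cc x0 ord_max y ^+ e' * k j y))).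
  rewrite !iter_partial_rcons.
  apply: (punctured_comb (Hl j) s (smooth_rotop n.+1 (sc e e' j)) (sr _ _ _ _) (sr _ _ _ _)) => y yx /=.
  rewrite mul1r mulN1r; congr (_ - _); congr (partial _ (rotop x0 n _) y);
    by apply/funext => z; rewrite exprS; ring.
under eq_bigr do rewrite Ej.
by rewrite big_split /= -!mulr_sumr H0 H1 !mulr0 addr0.
Qed.

Lemma rinv_moments s :
  \sum_(0 <= j < m.+1) (-1) ^+ j * l j (iter_partial s (multi_partial (m - j) j (rinv x0))) = 0.
Proof.
rewrite -[RHS](@rotop_moments m 0 0 s (add0n m)).
apply: eq_big_nat => j /andP[_ jm]; rewrite ltnS in jm.
have sk : smooth_on Om (k j) by exact: smooth_mono.
have E : (fun y => cc x0 ord0 y ^+ 0 * cc x0 ord_max y ^+ 0 * k j y) = k j.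
  by apply/funext => y; rewrite !expr0 !mul1r.
have sm : smooth_on Om (multi_partial (m - j) j (rinv x0)).
  by rewrite multi_partialE; exact: (smooth_iter _ (@smooth_rinv R x0)).
rewrite E (punctured_comb (Hl j) s (a := (-1) ^+ j) (a' := 0) (smooth_rotop m sk) sm (@smooth_cst R Om 0)).
  by rewrite mul0r addr0.
by move=> y yx; rewrite mul0r addr0 (rotop_mono (subnKC jm) yx).
Qed.

End many.

End punctured_functional.

(** * Mollification at a point of infinite order vanishing *)

Section mollifier.
Context {R : realType}.
Local Notation Y := (measurableTypeR R).
Local Notation mu := (@lebesgue_measure R).
Local Notation mu2 := (mu \x mu)%E.
Implicit Types (f g G phi : R * R -> R) (x y : R * R) (r : R).

Lemma continuous_translate (f : R * R -> R) (w : R * R) :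
  continuous f -> continuous (fun x : R * R => f (x + w)).
Proof.
move=> cf x; apply: (cvg_comp (fun x : R * R => x + w) f _ (cf (x + w))).
by apply: cvgD; [exact: cvg_id|exact: cvg_cst].
Qed.

(** Replaces a maximum over the finitely many words of length at most [N]: the constants for the
    empty word and for the two possible first letters are added. *)
Lemma words_bound (P : seq 'I_2 -> R -> Prop) :
  (forall t C C', P t C -> C <= C' -> P t C') ->
  (forall t, exists2 C : R, 0 <= C & P t C) ->
  forall N, exists2 C : R, 0 <= C & forall t, (size t <= N)%N -> P t C.
Proof.
move=> mono_P HP N; elim: N P mono_P HP => [|N IH] P mono_P HP.
  by have [C C0 HC] := HP [::]; exists C => // -[].
have [C C0 HC] := HP [::].
have [C1 C10 HC1] := IH (fun t => P (ord0 :: t)) (fun t => mono_P _) (fun t => HP _).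
have [C2 C20 HC2] := IH (fun t => P (ord_max :: t)) (fun t => mono_P _) (fun t => HP _).
exists (C + (C1 + C2)); first by rewrite !addr_ge0.
move=> [_|i t /= tN]; first by apply: mono_P HC _; rewrite lerDl addr_ge0.
case: (I2P i) => ->.
  by apply: mono_P (HC1 t tN) _; rewrite addrCA lerDl addr_ge0.
by apply: mono_P (HC2 t tN) _; rewrite addrA lerDr addr_ge0.
Qed.

Lemma lipschitz_box r f : smooth f -> exists2 C : R, 0 <= C &
  forall x y, plane_box r x -> plane_box r y ->
   `|f x - f y| <= C * (`|x.1 - y.1| + `|x.2 - y.2|).
Proof.
move=> sf.
have bnd i : exists2 C : R, 0 <= C & forall x, `|x.1| <= r /\ `|x.2| <= r -> `|partial i f x| <= C.
  exact: (compact_continuous_bound (@compact_box R r) (fun y _ => smooth_continuousT (smooth_partial i sf) (x := y))).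
have [C0 C00 H0] := bnd ord0; have [C1 C10 H1] := bnd ord_max.
exists (C0 + C1); first exact: addr_ge0.
move=> [x1 x2] [y1 y2] /plane_boxE[/= a1 a2] /plane_boxE[/= b1 b2].
pose g (t : R) := f (t, x2); pose h (t : R) := f (y1, t).
have seg (a b t : R) : `|a| <= r -> `|b| <= r -> (a <= t <= b) || (b <= t <= a) -> `|t| <= r.
  rewrite !ler_norml => /andP[? ?] /andP[? ?] /orP[] /andP[? ?]; apply/andP; split; lra.
have der1 (t : R) : is_derive t 1 g (partial ord0 f (t, x2)).
  by apply/is_derive_slice1; exact: smooth_is_derive sf I.
have der2 (t : R) : is_derive t 1 h (partial ord_max f (y1, t)).
  by apply/is_derive_slice2; exact: smooth_is_derive sf I.
have mvt (k dk : R -> R) (C a b : R) : (forall t : R, is_derive t 1 k (dk t)) ->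
    (forall t : R, (a <= t <= b) || (b <= t <= a) -> `|dk t| <= C) -> `|k a - k b| <= C * `|a - b|.
  move=> dkt kC.
  have cont (u v : R) : {within `[u, v], continuous k}.
    by apply: derivable_within_continuous => t _; case: (dkt t).
  have [ab|/ltW ba] := leP a b.
    have [t /itvP tab E] := MVT_segment ab (fun t _ => dkt t) (cont a b).
    rewrite -normrN opprB E normrM (distrC a b) ler_wpM2r// kC//.
    by rewrite !tab.
  have [t /itvP tab E] := MVT_segment ba (fun t _ => dkt t) (cont b a).
  by rewrite E normrM ler_wpM2r// kC// !tab orbT.
have B1 : `|g x1 - g y1| <= C0 * `|x1 - y1|.
  by apply: mvt der1 _ => t tab; apply: H0; split=> //; exact: seg tab.
have B2 : `|h x2 - h y2| <= C1 * `|x2 - y2|.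
  by apply: mvt der2 _ => t tab; apply: H1; split=> //; exact: seg tab.
have -> : f (x1, x2) - f (y1, y2) = (g x1 - g y1) + (h x2 - h y2) by rewrite /g /h; ring.
apply: le_trans (ler_normD _ _) _; apply: le_trans (lerD B1 B2) _.
rewrite mulrDl !mulrDr /=.
have := mulr_ge0 C00 (normr_ge0 (x2 - y2)); have := mulr_ge0 C10 (normr_ge0 (x1 - y1)).
by move=> p1 p2; clear -p1 p2; lra.
Qed.

Lemma box_integral_bound r f (B : R) : 0 <= r -> continuous f ->
  (forall x, plane_box r x -> `|f x| <= B) ->
  `|\int[mu2]_(x in plane_box r) f x| <= B * (4 * r ^+ 2).
Proof.
move=> r0 cf fB; have mB := @measurable_plane_box R r.
have icf := integrable_box_continuous (r) cf.
apply: le_trans (le_normr_Rintegral mB icf) _.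
apply: le_trans (le_Rintegral mB (integrable_norm icf) (integrable_box_cst r B) fB) _.
rewrite Rintegral_cst//.
by have := congr1 fine (plane_box_measure r0) => /= H; rewrite [X in B * X]H.
Qed.

Lemma le_box_integral r s f : r <= s -> continuous f -> (forall x, plane_box s x -> 0 <= f x) ->
  \int[mu2]_(x in plane_box r) f x <= \int[mu2]_(x in plane_box s) f x.
Proof.
move=> rs cf f0; have mB t := @measurable_plane_box R t.
have sub : plane_box r `<=` plane_box s.
  by move=> x /plane_boxE[H1 H2]; apply/plane_boxE; split; [exact: le_trans H1 rs|exact: le_trans H2 rs].
rewrite [X in X <= _]Rintegral_mkcond [X in _ <= X]Rintegral_mkcond.
apply: le_Rintegral => //.
- have := (integrable_mkcond _ (mB r)).1 (integrable_box_continuous r cf).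
  by apply: eq_integrable => // x _; rewrite restrict_EFin.
- have := (integrable_mkcond _ (mB s)).1 (integrable_box_continuous s cf).
  by apply: eq_integrable => // x _; rewrite restrict_EFin.
move=> x _; rewrite !patchE; case: ifPn => [|_].
  by rewrite inE => /sub xB; rewrite mem_set.
by case: ifPn => // /set_mem; exact: f0.
Qed.

Lemma smooth_affine k (p : R * R) f : smooth f ->
  smooth (fun x => f (k * (x.1 - p.1), k * (x.2 - p.2))).
Proof.
move=> sf; have s1 := smoothZ k openT (smoothB openT (@smooth_fst R setT) (@smooth_cst R setT p.1)).
have s2 := smoothZ k openT (smoothB openT (@smooth_snd R setT) (@smooth_cst R setT p.2)).
exact: (smooth_comp openT openT sf s1 s2 (fun _ _ => I)).
Qed.

Lemma partial_affine k (p : R * R) f i : smooth f ->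
  partial i (fun x => f (k * (x.1 - p.1), k * (x.2 - p.2))) =
  fun x => k * partial i f (k * (x.1 - p.1), k * (x.2 - p.2)).
Proof.
move=> sf; apply/funext => x.
have D1 : is_derive x (basis_vec R i) (fun x : R * R => k * (x.1 - p.1)) (k * (i == ord0)%:R).
  have H := is_deriveM (is_derive_cst k x (basis_vec R i)) (is_deriveB (is_derive_fst x _) (is_derive_cst p.1 x (basis_vec R i))).
  apply: is_derive_eq H _; rewrite /GRing.scale /= subr0 mulr0 addr0 /basis_vec.
  by case: (i == ord0).
have D2 : is_derive x (basis_vec R i) (fun x : R * R => k * (x.2 - p.2)) (k * (i == ord_max)%:R).
  have H := is_deriveM (is_derive_cst k x (basis_vec R i)) (is_deriveB (is_derive_snd x _) (is_derive_cst p.2 x (basis_vec R i))).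
  apply: is_derive_eq H _; rewrite /GRing.scale /= subr0 mulr0 addr0 /basis_vec.
  by case: (I2P i) => ->.
have D := smooth_is_derive_comp2 sf D1 D2.
rewrite [LHS](@derive_val _ _ _ _ _ _ _ D).
by case: (I2P i) => -> /=; rewrite mulr1 mulr0 mul0r ?addr0 ?add0r.
Qed.

Lemma iter_partial_affine k (p : R * R) f s : smooth f ->
  iter_partial s (fun x => f (k * (x.1 - p.1), k * (x.2 - p.2))) =
  fun x => k ^+ size s * iter_partial s f (k * (x.1 - p.1), k * (x.2 - p.2)).
Proof.
move=> sf; elim: s => [|i s IH] /=; first by apply/funext => x; rewrite mul1r.
have sI := smooth_iter s sf.
rewrite IH (partialZ _ i (smooth_affine k p sI)) (partial_affine k p i sI).
by apply/funext => x; rewrite exprSr mulrA.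
Qed.

Variable x0 : R * R.

(** A bump equal to 1 within distance e of [x0] and to 0 beyond 2e; 1 and 4 are squared radii. It is
    not normalised: its mass is carried through the estimates instead. *)
Definition molli (e : R) (x : R * R) : R :=
  cutoff 1 4 (0, 0) (e^-1 * (x.1 - x0.1), e^-1 * (x.2 - x0.2)).

Let lt14 : (1 : R) < 4. Proof. lra. Qed.

Lemma smooth_molli e : smooth (molli e).
Proof. exact: (smooth_affine e^-1 x0 (smooth_cutoff (0, 0) lt14)). Qed.

Lemma molli_ge0 e x : 0 <= molli e x.
Proof. exact: cutoff_ge0. Qed.

Lemma sqdist_scale e x : 0 < e ->
  sqdist (0, 0) (e^-1 * (x.1 - x0.1), e^-1 * (x.2 - x0.2)) = sqdist x0 x / e ^+ 2.
Proof. by move=> e0; rewrite /sqdist /= !subr0 !exprMn -mulrDr exprVn mulrC. Qed.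

Lemma molli0 e x : 0 < e -> (2 * e) ^+ 2 <= sqdist x0 x -> molli e x = 0.
Proof.
move=> e0 H; apply: cutoff0; rewrite sqdist_scale// ler_pdivlMr ?exprn_gt0//.
by rewrite (_ : 4 = 2 ^+ 2) -?exprMn//; ring.
Qed.

Lemma molli1 e x : 0 < e -> sqdist x0 x <= e ^+ 2 -> molli e x = 1.
Proof.
move=> e0 H; apply: cutoff1 => //; rewrite sqdist_scale// ler_pdivrMr ?exprn_gt0//.
by rewrite mul1r.
Qed.

Lemma molli_support e x : 0 < e -> molli e x != 0 -> sqdist x0 x <= (2 * e) ^+ 2.
Proof.
by move=> e0 H; rewrite leNgt; apply/negP => /ltW /(molli0 e0) E; rewrite E eqxx in H.
Qed.

Lemma test_molli e V s : 0 < e -> (forall x, sqdist x0 x <= (2 * e) ^+ 2 -> V x) ->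
  test_on V (iter_partial s (molli e)).
Proof.
move=> e0 HV; have e20 : 0 <= 2 * e by lra.
have cK := @compact_disc R _ x0 e20.
have clK : closed [set x | sqdist x0 x <= (2 * e) ^+ 2] by apply: compact_closed cK; exact: norm_hausdorff.
apply: (test_onI cK (smooth_iter s (smooth_molli e))) => // x nx.
have -> : 0 = iter_partial s (fun _ : R * R => 0) x by rewrite iter_partial_cst0.
apply: (iter_partial_eq_on s (closed_openC clK) _ nx) => y /negP; rewrite -ltNge => /ltW.
exact: molli0.
Qed.

Lemma molli_box e : 0 < e -> exists2 r, 0 < r & vanishes_off_box r (molli e).
Proof. by move=> e0; apply: (@vanishes_off_box_test _ setT); exact: (@test_molli e setT [::]). Qed.

Lemma molli_derivative_bound s : exists2 C : R, 0 <= C &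
  forall e, 0 < e -> forall x, `|iter_partial s (molli e) x| <= C / e ^+ size s.
Proof.
have sc := smooth_cutoff (0, 0) lt14.
have off x : ~ [set x : R * R | sqdist (0, 0) x <= 2 ^+ 2] x -> cutoff 1 4 (0, 0) x = 0.
  by move=> /negP; rewrite -ltNge => /ltW H; apply: cutoff0; apply: le_trans H; lra.
have tc := test_onI (@compact_disc R 2 (0, 0) (ler0n R 2)) sc off (@subsetT _ _).
have [r r0 v] := vanishes_off_box_test tc.
have [C C0 HC] := compact_continuous_bound (@compact_box R r)
  (fun y _ => smooth_continuousT (smooth_iter s sc) (x := y)).
exists C => // e e0 x; rewrite /molli (iter_partial_affine e^-1 x0 s sc) normrM mulrC exprVn.
rewrite (ger0_norm (x := (e ^+ _)^-1)); last by rewrite invr_ge0 exprn_ge0// ltW.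
apply: ler_wpM2r; first by rewrite invr_ge0 exprn_ge0// ltW.
set z := (e^-1 * _, _); have [Bz|nBz] := pselect (plane_box r z).
  exact: (HC z ((plane_boxE r z).1 Bz)).
by rewrite (vanishes_off_box_iter s v nBz) normr0.
Qed.

Definition molli_mass e : R := \int[mu2]_(x in setT) molli e x.

Let measurable_continuous f : continuous f -> measurable_fun (setT : set (Y * Y)) f.
Proof. exact: continuous_measurable_plane. Qed.

Lemma Rintegral_center r f : continuous f -> (forall x, ~ plane_box r x -> f (x + x0) = 0) ->
  \int[mu2]_(x in setT) f x = \int[mu2]_(x in plane_box r) f (x + x0).
Proof.
move=> cf v; have cf' := @continuous_translate _ x0 cf.
rewrite (@Rintegral_translate R x0 _ (measurable_continuous cf)).
  exact: Rintegral_box.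
exact: (integrable_setT_box (r := r) v (integrable_box_continuous _ cf')).
Qed.

(** The box of half-side e / 2 has area e^2 and lies in the disc of radius e, where the bump is
    1. *)
Lemma molli_mass_ge e : 0 < e -> e ^+ 2 <= molli_mass e.
Proof.
move=> e0; have cm := smooth_continuousT (smooth_molli e).
have v x : ~ plane_box (2 * e) x -> molli e (x + x0) = 0.
  move=> nB; apply/eqP; apply: contrapT => /negP H; apply: nB.
  have e20 : 0 <= 2 * e by lra.
  have [] := sqdist_box e20 (molli_support e0 H); rewrite /= !addrK => H1 H2.
  exact/plane_boxE.
rewrite /molli_mass (Rintegral_center cm v).
have cm' := @continuous_translate _ x0 cm.
have mB r := @measurable_plane_box R r.
apply: (@le_trans _ _ (\int[mu2]_(x in plane_box (e / 2)) molli e (x + x0))).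
  apply: (@le_trans _ _ (\int[mu2]_(x in plane_box (e / 2)) (1 : R))).
    rewrite Rintegral_cst//.
    have e40 : 0 <= e / 2 by lra.
    have := congr1 fine (plane_box_measure e40) => /= H; rewrite [X in 1 * X]H.
    by rewrite le_eqVlt; apply/orP; left; apply/eqP; field.
  apply: (le_Rintegral (mB _) (integrable_box_cst _ 1) (integrable_box_continuous _ cm')).
  move=> x /plane_boxE[H1 H2]; rewrite molli1// /sqdist /= !addrK.
  rewrite -(real_normK (num_real x.1)) -(real_normK (num_real x.2)).
  have := ler_pM (normr_ge0 _) (normr_ge0 _) H1 H1; have := ler_pM (normr_ge0 _) (normr_ge0 _) H2 H2.
  by rewrite -!expr2 => q1 q2; have := sqr_ge0 e; lra.
by apply: le_box_integral => // [|x _]; [lra|exact: molli_ge0].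
Qed.

Lemma molli_mass_gt0 e : 0 < e -> 0 < molli_mass e.
Proof. by move=> e0; apply: lt_le_trans (molli_mass_ge e0); rewrite exprn_gt0. Qed.

(** The bump acts as its mass times a Dirac mass at [x0], and the convolution evaluates [G] at x0 -
    y. Derivatives fall on [G], and on the support of the bump the Lipschitz estimate costs 2e per
    coordinate, whence the factor 4. *)
Lemma molli_approx G (K : set (R * R)) N : smooth G -> compact K -> exists2 C : R, 0 <= C &
  forall e, 0 < e -> e <= 1 -> forall t, (size t <= N)%N -> forall y, K y ->
  `|iter_partial t (fun y => plane_conv G (molli e) y -
      molli_mass e * G (-1 * (y.1 - x0.1), -1 * (y.2 - x0.2))) y| <= C * e * molli_mass e.
Proof.
move=> sG cK.
pose P t C := forall e, 0 < e -> e <= 1 -> forall y, K y ->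
  `|iter_partial t (fun y => plane_conv G (molli e) y -
      molli_mass e * G (-1 * (y.1 - x0.1), -1 * (y.2 - x0.2))) y| <= C * e * molli_mass e.
have [t C C' PC CC' e e0 e1 y Ky|t|C C0 HC] := @words_bound P _ _ N; last first.
- by exists C => // e e0 e1 t tN y Ky; exact: HC.
- have [r r0 Kr] := compact_subbox cK.
  (* The box of half-side [r'] contains x - y for y in [K] and x within 2e <= 2 of [x0]. *)
  pose r' := r + `|x0.1| + `|x0.2| + 2.
  have sGt := smooth_iter t sG.
  have [C C0 HC] := lipschitz_box r' sGt.
  exists (C * 4); first by rewrite mulr_ge0.
  move=> e e0 e1 y Ky; have [q q0 v] := molli_box e0.
  have sm := smooth_molli e.
  have sA := smooth_affine (-1) x0 sG.
  rewrite (iter_partialB t (smooth_plane_conv_regular sm v sG) (smoothZ (molli_mass e) openT sA)).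
  rewrite (iter_plane_conv_regular sm v t sG).
  have -> : iter_partial t (fun y => molli_mass e * G (-1 * (y.1 - x0.1), -1 * (y.2 - x0.2))) y =
      molli_mass e * ((-1) ^+ size t * iter_partial t G (-1 * (y.1 - x0.1), -1 * (y.2 - x0.2))).
    by rewrite (iter_partialZ _ t sA) (iter_partial_affine (-1) x0 t sG).
  set Gt := iter_partial t G in sGt HC *; set z := (_, _).
  have cGt := smooth_continuousT sGt; have cm := smooth_continuousT sm.
  have cGy := @continuous_translate _ (- y) cGt.
  have cf : continuous (fun x => Gt (x - y) * molli e x).
    by move=> x; apply: cvgM; [exact: cGy|exact: cm].
  have vf : vanishes_off_box q (fun x => Gt (x - y) * molli e x).
    by move=> x /v ->; rewrite mulr0.
  have vz : vanishes_off_box q (fun x => Gt z * molli e x) by move=> x /v ->; rewrite mulr0.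
  have cz : continuous (fun x => Gt z * molli e x).
    by move=> x; apply: cvgM; [exact: cvg_cst|exact: cm].
  have mB := @measurable_plane_box R q.
  have im := integrable_box_continuous (q) cm.
  have -> : (-1) ^+ size t * plane_conv Gt (molli e) y - molli_mass e * ((-1) ^+ size t * Gt z) =
     (-1) ^+ size t * \int[mu2]_(x in plane_box q) (Gt (x - y) * molli e x - Gt z * molli e x).
    rewrite (RintegralB mB (integrable_box_continuous _ cf) (integrable_box_continuous _ cz)).
    rewrite -(Rintegral_box vf) (RintegralZl _ mB im) -(Rintegral_box v) -/(molli_mass e) /plane_conv.
    by ring.
  rewrite normrM normrX normrN normr1 expr1n mul1r.
  have cd : continuous (fun x => Gt (x - y) * molli e x - Gt z * molli e x).
    by move=> x; apply: cvgB; [exact: cf|exact: cz].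
  have icd := integrable_box_continuous (q) cd.
  apply: le_trans (le_normr_Rintegral mB icd) _.
  have icm := integrableZl mB (C * 4 * e) im.
  have -> : C * 4 * e * molli_mass e = \int[mu2]_(x in plane_box q) (C * 4 * e * molli e x).
    by rewrite (RintegralZl _ mB im) -(Rintegral_box v).
  apply: (le_Rintegral mB (integrable_norm icd) icm) => x _.
  rewrite /= -mulrBl normrM (ger0_norm (molli_ge0 e x)).
  have [->|mx] := eqVneq (molli e x) 0; first by rewrite !mulr0.
  apply: ler_wpM2r; first exact: molli_ge0.
  have e20 : 0 <= 2 * e by lra.
  have [H1 H2] := sqdist_box e20 (molli_support e0 mx).
  have [k1 k2] := Kr y Ky.
  have n1 := ler_normD (x.1 - x0.1) (x0.1 - y.1); have n2 := ler_normD (x.2 - x0.2) (x0.2 - y.2).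
  have n3 := ler_normB x0.1 y.1; have n4 := ler_normB x0.2 y.2.
  have p1 := normr_ge0 x0.1; have p2 := normr_ge0 x0.2.
  have Ez : z = (x0.1 - y.1, x0.2 - y.2) by rewrite /z !mulN1r !opprB.
  have Bx : plane_box r' (x - y).
    apply/plane_boxE; rewrite /= /r'.
    have -> : x.1 - y.1 = (x.1 - x0.1) + (x0.1 - y.1) by ring.
    have -> : x.2 - y.2 = (x.2 - x0.2) + (x0.2 - y.2) by ring.
    by split; lra.
  have Bz : plane_box r' z by rewrite Ez; apply/plane_boxE; rewrite /= /r'; split; lra.
  apply: le_trans (HC _ _ Bx Bz) _; rewrite -mulrA ler_wpM2l// Ez /=.
  have -> : x.1 - y.1 - (x0.1 - y.1) = x.1 - x0.1 by ring.
  have -> : x.2 - y.2 - (x0.2 - y.2) = x.2 - x0.2 by ring.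
  by lra.
- apply: le_trans (PC e e0 e1 y Ky) _.
  by rewrite ler_wpM2r ?ler_wpM2r// ltW// molli_mass_gt0.
Qed.

End mollifier.

(** * From vanishing of infinite order to vanishing moments *)

Section moments.
Context {R : realType}.
Local Notation Y := (measurableTypeR R).
Local Notation mu := (@lebesgue_measure R).
Local Notation mu2 := (mu \x mu)%E.
Implicit Types (f g phi : R * R -> R) (x y : R * R) (V U : set (R * R)).

(** Induction on the order: the first partial derivatives also vanish to infinite order, and the
    mean value theorem gains one factor [t]. *)
Lemma taylor_bound V g x0 N : open V -> V x0 -> smooth_on V g ->
  (forall s, iter_partial s g x0 = 0) ->
  exists C r : R, [/\ 0 <= C, 0 < r,
    forall x, `|x.1 - x0.1| <= r -> `|x.2 - x0.2| <= r -> V x &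
    forall t x, 0 <= t -> t <= r -> `|x.1 - x0.1| <= t -> `|x.2 - x0.2| <= t -> `|g x| <= C * t ^+ N].
Proof.
move=> oV Vx0 sg; elim: N g sg => [|N IH] g sg g0.
  have cg := smooth_continuous sg Vx0.
  have : \forall y \near x0, V y /\ `|g x0 - g y| <= 1.
    move/cvgrPdist_le : cg => /(_ _ ltr01) cg.
    by apply: filterS2 (open_near oV Vx0 (fun y Vy => Vy)) cg => y H1 H2; split; [exact: H1|exact: H2].
  case/nbhs_ballP => r r0 Hr; rewrite /= in r0.
  have Hb x : `|x.1 - x0.1| <= r / 2 -> `|x.2 - x0.2| <= r / 2 -> ball x0 r x.
    by move=> H1 H2; split; rewrite /ball /= distrC; lra.
  exists 1, (r / 2); split=> //; first by rewrite divr_gt0.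
    by move=> x H1 H2; case: (Hr _ (Hb x H1 H2)).
  move=> t x t0 tr H1 H2; rewrite expr0 mulr1.
  have [_] := Hr _ (Hb x (le_trans H1 tr) (le_trans H2 tr)).
  by have -> : g x0 = 0 := g0 [::]; rewrite sub0r normrN.
have IHi i : exists C r : R, [/\ 0 <= C, 0 < r,
    forall x, `|x.1 - x0.1| <= r -> `|x.2 - x0.2| <= r -> V x &
    forall t x, 0 <= t -> t <= r -> `|x.1 - x0.1| <= t -> `|x.2 - x0.2| <= t ->
      `|partial i g x| <= C * t ^+ N].
  apply: IH (smooth_partial i sg) _ => s; rewrite -iter_partial_rcons; exact: g0.
have [C0 [r0 [C00 r00 V0 H0]]] := IHi ord0.
have [C1 [r1 [C10 r10 V1 H1]]] := IHi ord_max.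
exists (C0 + C1), (Num.min r0 r1); split; [exact: addr_ge0|by rewrite lt_min r00| |].
  by move=> x; rewrite !le_min => /andP[h1 _] /andP[h2 _]; exact: V0.
case: x0 Vx0 g0 {IH IHi} V0 H0 V1 H1 => a b Vx0 g0 /= V0 H0 V1 H1.
move=> t [x1 x2] t0; rewrite le_min => /andP[tr0 tr1] /= h1 h2.
have z0 : `|a - a| <= t by rewrite subrr normr0.
have [s Hs Es] := @MVT1 R g a x1 x2 (fun s Hs => smooth_derivable sg
  (V0 (s, x2) (le_trans (le_trans Hs h1) tr0) (le_trans h2 tr0))).
have [u Hu Eu] := @MVT2 R g a b x2 (fun s Hs => smooth_derivable sg
  (V0 (a, s) (le_trans z0 tr0) (le_trans (le_trans Hs h2) tr0))).
have gab : g (a, b) = 0 := g0 [::].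
have -> : g (x1, x2) = (x1 - a) * partial ord0 g (s, x2) + (x2 - b) * partial ord_max g (a, u).
  by rewrite -Es -Eu gab; ring.
have B0 := H0 t (s, x2) t0 tr0 (le_trans Hs h1) h2.
have B1 := H1 t (a, u) t0 tr1 z0 (le_trans Hu h2).
apply: le_trans (ler_normD _ _) _; rewrite !normrM exprS mulrCA mulrDl mulrDr.
by apply: lerD; exact: ler_pM.
Qed.

Section outer.
Variables (p : R * R) (d : R) (d0 : 0 < d).

(** Vanishes within distance d of [p] and equals 1 beyond 2d. Multiplication by it turns a function
    smooth off [p] into one smooth everywhere, to which a distribution can be applied. *)
Definition outer y : R := 1 - cutoff (d ^+ 2) ((2 * d) ^+ 2) p y.

Let dd : d ^+ 2 < (2 * d) ^+ 2.
Proof. rewrite exprMn ltr_pMl ?exprn_gt0// expr2; lra. Qed.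

Lemma smooth_outer : smooth outer.
Proof. exact: (smoothB openT (@smooth_cst R setT 1) (smooth_cutoff p dd)). Qed.

Lemma outer0 y : sqdist p y <= d ^+ 2 -> outer y = 0.
Proof. by move=> H; rewrite /outer cutoff1// subrr. Qed.

Lemma outer1 y : (2 * d) ^+ 2 <= sqdist p y -> outer y = 1.
Proof. by move=> H; rewrite /outer cutoff0// subr0. Qed.

Lemma smooth_outerM g : smooth_on (punctured p) g -> smooth (fun y => outer y * g y).
Proof.
move=> sg; apply: smooth_local => y; have [yp|yp] := eqVneq y p.
  have oW := @open_sqdist_lt R p (d ^+ 2).
  exists [set z | sqdist p z < d ^+ 2]; split=> //.
    by rewrite yp /= /sqdist !subrr expr0n addr0 exprn_gt0.
  have E z : [set z | sqdist p z < d ^+ 2] z -> (fun=> 0 : R) z = outer z * g z.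
    by move=> /= /ltW /outer0 ->; rewrite mul0r.
  exact: (smooth_eq oW E (@smooth_cst R _ 0)).
exists (punctured p); split; [exact: open_punctured|exact/eqP|].
exact: (smoothM (@open_punctured R p) (smooth_sub (@subsetT _ _) smooth_outer) sg).
Qed.

Lemma punctured_outer (F : functional R) : linear_dist F ->
  punctured_functional p (fun g => F (fun y => outer y * g y)).
Proof.
move=> lF; split=> [a f g sf sg|f g sf fg].
  rewrite -(lF a _ _ (smooth_outerM sf) (smooth_outerM sg)); congr F.
  by apply/funext => y; rewrite mulrDr mulrCA.
congr F; apply/funext => y; have [->|yp] := eqVneq y p.
  by rewrite outer0 ?mul0r// /sqdist !subrr expr0n addr0 exprn_ge0// ltW.
by rewrite fg//; exact/eqP.
Qed.

Lemma dist_outer U (F : functional R) phi : linear_dist F ->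
  (forall psi, test_on U psi -> F psi = 0) ->
  (forall x, sqdist p x <= (2 * d) ^+ 2 -> U x) -> smooth phi ->
  F phi = F (fun y => outer y * phi y).
Proof.
move=> lF FU HU sp; apply/eqP; rewrite -subr_eq0.
have so := smoothM openT smooth_outer sp.
rewrite -(linear_distB lF sp so).
have -> : (fun x => phi x - outer x * phi x) =
    (fun x => cutoff (d ^+ 2) ((2 * d) ^+ 2) p x * phi x).
  by apply/funext => x; rewrite /outer; ring.
apply/eqP/FU; have d20 : 0 <= 2 * d := mulr_ge0 (ler0n R 2) (ltW d0).
have off x : ~ [set x | sqdist p x <= (2 * d) ^+ 2] x ->
    cutoff (d ^+ 2) ((2 * d) ^+ 2) p x * phi x = 0.
  by move=> /negP; rewrite -ltNge => /ltW H; rewrite cutoff0// mul0r.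
exact: (test_onI (@compact_disc R _ p d20) (smoothM openT (smooth_cutoff p dd) sp) off HU).
Qed.

End outer.

Lemma mono_center x0 b c n y : mono x0 b c n y = mono (0, 0) b c n (y.1 - x0.1, y.2 - x0.2).
Proof. by rewrite /mono /cc /xcoord /rinv /sqdist /= !subr0. Qed.

(** The convolution evaluates the kernel at x0 - y, whereas [mono x0] evaluates it at y - x0;
    evenness reconciles the two. *)
Lemma mono_even b c n y : ~~ odd (b + c) -> mono (0, 0) b c n (-1 * y.1, -1 * y.2) = mono (0, 0) b c n y.
Proof.
move=> bc; rewrite /mono /cc /xcoord /rinv /sqdist /= !subr0 !mulN1r !sqrrN.
rewrite (exprNn y.1) (exprNn y.2) mulrACA -exprD -signr_odd (negbTE bc) expr0 mul1r; reflexivity.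
Qed.

Lemma rinv_inv_norm : rinv (0, 0) = @inv_norm R.
Proof. by apply/funext => x; rewrite /rinv /inv_norm /sqdist /= !subr0. Qed.

Lemma mono_le b c n y : (b + c).+1 = n -> `|mono (0, 0) b c n y| <= inv_norm y.
Proof.
move=> <-; rewrite /mono rinv_inv_norm exprS exprD mulrCA.
set r := inv_norm y; have r0 : 0 <= r := inv_norm_ge0 y.
rewrite normrM (ger0_norm r0) -[leRHS]mulr1 ler_wpM2l//.
have le1 i : `|cc (0, 0) i y * r| <= 1.
  have yi : `|cc (0, 0) i y| <= Num.sqrt (y.1 ^+ 2 + y.2 ^+ 2).
    rewrite -sqrtr_sqr ler_sqrt ?addr_ge0 ?sqr_ge0// /cc /xcoord.
    by case: (I2P i) => -> /=; rewrite subr0 ?lerDl ?lerDr sqr_ge0.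
  rewrite normrM (ger0_norm r0) /r /inv_norm; set q := Num.sqrt _ in yi *.
  (* At the origin the inverse of [q] is 0 by convention, and the bound is trivial. *)
  have [q0|q0] := eqVneq q 0; first by rewrite q0 invr0 mulr0 ler01.
  by rewrite ler_pdivrMr ?mul1r// lt_neqAle eq_sym q0 sqrtr_ge0.
have -> : cc (0, 0) ord0 y ^+ b * cc (0, 0) ord_max y ^+ c * (r ^+ b * r ^+ c) =
  (cc (0, 0) ord0 y * r) ^+ b * (cc (0, 0) ord_max y * r) ^+ c by rewrite !exprMn; ring.
by rewrite normrM !normrX mulr_ile1 ?exprn_ge0// exprn_ile1.
Qed.

Lemma measurable_mono b c n : measurable_fun (setT : set (Y * Y)) (mono (0, 0) b c n).
Proof.
apply: measurable_funM; last first.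
  by rewrite rinv_inv_norm; apply: measurable_funX; exact: measurable_inv_norm.
have mi i : measurable_fun (setT : set (Y * Y)) (cc (0, 0) i).
  by apply: continuous_measurable_plane; apply: smooth_continuousT; exact: smooth_cc openT.
by apply: measurable_funM; apply: measurable_funX; exact: mi.
Qed.

Lemma integrable_mono b c n r : (b + c).+1 = n -> 0 < r ->
  mu2.-integrable (plane_box r) (EFin \o mono (0, 0) b c n).
Proof.
move=> bc r0; have mB := @measurable_plane_box R r.
apply: (le_integrable mB _ _ (integrable_inv_norm r0)).
  by apply/measurable_EFinP; apply: measurable_funTS; exact: measurable_mono.
by move=> x _; rewrite /= lee_fin (ger0_norm (inv_norm_ge0 _)) mono_le.
Qed.

(** [g] is controlled on V only, but the product extended by zero is smooth on the whole plane
    because the support of [phi] lies in V. Its integral can then be recentred at [x0] and bounded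
    on a box. *)
Lemma test_integral_bound V g phi x0 r (B : R) : open V -> smooth_on V g -> test_on V phi -> 0 <= r ->
  (forall x, ~ plane_box r x -> phi (x + x0) = 0) ->
  (forall x, plane_box r x -> `|g (x + x0) * phi (x + x0)| <= B) ->
  `|\int[mu2]_(x in V) (g x * phi x)| <= B * (4 * r ^+ 2).
Proof.
move=> oV sg [sp cs sV] r0 v gB.
pose f := (fun x => g x * phi x) \_ V.
have sf : smooth f.
  apply: smooth_local => y; have [Vy|nVy] := pselect (V y).
    exists V; split; [exact: oV|exact: Vy|].
    have E z : V z -> g z * phi z = f z by move=> Vz; rewrite /f patchE mem_set.
    exact: (smooth_eq oV E (smoothM oV sg (smooth_sub (@subsetT _ _) sp))).
  have oS : open (~` supp phi) by apply: closed_openC; exact: closed_closure.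
  exists (~` supp phi); split=> //; first by move=> /sV.
  have E z : (~` supp phi) z -> (fun=> 0 : R) z = f z.
    move=> nz; rewrite /f patchE; case: ifP => // _.
    have -> : phi z = 0; last by rewrite mulr0.
    by apply/eqP; apply: contrapT => /negP pz; apply: nz; exact: subset_closure.
  exact: (smooth_eq oS E (@smooth_cst R _ 0)).
have cf := smooth_continuousT sf.
rewrite Rintegral_mkcond -/f.
have fv x : ~ plane_box r x -> f (x + x0) = 0.
  by move=> /v px; rewrite /f patchE px mulr0; case: ifP.
rewrite (Rintegral_center cf fv).
have cf' := @continuous_translate _ _ x0 cf.
apply: (box_integral_bound r0 cf') => x Bx; rewrite /f patchE; case: ifP => _; first exact: gB.
by rewrite normr0; apply: le_trans (gB x Bx).
Qed.

Lemma small_le0 (X C e0 : R) : 0 < e0 -> 0 <= C ->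
  (forall e, 0 < e -> e <= e0 -> X <= C * e) -> X <= 0.
Proof.
move=> e00 C0 H; rewrite leNgt; apply/negP => X0.
have C1 : 0 < 2 * (C + 1) by lra.
pose e := Num.min e0 (X / (2 * (C + 1))).
have e1 : 0 < e by rewrite lt_min e00 divr_gt0.
have := H e e1 (ltac:(by rewrite ge_min lexx)).
have : e * (2 * (C + 1)) <= X by rewrite -ler_pdivlMr// ge_min lexx orbT.
by move=> h1 h2; have := mulr_ge0 C0 (ltW e1); move: h1 h2; clear -X0 e1; lra.
Qed.

(** If both coordinates of y - x0 were at most d / 2, its squared length would be at most d^2 / 2 <
    (3d / 4)^2. So one coordinate exceeds d / 2, and the same coordinate of x - y is at least d / 4
    = 2 (d / 8). *)
Lemma sqdist_far x0 (d : R) x y : 0 < d -> (3 / 4 * d) ^+ 2 < sqdist x0 y -> `|x.1 - x0.1| <= d / 4 -> `|x.2 - x0.2| <= d / 4 ->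
  (2 * (d / 8)) ^+ 2 <= sqdist (0, 0) (x - y).
Proof.
move=> d0 Wy h1 h2; have [y1|y1] := leP `|y.1 - x0.1| (d / 2).
  have [y2|y2] := leP `|y.2 - x0.2| (d / 2).
    exfalso; move: Wy; rewrite /sqdist -(real_normK (num_real (y.1 - x0.1))) -(real_normK (num_real (y.2 - x0.2))).
    have := ler_pM (normr_ge0 _) (normr_ge0 _) y1 y1; have := ler_pM (normr_ge0 _) (normr_ge0 _) y2 y2.
    have := mulr_gt0 d0 d0; rewrite -!expr2 exprMn => p1 p2 p3 p4.
    by move: p1 p2 p3 p4; rewrite !expr2; clear; lra.
  have q : d / 4 <= `|(x - y).2|.
    have := ler_distD x.2 y.2 x0.2; rewrite (distrC y.2 x.2) /= => p1.
    by move: p1 h2 y2; clear; lra.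
  rewrite /sqdist /= !subr0; apply: le_trans (_ : (x.2 - y.2) ^+ 2 <= _); last by rewrite lerDr sqr_ge0.
  rewrite -(real_normK (num_real (x.2 - y.2))) (_ : 2 * (d / 8) = d / 4); last by field.
  by rewrite ler_sqr ?nnegrE// ltW// divr_gt0.
have q : d / 4 <= `|(x - y).1|.
  have := ler_distD x.1 y.1 x0.1; rewrite (distrC y.1 x.1) /= => p1.
  by move: p1 h1 y1; clear; lra.
rewrite /sqdist /= !subr0; apply: le_trans (_ : (x.1 - y.1) ^+ 2 <= _); last by rewrite lerDl sqr_ge0.
rewrite -(real_normK (num_real (x.1 - y.1))) (_ : 2 * (d / 8) = d / 4); last by field.
by rewrite ler_sqr ?nnegrE// ltW// divr_gt0.
Qed.

Section mollify.
Variables (U : set (R * R)) (x0 : R * R) (d : R) (d0 : 0 < d).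
Hypothesis HU : forall x, sqdist x0 x <= (2 * d) ^+ 2 -> U x.
Variables (F : functional R) (cF : compact_distribution F).
Hypothesis FU : forall psi, test_on U psi -> F psi = 0.
Variables (b c : nat) (bc : ~~ odd (b + c)).
Let n := (b + c).+1.
Local Notation K := (mono (0, 0) b c n).
Local Notation Om := (punctured x0).

Let d80 : 0 < d / 8. Proof. exact: divr_gt0. Qed.

(** The kernel with its singularity removed; it is unchanged at distance at least d / 4 from the
    origin. *)
Let G y : R := outer (0, 0) (d / 8) y * K y.
Let sG : smooth G. Proof. exact: (smooth_outerM d80 (smooth_mono _ _ _)). Qed.
Let lF : linear_dist F. Proof. by case/compact_distributionP: cF. Qed.

(** An open set containing every point where [outer x0 d] is nonzero, so that derivatives can be
    compared there; 3 / 4 leaves room both below d and above the reach d / 4 of the bumps. *)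
Let W : set (R * R) := [set y | (3 / 4 * d) ^+ 2 < sqdist x0 y].
Let oW : open W. Proof. exact: open_sqdist_gt. Qed.

Let far x y : W y -> `|x.1 - x0.1| <= d / 4 -> `|x.2 - x0.2| <= d / 4 ->
  (2 * (d / 8)) ^+ 2 <= sqdist (0, 0) (x - y).
Proof. exact: sqdist_far. Qed.

Let outer_W f g : (forall y, W y -> f y = g y) ->
  (fun y => outer x0 d y * f y) = (fun y => outer x0 d y * g y).
Proof.
move=> fg; apply/funext => y; have [Wy|nW] := pselect (W y); first by rewrite fg.
have -> : outer x0 d y = 0; last by rewrite !mul0r.
apply: outer0 => //; move/negP : nW; rewrite -leNgt => H; apply: le_trans H _.
by rewrite exprMn ler_piMl ?sqr_ge0// exprn_ile1// ler_pdivrMr// mul1r ler_nat.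
Qed.

(** For e <= d / 8 the bump lives within d / 4 of [x0] and [outer x0 d] restricts y to [W]. The
    singularity of the kernel is never met, so [G] may replace it. *)
Lemma conv_outer e s : 0 < e -> e <= d / 8 ->
  F (plane_conv K (iter_partial s (molli x0 e))) =
  F (fun y => outer x0 d y * iter_partial s (plane_conv G (molli x0 e)) y).
Proof.
move=> e0 ed; have [r r0 v] := molli_box x0 e0.
have sm := smooth_molli x0 e.
have mK := measurable_mono b c n.
have iK q : 0 < q -> mu2.-integrable (plane_box q) (EFin \o K) by exact: integrable_mono.
have sP : smooth (plane_conv K (molli x0 e)) := smooth_plane_conv mK iK sm r0 v.
rewrite -(iter_plane_conv mK iK s sm r0 v).
rewrite (dist_outer d0 lF FU HU (smooth_iter s sP)); congr F.
apply: outer_W => y Wy; apply: (iter_partial_eq_on s oW _ Wy) => {Wy}y Wy.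
apply: eq_Rintegral => x _; have [->|mx] := eqVneq (molli x0 e x) 0; first by rewrite !mulr0.
have e20 : 0 <= 2 * e := mulr_ge0 (ler0n R 2) (ltW e0).
have [h1 h2] := sqdist_box e20 (molli_support e0 mx).
have ed4 : 2 * e <= d / 4.
  have -> : d / 4 = 2 * (d / 8) by field.
  by rewrite ler_wpM2l.
by rewrite /G outer1 ?mul1r//; apply: far => //; [exact: le_trans h1 ed4|exact: le_trans h2 ed4].
Qed.

(** With the smooth kernel [G], [molli_approx] applies on the compact set that bounds [F], with N
    derivatives for the order of [F] and [size s] more for the word. *)
Lemma conv_approx s : exists2 C, 0 <= C & forall e, 0 < e -> e <= 1 ->
  `|F (fun y => outer x0 d y * iter_partial s (plane_conv G (molli x0 e)) y) -
    molli_mass x0 e * F (fun y => outer x0 d y * iter_partial s (mono x0 b c n) y)| <=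
  C * e * molli_mass x0 e.
Proof.
have [_ [Q [N [C [cQ C0 HF]]]]] := (compact_distributionP F).1 cF.
have so := smooth_outer x0 d0.
have [C1 C10 H1] := mul_bound N cQ so.
have [C2 C20 H2] := molli_approx x0 (N + size s) sG cQ.
exists (C * (C1 * C2)); first by rewrite !mulr_ge0.
move=> e e0 e1; have [r r0 v] := molli_box x0 e0.
have sm := smooth_molli x0 e.
set I := molli_mass x0 e.
pose Gx y := G (-1 * (y.1 - x0.1), -1 * (y.2 - x0.2)).
have sGx : smooth Gx := smooth_affine (-1) x0 sG.
have sP : smooth (plane_conv G (molli x0 e)) := smooth_plane_conv_regular sm v sG.
have sPs := smoothM openT so (smooth_iter s sP).
have sGs := smoothM openT so (smooth_iter s sGx).
have -> : (fun y => outer x0 d y * iter_partial s (mono x0 b c n) y) =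
    (fun y => outer x0 d y * iter_partial s Gx y).
  apply: outer_W => y Wy; apply: (iter_partial_eq_on s oW _ Wy) => {Wy}y Wy.
  have Hf := far (x := x0) Wy (ltac:(by rewrite subrr normr0 divr_ge0// ltW)) (ltac:(by rewrite subrr normr0 divr_ge0// ltW)).
  rewrite mono_center -mono_even// /Gx /G outer1 ?mul1r//.
  by move: Hf; rewrite /sqdist /= !subr0 !mulN1r !opprB.
rewrite -(linear_distZ I lF sGs) -(linear_distB lF sPs (smoothZ I openT sGs)).
pose D y := plane_conv G (molli x0 e) y - I * Gx y.
have sD : smooth D := smoothB openT sP (smoothZ I openT sGx).
have -> : (fun y => outer x0 d y * iter_partial s (plane_conv G (molli x0 e)) y -
     I * (outer x0 d y * iter_partial s Gx y)) = (fun y => outer x0 d y * iter_partial s D y).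
  apply/funext => y; rewrite /D (iter_partialB s sP (smoothZ I openT sGx)) mulrBr; congr (_ - _).
  by rewrite (iter_partialZ I s sGx) mulrCA.
have I0 : 0 <= I by apply: ltW; exact: molli_mass_gt0.
have e00 := ltW e0.
rewrite -!mulrA; apply: HF; first exact: (smoothM openT so (smooth_iter s sD)).
  by rewrite !mulr_ge0.
move=> t tN y Qy; apply: (H1 _ (smooth_iter s sD) _ _ t y tN Qy); first by rewrite !mulr_ge0.
move=> u ut; rewrite -iter_partial_cat mulrA; apply: H2 => //.
by rewrite size_cat leq_add2r (leq_trans ut).
Qed.

End mollify.

(** Let X be the sum in question. Testing on the s-th derivative of the bump makes the kernel side X
    times the mass, up to O(e) times the mass. On the other side Taylor's bound gives e^(size s +
    1), the differentiated bump costs e^(-size s), and the area O(e^2) is at most a constant times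
    the mass. Hence |X| = O(e). *)
Lemma vanishing_moments U x0 (d : R) m (F : nat -> functional R) (a : nat) V g :
  0 < d -> (forall x, sqdist x0 x <= (2 * d) ^+ 2 -> U x) ->
  (forall j, compact_distribution (F j)) ->
  (forall j phi, test_on U phi -> F j phi = 0) ->
  (a <= m)%N -> open V -> V x0 -> smooth_on V g ->
  (forall p q, multi_partial p q g x0 = 0) ->
  (forall phi, test_on V phi ->
    \sum_(0 <= j < m.+1) F j (plane_conv (mono (0, 0) (a + j) (m - a + (m - j)) m.*2.+1) phi) =
    \int[mu2]_(x in V) (g x * phi x)) ->
  forall s, \sum_(0 <= j < m.+1)
    F j (fun y => outer x0 d y * iter_partial s (mono x0 (a + j) (m - a + (m - j)) m.*2.+1) y) = 0.
Proof.
move=> d0 HU cF FU am oV Vx0 sg g0 HF s.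
have bc j : (j < m.+1)%N -> (a + j + (m - a + (m - j)) = m.*2)%N.
  by rewrite ltnS => jm; rewrite addnACA !subnKC// addnn.
have g0' t : iter_partial t g x0 = 0 by rewrite (iter_partial_multi t oV sg Vx0).
(* One order more than the length of [s], so that a factor e survives the division by e^(size s). *)
have [Cg [r [Cg0 r0 HV Hg]]] := taylor_bound (size s).+1 oV Vx0 sg g0'.
have [Cs Cs0 Hs] := molli_derivative_bound x0 s.
pose X := \sum_(0 <= j < m.+1)
    F j (fun y => outer x0 d y * iter_partial s (mono x0 (a + j) (m - a + (m - j)) m.*2.+1) y).
have [C C0 HC] : exists2 C : R, 0 <= C & forall e, 0 < e -> e <= 1 -> e <= d / 8 ->
   `|\sum_(0 <= j < m.+1) F j (plane_conv (mono (0, 0) (a + j) (m - a + (m - j)) m.*2.+1) (iter_partial s (molli x0 e)))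
     - molli_mass x0 e * X| <= C * e * molli_mass x0 e.
  rewrite /X; have : (m.+1 <= m.+1)%N by [].
  (* The induction is on the number of summands only; the exponents of the kernels keep the fixed
     m. *)
  elim: {1 3 4}m.+1 => [|k IH] km.
    by exists 0 => // e e0 _ _; rewrite !big_geq// mulr0 subrr normr0 !mul0r.
  have [C C0 HC] := IH (ltnW km).
  have Ek := bc k km.
  have ek : ~~ odd (a + k + (m - a + (m - k))) by rewrite Ek odd_double.
  have [C1 C10 HC1] := conv_approx x0 d0 (cF k) ek s.
  exists (C + C1) => [|e e0 e1 ed]; first exact: addr_ge0.
  rewrite !big_nat_recr//= mulrDr opprD addrACA !mulrDl.
  apply: le_trans (ler_normD _ _) _; apply: lerD; first exact: HC.
  by rewrite -Ek (conv_outer d0 HU (cF k) (FU k) _ _ s e0 ed); exact: HC1.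
apply/eqP; rewrite -normr_le0.
(* The powers of 2 come from Taylor's bound on the box of half-side 2e, whose area is 4 (2e)^2 = 16
   e^2. *)
pose D := Cg * 2 ^+ (size s).+1 * Cs * 16.
have D0 : 0 <= D by rewrite !mulr_ge0// exprn_ge0.
pose e0 := Num.min (Num.min 1 (d / 8)) (r / 2).
have e00 : 0 < e0 by rewrite !lt_min ltr01 !divr_gt0.
apply: (small_le0 e00 (addr_ge0 C0 D0)) => e ep.
rewrite !le_min => /andP[/andP[e1 ed] er].
have I0 := molli_mass_gt0 x0 ep; have Ige := molli_mass_ge x0 ep.
have e20 : 0 <= 2 * e by lra.
have e2r : 2 * e <= r by lra.
have tm : test_on V (iter_partial s (molli x0 e)).
  apply: test_molli => // x /(sqdist_box e20)[h1 h2]; apply: HV; lra.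
have RHS : `|\int[mu2]_(x in V) (g x * iter_partial s (molli x0 e) x)| <= D * e * molli_mass x0 e.
  apply: le_trans (_ : D * e * e ^+ 2 <= _); last by rewrite ler_wpM2l// mulr_ge0// ltW.
  have -> : D * e * e ^+ 2 = Cg * (2 * e) ^+ (size s).+1 * (Cs / e ^+ size s) * (4 * (2 * e) ^+ 2).
    have es : e ^+ size s != 0 by rewrite expf_neq0// gt_eqF.
    by rewrite /D !exprMn !exprS; field.
  apply: (test_integral_bound (x0 := x0) oV sg tm e20).
    move=> x nB; have [_ off _] := tm.
    have nd : ~ [set y | sqdist x0 y <= (2 * e) ^+ 2] (x + x0).
      move=> /(sqdist_box e20); rewrite /= !addrK => -[h1 h2]; apply: nB; exact/plane_boxE.
    have clK : closed [set y | sqdist x0 y <= (2 * e) ^+ 2].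
      by apply: compact_closed (@compact_disc R _ x0 e20); exact: norm_hausdorff.
    have -> : 0 = iter_partial s (fun _ : R * R => 0) (x + x0) by rewrite iter_partial_cst0.
    apply: (iter_partial_eq_on s (closed_openC clK) _ nd) => y /negP; rewrite -ltNge => /ltW.
    exact: molli0.
  move=> x /plane_boxE[h1 h2]; rewrite normrM; apply: ler_pM => //.
    by apply: Hg => //; rewrite /= addrK.
  exact: Hs.
have := HC e ep e1 ed; rewrite (HF _ tm) => H.
have : molli_mass x0 e * `|X| <= (C + D) * e * molli_mass x0 e.
  rewrite -{1}(gtr0_norm I0) -normrM !mulrDl.
  set A := \int[mu2]_(x in V) _ in H RHS.
  have -> : molli_mass x0 e * X = A - (A - molli_mass x0 e * X) by rewrite opprB addrC subrK.
  by apply: le_trans (ler_normB _ _) _; rewrite addrC; exact: lerD.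
by rewrite mulrC ler_pM2r.
Qed.

End moments.

(** * Polynomial approximation and inversion *)

Section landau.
Context {R : realType}.
Local Notation Y := (measurableTypeR R).
Local Notation mu := (@lebesgue_measure R).
Local Notation mu2 := (mu \x mu)%E.
Implicit Types (f g q : R * R -> R) (x y z : R * R) (P : R * R -> R).

Definition plane_poly P := exists s : seq (R * nat * nat),
  forall z, P z = \sum_(p <- s) p.1.1 * (z.1 ^+ p.1.2 * z.2 ^+ p.2).

Lemma plane_poly_cst (c : R) : plane_poly (fun=> c).
Proof. by exists [:: (c, 0%N, 0%N)] => z; rewrite big_seq1 /= !expr0 !mulr1. Qed.

Lemma plane_polyZD (a : R) P Q : plane_poly P -> plane_poly Q -> plane_poly (fun z => a * P z + Q z).
Proof.
move=> [s Hs] [t Ht]; exists ([seq (a * p.1.1, p.1.2, p.2) | p <- s] ++ t) => z.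
rewrite big_cat big_map Hs Ht mulr_sumr; congr (_ + _).
by apply: eq_bigr => p _; rewrite /= mulrA.
Qed.

Lemma plane_polyM i P : plane_poly P -> plane_poly (fun z => xcoord i z * P z).
Proof.
move=> [s Hs]; exists [seq (p.1.1, (i == ord0) + p.1.2, (i == ord_max) + p.2)%N | p <- s] => z.
rewrite big_map Hs mulr_sumr; apply: eq_bigr => p _ /=.
rewrite /xcoord; case: (I2P i) => -> /=.
  by rewrite add1n add0n exprS mulrCA !mulrA.
by rewrite add1n add0n exprS mulrCA (mulrCA z.2).
Qed.

Lemma smooth_plane_poly P : plane_poly P -> smooth P.
Proof.
case=> s Hs; have -> : P = fun z => \sum_(p <- s) p.1.1 * (z.1 ^+ p.1.2 * z.2 ^+ p.2) by apply/funext.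
apply: (smooth_sum _ _ openT) => p; apply: (smoothZ _ openT).
exact: (smoothM openT (smoothX _ openT (@smooth_fst R setT)) (smoothX _ openT (@smooth_snd R setT))).
Qed.

(** Polynomial dependence on [y] after integration in [x]. It is stable under linear combinations
    and multiplication by x_i - y_i, which avoids expanding the powers in the Landau kernel. *)
Definition poly_kernel r (L : R * R -> R * R -> R) :=
  (forall y, continuous (L^~ y)) /\
  forall q, continuous q -> vanishes_off_box r q ->
  plane_poly (fun y => \int[mu2]_(x in setT) (L x y * q x)).

Lemma integrable_kernel r (L q : R * R -> R) : continuous L -> continuous q -> vanishes_off_box r q ->
  mu2.-integrable setT (EFin \o (fun x => L x * q x)).
Proof.
move=> cL cq v; apply: (integrable_setT_box (r := r)).
  by move=> x /v ->; rewrite mulr0.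
by apply: integrable_box_continuous => x; apply: cvgM; [exact: cL|exact: cq].
Qed.

Lemma poly_kernel_cst r (c : R) : poly_kernel r (fun _ _ => c).
Proof.
split=> [y x|q cq v]; first exact: cvg_cst.
exact: plane_poly_cst.
Qed.

Lemma poly_kernelZD r (a : R) L M : poly_kernel r L -> poly_kernel r M ->
  poly_kernel r (fun x y => a * L x y + M x y).
Proof.
move=> [cL HL] [cM HM]; split=> [y x|q cq v].
  by apply: cvgD; [apply: cvgM; [exact: cvg_cst|exact: cL]|exact: cM].
have := plane_polyZD a (HL q cq v) (HM q cq v).
congr plane_poly; apply/funext => y.
have iL := integrable_kernel (cL y) cq v; have iM := integrable_kernel (cM y) cq v.
rewrite -(RintegralZl _ measurableT iL) -(RintegralD measurableT (integrableZl measurableT a iL) iM).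
by apply: eq_Rintegral => x _; rewrite /= mulrDl mulrA.
Qed.

Lemma poly_kernelM r i L : poly_kernel r L -> poly_kernel r (fun x y => xcoord i (x - y) * L x y).
Proof.
move=> [cL HL]; have cc : continuous (xcoord i : R * R -> R) := smooth_continuousT (smooth_coord (R := R) i).
have cL' y : continuous (fun x => xcoord i x * L x y).
  by move=> x; apply: cvgM; [exact: cc|exact: cL].
split=> [y x|q cq v].
  apply: cvgM; last exact: cL.
  exact: (@continuous_translate _ _ (- y) cc).
pose q' x := xcoord i x * q x.
have cq' : continuous q' by move=> x; apply: cvgM; [exact: cc|exact: cq].
have v' : vanishes_off_box r q' by move=> x /v qx; rewrite /q' qx mulr0.
have := plane_polyZD (-1) (plane_polyM i (HL q cq v)) (HL q' cq' v').
congr plane_poly; apply/funext => y.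
have iL := integrable_kernel (cL y) cq v; have iL' := integrable_kernel (cL y) cq' v'.
rewrite mulrA -(RintegralZl _ measurableT iL) -(RintegralD measurableT (integrableZl measurableT _ iL) iL').
apply: eq_Rintegral => x _ /=; rewrite /q' /xcoord; case: (I2P i) => -> /=; ring.
Qed.

(** The two-dimensional Landau kernel, not normalised: a polynomial, nonnegative on the box of
    half-side A, that concentrates at the origin there as n grows. *)
Definition landau (A : R) n z : R := ((1 - z.1 ^+ 2 / A ^+ 2) * (1 - z.2 ^+ 2 / A ^+ 2)) ^+ n.

Lemma smooth_landau A n : smooth (landau A n).
Proof.
have s2 i : smooth (fun z : R * R => 1 - (if i then z.1 else z.2) ^+ 2 / A ^+ 2).
  apply: (smoothB openT (@smooth_cst R setT 1) (smoothM openT (smoothX 2 openT _) (@smooth_cst R setT _))).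
  by case: i; [exact: smooth_fst|exact: smooth_snd].
exact: (smoothX n openT (smoothM openT (s2 true) (s2 false))).
Qed.

Lemma poly_kernel_landau r A n : poly_kernel r (fun x y => landau A n (x - y)).
Proof.
elim: n => [|n IH].
  have -> : (fun x y => landau A 0 (x - y)) = (fun _ _ : R * R => 1 : R).
    by apply/funext => x; apply/funext => y; rewrite /landau expr0.
  exact: poly_kernel_cst.
have K i L : poly_kernel r L ->
    poly_kernel r (fun x y => - (A ^- 2) * (xcoord i (x - y) * (xcoord i (x - y) * L x y)) + L x y).
  by move=> H; apply: poly_kernelZD => //; do 2! apply: poly_kernelM.
have := K ord0 _ (K ord_max _ IH); congr poly_kernel; apply/funext => x; apply/funext => y.
rewrite /xcoord /landau [_ ^+ n.+1]exprS /=; set k := A ^- 2; ring.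
Qed.

Definition landau_mass A n : R := \int[mu2]_(z in plane_box A) landau A n z.

Lemma landau_ge0 (A : R) n z : 0 < A -> plane_box A z -> 0 <= landau A n z.
Proof.
move=> A0 /plane_boxE[h1 h2]; have H (t : R) : `|t| <= A -> 0 <= 1 - t ^+ 2 / A ^+ 2.
  move=> tA; rewrite subr_ge0 ler_pdivrMr ?exprn_gt0// mul1r -(real_normK (num_real t)).
  by rewrite ler_sqr ?nnegrE// ltW.
by rewrite exprn_ge0// mulr_ge0// H.
Qed.

Lemma landau_le (A d : R) n z : 0 < A -> 0 <= d -> plane_box A z -> ~ plane_box d z ->
  landau A n z <= (1 - (d / A) ^+ 2) ^+ n.
Proof.
move=> A0 d0 /plane_boxE[h1 h2] nd; have H (t : R) : `|t| <= A -> 0 <= 1 - t ^+ 2 / A ^+ 2 <= 1.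
  move=> tA; rewrite subr_ge0 ler_pdivrMr ?exprn_gt0// mul1r -(real_normK (num_real t)).
  rewrite ler_sqr ?nnegrE// ?(ltW A0)// tA /= gerBl divr_ge0// ?exprn_ge0// ltW//.
have G (t : R) : d < `|t| -> 1 - t ^+ 2 / A ^+ 2 <= 1 - (d / A) ^+ 2.
  move=> dt; rewrite lerD2l lerN2 expr_div_n ler_pM2r ?invr_gt0 ?exprn_gt0//.
  by rewrite -(real_normK (num_real t)) ler_sqr ?nnegrE// ltW.
have /andP[p1 q1] := H _ h1; have /andP[p2 q2] := H _ h2.
rewrite /landau; apply: lerXn2r; rewrite ?nnegrE ?mulr_ge0//.
- have [z1|z1] := leP `|z.1| d; last by apply: le_trans p1 (G _ z1).
  have [z2|z2] := leP `|z.2| d; last by apply: le_trans p2 (G _ z2).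
  by exfalso; apply: nd; exact/plane_boxE.
- have [z1|z1] := leP `|z.1| d; last by apply: le_trans (ler_piMr p1 q2) (G _ z1).
  have [z2|z2] := leP `|z.2| d; last by apply: le_trans (ler_piMl p2 q1) (G _ z2).
  by exfalso; apply: nd; exact/plane_boxE.
Qed.

Lemma ratio_sqr_le1 (A d : R) : 0 < d -> d <= A -> (d / A) ^+ 2 <= 1.
Proof.
move=> d0 dA; have A0 := lt_le_trans d0 dA.
by rewrite exprn_ile1 ?divr_ge0 ?(ltW d0) ?(ltW A0)// ler_pdivrMr// mul1r.
Qed.

(** Put a = (d / A)^2. The kernel is at least ((1 - a / 4)^2)^n on the box of half-side d / 2, of
    area d^2, whereas [landau_le] bounds it by (1 - a)^n off the box of half-side d. As (1 - a /
    4)^2 > 1 - a, the mass wins over the tail geometrically. *)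
Lemma landau_mass_ge (A d : R) n : 0 < d -> d <= A ->
  ((1 - (d / A) ^+ 2 / 4) ^+ 2) ^+ n * d ^+ 2 <= landau_mass A n.
Proof.
move=> d0 dA; have A0 := lt_le_trans d0 dA.
have cl := smooth_continuousT (smooth_landau A n).
have mB r := @measurable_plane_box R r.
have d20 : 0 <= d / 2 by rewrite divr_ge0// ltW.
apply: (@le_trans _ _ (\int[mu2]_(x in plane_box (d / 2)) landau A n x)); last first.
  apply: le_box_integral => // [|x Ax]; last exact: landau_ge0.
  by move: d0 dA; clear; lra.
set c := (_ ^+ 2) ^+ n; apply: (@le_trans _ _ (\int[mu2]_(x in plane_box (d / 2)) c)).
  rewrite Rintegral_cst//.
  have := congr1 fine (plane_box_measure d20) => /= H; rewrite [X in _ <= c * X]H.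
  by rewrite le_eqVlt; apply/orP; left; apply/eqP; field.
apply: (le_Rintegral (mB _) (integrable_box_cst _ c) (integrable_box_continuous _ cl)).
move=> x /plane_boxE[H1 H2].
have G (t : R) : `|t| <= d / 2 -> 1 - (d / A) ^+ 2 / 4 <= 1 - t ^+ 2 / A ^+ 2.
  move=> dt; rewrite lerD2l lerN2 expr_div_n [leRHS]mulrAC ler_pM2r ?invr_gt0 ?exprn_gt0//.
  rewrite -(real_normK (num_real t)) (_ : d ^+ 2 / 4 = (d / 2) ^+ 2); last by field.
  by rewrite ler_sqr ?nnegrE.
have c0 : 0 <= 1 - (d / A) ^+ 2 / 4.
  by have := ratio_sqr_le1 d0 dA; clear; lra.
rewrite /c /landau; apply: lerXn2r; rewrite ?nnegrE ?exprn_ge0//.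
  by rewrite mulr_ge0//; apply: le_trans c0 _; exact: G.
by rewrite expr2; apply: ler_pM => //; exact: G.
Qed.

(** A = 2r because differences of points of the box of half-side r lie in that of half-side 2r;
    adding y again leads to 3r. Within half-side d the Lipschitz estimate gives 2 C d; beyond, it
    gives 4 C r against a kernel bounded by the geometric term, over an area of 16 r^2. *)
Lemma landau_conv_error (r C d : R) n psi y : 0 < r -> smooth psi -> vanishes_off_box r psi ->
  0 <= C -> (forall x z, plane_box (3 * r) x -> plane_box (3 * r) z ->
    `|psi x - psi z| <= C * (`|x.1 - z.1| + `|x.2 - z.2|)) ->
  0 < d -> d <= 2 * r -> plane_box r y ->
  `|plane_conv (landau (2 * r) n) psi y - landau_mass (2 * r) n * psi y| <=
   2 * C * d * landau_mass (2 * r) n + 16 * C * r * (1 - (d / (2 * r)) ^+ 2) ^+ n * (4 * r ^+ 2).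
Proof.
move=> r0 sp v C0 HC d0 dr By; set A := 2 * r; have A0 : 0 < A by rewrite mulr_gt0.
set L := landau A n; have cL : continuous L := smooth_continuousT (smooth_landau A n).
have cp := smooth_continuousT sp; have mB t := @measurable_plane_box R t.
have [y1 y2] := (plane_boxE _ _).1 By.
have cf : continuous (fun x => L (x - y) * psi x).
  move=> x; apply: cvgM; last exact: cp.
  exact: (@continuous_translate _ _ (- y) cL).
have vf x : ~ plane_box A x -> L (x + y - y) * psi (x + y) = 0.
  move=> nB; rewrite v ?mulr0// => /plane_boxE[/= h1 h2]; apply/nB/plane_boxE.
  have E1 := ler_normB (x.1 + y.1) y.1; have E2 := ler_normB (x.2 + y.2) y.2.
  rewrite !addrK in E1 E2; rewrite /A; clear -E1 E2 h1 h2 y1 y2; split; lra.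
rewrite /plane_conv (Rintegral_center cf vf).
have cpy := @continuous_translate _ _ y cp.
have cf' : continuous (fun x => L x * psi (x + y)).
  by move=> x; apply: cvgM; [exact: cL|exact: cpy].
have iL := integrable_box_continuous A cL.
have cy : continuous (fun x => psi y * L x) by move=> x; apply: cvgM; [exact: cvg_cst|exact: cL].
have -> : \int[mu2]_(x in plane_box A) (L (x + y - y) * psi (x + y)) =
    \int[mu2]_(x in plane_box A) (L x * psi (x + y)) by apply: eq_Rintegral => x _; rewrite addrK.
rewrite mulrC -(RintegralZl _ (mB A) iL).
rewrite -(RintegralB (mB A) (integrable_box_continuous A cf') (integrable_box_continuous A cy)).
have cd : continuous (fun x => L x * psi (x + y) - psi y * L x).
  by move=> x; apply: cvgB; [exact: cf'|exact: cy].
have icd := integrable_box_continuous A cd.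
apply: le_trans (le_normr_Rintegral (mB A) icd) _.
set a := (1 - _) ^+ n.
have a0 : 0 <= a.
  by rewrite exprn_ge0// subr_ge0 ratio_sqr_le1.
have cb : continuous (fun x => 2 * C * d * L x + 4 * C * r * a).
  by move=> x; apply: cvgD; [apply: cvgM; [exact: cvg_cst|exact: cL]|exact: cvg_cst].
have -> : 2 * C * d * landau_mass A n + 16 * C * r * a * (4 * r ^+ 2) =
    \int[mu2]_(x in plane_box A) (2 * C * d * L x + 4 * C * r * a).
  rewrite (RintegralD (mB A) (integrableZl (mB A) (2 * C * d) iL) (integrable_box_cst A (4 * C * r * a))).
  rewrite (RintegralZl _ (mB A) iL) Rintegral_cst//; congr (_ + _).
  have := congr1 fine (plane_box_measure (ltW A0)) => /= H; rewrite [X in _ = _ * X]H /A; ring.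
apply: (le_Rintegral (mB A) (integrable_norm icd) (integrable_box_continuous A cb)) => x Ax.
have [x1 x2] := (plane_boxE _ _).1 Ax.
have L0 : 0 <= L x by exact: landau_ge0.
rewrite /= (mulrC (psi y)) -mulrBr normrM (ger0_norm L0).
have Bz : plane_box (3 * r) (x + y).
  apply/plane_boxE; rewrite /= ; have := ler_normD x.1 y.1; have := ler_normD x.2 y.2.
  by move: x1 x2 y1 y2; rewrite /A; clear; split; lra.
have By3 : plane_box (3 * r) y by apply/plane_boxE; clear -y1 y2 r0; split; lra.
have := HC _ _ Bz By3; rewrite /= !addrK => Hp.
have p0 : 0 <= 4 * C * r * a by rewrite !mulr_ge0// ltW.
have q0 : 0 <= 2 * C * d * L x by rewrite !mulr_ge0// ltW.
have [/plane_boxE[d1 d2]|nd] := pselect (plane_box d x).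
  apply: (@le_trans _ _ (2 * C * d * L x)); last by rewrite lerDl.
  rewrite mulrC ler_wpM2r//; apply: le_trans Hp _.
  have -> : 2 * C * d = C * (d + d) by ring.
  by rewrite ler_wpM2l// lerD.
apply: (@le_trans _ _ (4 * C * r * a)); last by rewrite lerDr.
rewrite mulrC; apply: ler_pM => //; last exact: landau_le (ltW d0) Ax nd.
apply: le_trans Hp _; have -> : 4 * C * r = C * (A + A) by rewrite /A; ring.
by rewrite ler_wpM2l// lerD.
Qed.

Lemma geometric_small (u w K e : R) : 0 <= u -> u < w -> 0 <= K -> 0 < e ->
  exists n, K * u ^+ n <= e * w ^+ n.
Proof.
move=> u0 uw K0 e0; have w0 := le_lt_trans u0 uw.
have q : `|u / w| < 1 by rewrite ger0_norm ?(divr_ge0 u0 (ltW w0))// ltr_pdivrMr// mul1r.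
have /cvgrPdist_le/(_ (e / (K + 1))) := cvg_geometric 1 q.
have K1 : 0 < K + 1 by rewrite ltr_wpDl.
move=> /(_ (divr_gt0 e0 K1))[n _ /(_ n (leqnn n))]; rewrite /geometric /= mul1r sub0r normrN.
rewrite (ger0_norm (exprn_ge0 n (divr_ge0 u0 (ltW w0)))) expr_div_n ler_pdivrMr ?exprn_gt0// => H.
exists n; apply: (@le_trans _ _ ((K + 1) * u ^+ n)); first by rewrite ler_wpM2r ?exprn_ge0// lerDl.
by rewrite mulrC -ler_pdivlMr// mulrAC.
Qed.

(** Convolution with the Landau kernel commutes with derivatives of [q], so one polynomial
    approximates all of them up to order N, with a common Lipschitz constant. *)
Lemma polynomial_approx (r e : R) q N : 0 < r -> smooth q -> vanishes_off_box r q -> 0 < e ->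
  exists2 P, plane_poly P & forall s, (size s <= N)%N -> forall y, plane_box r y ->
   `|iter_partial s (fun y => q y - P y) y| <= e.
Proof.
move=> r0 sq v e0.
have [C C0 HC] := words_bound (P := fun s C => forall x z, plane_box (3 * r) x -> plane_box (3 * r) z ->
    `|iter_partial s q x - iter_partial s q z| <= C * (`|x.1 - z.1| + `|x.2 - z.2|))
  (fun t C C' H CC' x z Bx Bz => le_trans (H x z Bx Bz) (ler_wpM2r (addr_ge0 (normr_ge0 _) (normr_ge0 _)) CC'))
  (fun s => lipschitz_box (3 * r) (smooth_iter s sq)) N.
pose A := 2 * r; have A0 : 0 < A by rewrite mulr_gt0.
have C1 : 0 < C + 1 by rewrite ltr_wpDl.
pose d := Num.min A (e / (4 * (C + 1))).
have d0 : 0 < d by rewrite lt_min A0 divr_gt0// mulr_gt0.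
have dA : d <= A by rewrite ge_min lexx.
have de : 2 * C * d <= e / 2.
  have : d * (4 * (C + 1)) <= e by rewrite -ler_pdivlMr ?mulr_gt0// ge_min lexx orbT.
  by move=> h; have := mulr_ge0 C0 (ltW d0); move: h d0; clear; lra.
pose a := (d / A) ^+ 2.
have a0 : 0 < a by rewrite exprn_gt0// divr_gt0.
have a1 : a <= 1 := ratio_sqr_le1 d0 dA.
have u0 : 0 <= 1 - a by rewrite subr_ge0.
have w0 : 0 < 1 - a / 4 by move: (a1); clear; lra.
(* This strict inequality lets [geometric_small] make the tail negligible against the lower bound of
   the mass. *)
have uw : 1 - a < (1 - a / 4) ^+ 2 by move: (a0) (sqr_ge0 a); rewrite !expr2; clear; lra.
have K0 : 0 <= 16 * C * r * (4 * r ^+ 2) by rewrite !mulr_ge0 ?exprn_ge0 ?(ltW r0).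
have ed : 0 < e / 2 * d ^+ 2 by rewrite mulr_gt0 ?divr_gt0 ?exprn_gt0.
have [n Hn] := geometric_small u0 uw K0 ed.
have Jge := landau_mass_ge n d0 dA.
set J := landau_mass A n in Jge.
have J0 : 0 < J.
  by apply: lt_le_trans Jge; rewrite -/a !(mulr_gt0, exprn_gt0).
pose L := landau A n.
have sL : smooth L := smooth_landau A n.
have cL := smooth_continuousT sL.
have mL := continuous_measurable_plane cL.
have iL t : 0 < t -> mu2.-integrable (plane_box t) (EFin \o L).
  by move=> _; exact: integrable_box_continuous.
have sc : smooth (plane_conv L q) := smooth_plane_conv mL iL sq r0 v.
exists (fun y => J^-1 * plane_conv L q y).
  have [_ H] := poly_kernel_landau r A n.
  have := plane_polyZD J^-1 (H q (smooth_continuousT sq) v) (plane_poly_cst 0).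
  by congr plane_poly; apply/funext => y; rewrite addr0.
move=> s sN y By.
rewrite (iter_partialB s sq (smoothZ J^-1 openT sc)).
have -> : iter_partial s (fun y => J^-1 * plane_conv L q y) y = J^-1 * plane_conv L (iter_partial s q) y.
  by rewrite -(iter_plane_conv mL iL s sq r0 v) (iter_partialZ J^-1 s sc).
have := landau_conv_error n r0 (smooth_iter s sq) (vanishes_off_box_iter s v) C0 (HC s sN) d0 dA By.
rewrite -/A -/L -/J -/a; set u := plane_conv _ _ _; set w := iter_partial s q y => H.
have -> : w - J^-1 * u = - (J^-1 * (u - J * w)).
  by rewrite mulrBr mulrA mulVf ?gt_eqF// mul1r opprB.
rewrite normrN normrM gtr0_norm ?invr_gt0// mulrC ler_pdivrMr//.
apply: le_trans H _; have -> : e * J = e / 2 * J + e / 2 * J by field.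
apply: lerD; first by rewrite ler_wpM2r// ltW.
apply: (@le_trans _ _ (e / 2 * d ^+ 2 * ((1 - a / 4) ^+ 2) ^+ n)).
  by apply: le_trans Hn; rewrite mulrAC.
by rewrite -mulrA (mulrC (d ^+ 2)); apply: ler_wpM2l Jge; rewrite divr_ge0// ltW.
Qed.

End landau.

Section inversion.
Context {R : realType}.
Variable x0 : R * R.
Implicit Types (f g phi E : R * R -> R) (x y z : R * R).
Local Notation Om := (punctured x0).
Let oOm : open Om := @open_punctured R x0.

(** The coordinates of (y - x0) / |y - x0|^2, the inversion about [x0] followed by a translation to
    the origin. *)
Definition invert i y : R := cc x0 i y * rinv x0 y ^+ 2.

Lemma smooth_invert i : smooth_on Om (invert i).
Proof. exact: (smoothM oOm (@smooth_cc R x0 _ i oOm) (smoothX 2 oOm (@smooth_rinv R x0))). Qed.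

Lemma mono_invert b c y :
  mono x0 b c (b + c).*2.+1 y = rinv x0 y * (invert ord0 y ^+ b * invert ord_max y ^+ c).
Proof.
rewrite /mono exprS -mul2n exprM exprD /invert !exprMn.
ring.
Qed.

Lemma smooth_comp_invert E : smooth E -> smooth_on Om (fun y => E (invert ord0 y, invert ord_max y)).
Proof. by move=> sE; exact: (smooth_comp oOm openT sE (smooth_invert _) (smooth_invert _) (fun _ _ => I)). Qed.

(** The chain rule produces derivatives of the inversion as extra factors; they are absorbed into
    the multiplier, so the induction runs over all [f]. On a compact set avoiding [x0] the
    multipliers are bounded. *)
Lemma comp_invert_bound K s f : compact K -> K `<=` Om -> smooth_on Om f ->
  exists2 C : R, 0 <= C & forall E, smooth E -> forall e, 0 <= e -> forall x, K x ->
   (forall t, (size t <= size s)%N -> `|iter_partial t E (invert ord0 x, invert ord_max x)| <= e) ->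
   `|iter_partial s (fun y => f y * E (invert ord0 y, invert ord_max y)) x| <= C * e.
Proof.
move=> cK KO; elim/last_ind: s f => [|s i IH] f sf.
  have [M M0 HM] := compact_continuous_bound cK (fun x Kx => smooth_continuous sf (KO x Kx)).
  exists M => // E sE e e0 x Kx H; rewrite /= normrM.
  by apply: ler_pM => //; [exact: HM|exact: (H [::])].
have sI j := smooth_partial i (smooth_invert j).
have [C0 C00 H0] := IH _ (smooth_partial i sf).
have [C1 C10 H1] := IH _ (smoothM oOm sf (sI ord0)).
have [C2 C20 H2] := IH _ (smoothM oOm sf (sI ord_max)).
exists (C0 + (C1 + C2)); first by rewrite !addr_ge0.
move=> E sE e e0 x Kx He.
have sE0 := smooth_partial ord0 sE; have sE1 := smooth_partial ord_max sE.
pose A g E y := g y * E (invert ord0 y, invert ord_max y).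
have sA g F : smooth_on Om g -> smooth F -> smooth_on Om (A g F).
  by move=> sg sF; exact: (smoothM oOm sg (smooth_comp_invert sF)).
pose A0 := A (partial i f) E; pose A1 := A (fun y => f y * partial i (invert ord0) y) (partial ord0 E).
pose A2 := A (fun y => f y * partial i (invert ord_max) y) (partial ord_max E).
have sA0 : smooth_on Om A0 := sA _ _ (smooth_partial i sf) sE.
have sA1 : smooth_on Om A1 := sA _ _ (smoothM oOm sf (sI ord0)) sE0.
have sA2 : smooth_on Om A2 := sA _ _ (smoothM oOm sf (sI ord_max)) sE1.
have D y : Om y -> partial i (A f E) y = 1 * A0 y + (1 * A1 y + A2 y).
  move=> yx; have df := smooth_derivable sf yx; have dc := smooth_derivable (smooth_comp_invert sE) yx.
  rewrite /A (partialM_at (df _) (dc _)).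
  rewrite [partial i (fun y => E _) y](@derive_val _ _ _ _ _ _ _ (smooth_comp_is_derive openT i sE (smooth_invert ord0) (smooth_invert ord_max) yx I)).
  by rewrite !mul1r /A0 /A1 /A2 /A mulrDr !mulrA.
rewrite iter_partial_rcons (iter_partial_eq_on s oOm D (KO x Kx)).
have sA12 := smoothD oOm (smoothZ 1 oOm sA1) sA2.
rewrite (iter_partialZD_on 1 s sA0 sA12 (KO x Kx)) (iter_partialZD_on 1 s sA1 sA2 (KO x Kx)) !mul1r.
rewrite !mulrDl; apply: le_trans (ler_normD _ _) _; apply: lerD.
  apply: (H0 _ sE e e0 x Kx) => t ts; apply: He; rewrite size_rcons; exact: leqW.
apply: le_trans (ler_normD _ _) _; apply: lerD.
  by apply: (H1 _ sE0 e e0 x Kx) => t ts; rewrite -iter_partial_rcons; apply: He; rewrite !size_rcons ltnS.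
by apply: (H2 _ sE1 e e0 x Kx) => t ts; rewrite -iter_partial_rcons; apply: He; rewrite !size_rcons ltnS.
Qed.

Lemma sqdist_invert y : Om y -> sqdist (0, 0) (invert ord0 y, invert ord_max y) = rinv x0 y ^+ 2.
Proof.
move=> yx; rewrite /sqdist /= !subr0 /invert -[RHS]mulr1 -(rinv_sqr yx).
ring.
Qed.

Lemma rinv_invert y : Om y -> rinv (0, 0) (invert ord0 y, invert ord_max y) = (rinv x0 y)^-1.
Proof.
move=> yx; rewrite /rinv sqdist_invert// /rinv.
by rewrite sqrtr_sqr ger0_norm// invr_ge0 sqrtr_ge0.
Qed.

Lemma invertK y : Om y ->
  (x0.1 + cc (0, 0) ord0 (invert ord0 y, invert ord_max y) * rinv (0, 0) (invert ord0 y, invert ord_max y) ^+ 2,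
   x0.2 + cc (0, 0) ord_max (invert ord0 y, invert ord_max y) * rinv (0, 0) (invert ord0 y, invert ord_max y) ^+ 2) = y.
Proof.
move=> yx; rewrite rinv_invert// /cc /xcoord /= !subr0 exprVn /invert.
rewrite !mulfK ?expf_neq0 ?rinv_neq0//.
by case: y yx => a b _; rewrite /cc /xcoord /= !(addrC x0.1) !(addrC x0.2) !subrK.
Qed.

Section density.
Variables (U : set (R * R)) (d : R) (d0 : 0 < d).
Hypothesis HU : forall x, sqdist x0 x <= (2 * d) ^+ 2 -> U x.
Variables (T : functional R) (cT : compact_distribution T).
Hypothesis TU : forall psi, test_on U psi -> T psi = 0.
Hypothesis Tmono : forall b c, T (fun y => outer x0 d y * mono x0 b c (b + c).*2.+1 y) = 0.

Lemma poly_invert_vanish P : plane_poly P ->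
  T (fun y => outer x0 d y * (rinv x0 y * P (invert ord0 y, invert ord_max y))) = 0.
Proof.
case=> s Hs; have lT := ((compact_distributionP T).1 cT).1.
have sm b c := smooth_outerM d0 (@smooth_mono R x0 b c (b + c).*2.+1).
have -> : (fun y => outer x0 d y * (rinv x0 y * P (invert ord0 y, invert ord_max y))) =
    (fun y => \sum_(p <- s) p.1.1 * (outer x0 d y * mono x0 p.1.2 p.2 (p.1.2 + p.2).*2.+1 y)).
  apply/funext => y; rewrite Hs !mulr_sumr; apply: eq_bigr => p _.
  by rewrite mono_invert /=; ring.
rewrite (linear_dist_sum _ _ lT); last by move=> p; exact: (smoothZ _ openT (sm _ _)).
by rewrite big1// => p _; rewrite (linear_distZ _ lT (sm _ _)) Tmono mulr0.
Qed.

(** With z the inverted point, |z| = 1 / |y - x0|, so [q] must be [phi] at the preimage of z divided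
    by |z|. The point z = 0, the image of infinity, is removed by [outer], which is 1 for |z| >=
    1/rho; large z, images of points near [x0], are removed by [cutoff], which is 1 for |z| <=
    1/d. *)
Lemma local_inverse (phi : R * R -> R) (rho : R) : smooth phi -> 0 < rho -> exists q, [/\ smooth q,
  vanishes_off_box (2 * d^-1) q &
  forall y, Om y -> d ^+ 2 <= sqdist x0 y -> sqdist x0 y <= rho ^+ 2 ->
    rinv x0 y * q (invert ord0 y, invert ord_max y) = phi y].
Proof.
move=> sp rho0; pose O := ((0, 0) : R * R).
have oO : open (punctured O) := @open_punctured R O.
pose h z := phi (x0.1 + cc O ord0 z * rinv O z ^+ 2, x0.2 + cc O ord_max z * rinv O z ^+ 2) * rinv O z.
have sc (c : R) i : smooth_on (punctured O) (fun z => c + cc O i z * rinv O z ^+ 2).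
  apply: (smoothD oO (@smooth_cst R _ c)).
  exact: (smoothM oO (@smooth_cc R O _ i oO) (smoothX 2 oO (@smooth_rinv R O))).
have sh : smooth_on (punctured O) h.
  exact: (smoothM oO (smooth_comp oO openT sp (sc _ _) (sc _ _) (fun _ _ => I)) (@smooth_rinv R O)).
pose del := (2 * rho)^-1; have del0 : 0 < del by rewrite invr_gt0 mulr_gt0.
have di0 : 0 < d^-1 by rewrite invr_gt0.
have dd : (d^-1) ^+ 2 < (2 * d^-1) ^+ 2.
  by rewrite exprMn ltr_pMl ?exprn_gt0// expr2 -natrM ltr1n.
pose q z := cutoff ((d^-1) ^+ 2) ((2 * d^-1) ^+ 2) O z * (outer O del z * h z).
exists q; split.
- exact: (smoothM openT (smooth_cutoff O dd) (smooth_outerM del0 sh)).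
- move=> z nz; rewrite /q cutoff0 ?mul0r// leNgt; apply/negP => /ltW H; apply: nz.
  have := sqdist_box (mulr_ge0 (ler0n R 2) (ltW di0)) H.
  by rewrite /= !subr0 => ?; exact/plane_boxE.
move=> y yx dy yr; have s0 := sqdist_gt0 yx.
have r2 : rinv x0 y ^+ 2 = (sqdist x0 y)^-1 by rewrite /rinv exprVn sqr_sqrtr// ltW.
rewrite /q /h invertK// rinv_invert// (cutoff1 dd); last first.
  by rewrite sqdist_invert// r2 exprVn lef_pV2 ?posrE ?exprn_gt0.
rewrite outer1; last first.
  rewrite sqdist_invert// r2 /del (_ : 2 * (2 * rho)^-1 = rho^-1); last by field; rewrite gt_eqF.
  by rewrite exprVn lef_pV2 ?posrE ?exprn_gt0.
by rewrite !mul1r mulrCA mulfV ?mulr1// rinv_neq0.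
Qed.

(** T is bounded by finitely many derivatives on a compact set, and only points at distance at least
    d from [x0] matter. There phi = |z| q(z); replacing [q] by a polynomial close in C^N changes the
    value by O(e), and the polynomial part is annihilated. *)
Lemma vanish_of_mono phi : smooth phi -> T phi = 0.
Proof.
move=> sp; have [lT [K [N [C [cK C0 HT]]]]] := (compact_distributionP T).1 cT.
have [M M0 HM] := compact_continuous_bound cK (fun x _ => smooth_continuousT (smooth_sqdist x0) (x := x)).
(* Since (M + 1)^2 > M, the squared radius rho^2 exceeds [sqdist] on all of [K]. *)
pose rho := M + 1; have rho0 : 0 < rho by rewrite ltr_wpDl.
have Mrho x : K x -> sqdist x0 x < rho ^+ 2.
  move=> /HM; rewrite ger0_norm ?addr_ge0 ?sqr_ge0// => H; apply: le_lt_trans H _.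
  apply: (@lt_le_trans _ _ rho); first by rewrite ltrDl.
  by rewrite expr2 ler_peMr ?(ltW rho0)// lerDr.
have [q [sq vq qE]] := local_inverse sp rho0.
pose K' := K `&` [set x | d ^+ 2 <= sqdist x0 x].
have cs := smooth_continuousT (smooth_sqdist x0).
have cK' : compact K'.
  apply: compact_closedI => //.
  have -> : [set x | d ^+ 2 <= sqdist x0 x] = sqdist x0 @^-1` [set t | d ^+ 2 <= t] by [].
  by move/continuous_closedP : cs; apply; exact: closed_ge.
have K'O : K' `<=` Om.
  move=> x [_ /= H] xx; move: H; rewrite xx /sqdist !subrr expr0n addr0 leNgt.
  by rewrite exprn_gt0.
have so := smooth_outer x0 d0.
have sof : smooth_on Om (fun y => outer x0 d y * rinv x0 y).
  exact: (smoothM oOm (smooth_sub (@subsetT _ _) so) (@smooth_rinv R x0)).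
have [B B0 HB] := words_bound (P := fun s C => forall E, smooth E -> forall e, 0 <= e -> forall x, K' x ->
   (forall t, (size t <= size s)%N -> `|iter_partial t E (invert ord0 x, invert ord_max x)| <= e) ->
   `|iter_partial s (fun y => outer x0 d y * rinv x0 y * E (invert ord0 y, invert ord_max y)) x| <= C * e)
  (fun t C C' H CC' E sE e e0 x Kx HE => le_trans (H E sE e e0 x Kx HE) (ler_wpM2r e0 CC'))
  (fun s => comp_invert_bound s cK' K'O sof) N.
apply/eqP; rewrite -normr_le0; apply: (small_le0 ltr01 (mulr_ge0 C0 B0)) => e e0 _.
have di0 : 0 < 2 * d^-1 by rewrite mulr_gt0// invr_gt0.
have [P pP HP] := polynomial_approx N di0 sq vq e0.
have sP := smooth_plane_poly pP.
pose E z := q z - P z; have sE : smooth E := smoothB openT sq sP.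
have sop := smoothM openT so sp.
have sPi := smooth_outerM d0 (smoothM oOm (@smooth_rinv R x0) (smooth_comp_invert sP)).
rewrite (dist_outer d0 lT TU HU sp) -[T _]subr0 -(poly_invert_vanish pP) -(linear_distB lT sop sPi) -mulrA.
apply: HT; [exact: (smoothB openT sop sPi)|by rewrite mulr_ge0// ltW|].
move=> s sN x Kx; have [dx|dx] := leP (d ^+ 2) (sqdist x0 x); last first.
  (* Near such a point [outer] is identically 0, so all derivatives of the difference vanish. *)
  have oW := @open_sqdist_lt R x0 (d ^+ 2).
  rewrite (@iter_partial_eq_on R _ _ (fun=> 0) s oW _ x dx); last first.
    by move=> y /= /ltW H; rewrite !outer0// !mul0r subrr.
  by rewrite iter_partial_cst0 normr0 mulr_ge0// ltW.
have xO : Om x by apply: K'O.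
pose W := Om `&` [set y | sqdist x0 y < rho ^+ 2].
have oW : open W := openI oOm (@open_sqdist_lt R x0 (rho ^+ 2)).
have Wx : W x by split=> //; exact: Mrho.
have EW y : W y -> outer x0 d y * phi y - outer x0 d y * (rinv x0 y * P (invert ord0 y, invert ord_max y)) =
    outer x0 d y * rinv x0 y * E (invert ord0 y, invert ord_max y).
  move=> [yx /= yr]; rewrite /E mulrBr -!mulrA.
  have [dy|dy] := leP (d ^+ 2) (sqdist x0 y); first by rewrite qE// ltW.
  by rewrite outer0 ?mul0r// ltW.
rewrite (iter_partial_eq_on s oW EW Wx).
apply: (HB s sN E sE e (ltW e0) x) => [|t ts]; first by split.
 apply: HP; first exact: leq_trans ts sN.
have : sqdist (0, 0) (invert ord0 x, invert ord_max x) <= (2 * d^-1) ^+ 2.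
  rewrite sqdist_invert//; have s0 := sqdist_gt0 xO.
  have -> : rinv x0 x ^+ 2 = (sqdist x0 x)^-1 by rewrite /rinv exprVn sqr_sqrtr// ltW.
  apply: (@le_trans _ _ (d ^- 2)); first by rewrite lef_pV2 ?posrE ?exprn_gt0.
  by rewrite exprMn exprVn ler_peMl ?invr_ge0 ?exprn_ge0 ?(ltW d0)// expr2 -natrM ler1n.
move=> /(sqdist_box (ltW di0)); rewrite /= !subr0 => ?; exact/plane_boxE.
Qed.

End density.

End inversion.

(** * Vanishing of the operator T *)

Section combine.
Context {R : realType}.
Local Notation Y := (measurableTypeR R).
Local Notation mu := (@lebesgue_measure R).
Local Notation mu2 := (mu \x mu)%E.
Implicit Types (phi : R * R -> R) (x y : R * R).

Lemma compact_iter_dist s (u : functional R) : compact_distribution u ->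
  compact_distribution (fun phi => u (iter_partial s phi)).
Proof.
elim: s u => [//|i s IH] u cu.
have := IH _ (compact_distZ (-1) (compact_partial_dist i cu)).
congr compact_distribution; apply/funext => phi.
by rewrite /partial_dist mulN1r opprK.
Qed.

Lemma test_iter V s phi : test_on V phi -> test_on V (iter_partial s phi).
Proof.
move=> [sp cs sV]; apply: (test_onI cs (smooth_iter s sp)) sV => x nx.
have oS : open (~` supp phi) by apply: closed_openC; exact: closed_closure.
rewrite (@iter_partial_eq_on R _ _ (fun=> 0) s oS _ x nx) ?iter_partial_cst0// => y ny.
by apply/eqP; apply: contrapT => /negP py; apply: ny; exact: subset_closure.
Qed.

Lemma iter_partial_swap V g s t y : open V -> smooth_on V g -> V y ->
  iter_partial s (iter_partial t g) y = iter_partial t (iter_partial s g) y.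
Proof.
move=> oV sg Vy; rewrite -!iter_partial_cat !(iter_partial_multi _ oV sg Vy) !count_cat.
by rewrite !(addnC (count _ s)).
Qed.

Lemma moments_vanish U x0 m (F : nat -> functional R) : open U -> U x0 ->
  (forall j, compact_distribution (F j)) ->
  (forall j phi, test_on U phi -> F j phi = 0) ->
  (forall a, (a <= m)%N -> exists V g, exists2 c : R, c != 0 & [/\ open V, V x0, smooth_on V g,
    forall p q, multi_partial p q g x0 = 0 &
    forall phi, test_on V phi ->
    \sum_(0 <= j < m.+1) c * F j (plane_conv (mono (0, 0) (a + j) (m - a + (m - j)) m.*2.+1) phi) =
    \int[mu2]_(x in V) (g x * phi x)]) ->
  forall phi, smooth phi -> \sum_(0 <= j < m.+1) (-1) ^+ j * F j (multi_partial (m - j) j phi) = 0.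
Proof.
move=> oU Ux0 cF FU HN.
have lF j : linear_dist (F j) := ((compact_distributionP _).1 (cF j)).1.
(* Two nested cutoffs occur: radius d for T and radius 2d for the F_j, which needs the disc of
   radius 4d inside U. Where the second cutoff is nonzero the first is locally 1, so the derivatives
   in T pass through it in [Trinv]. *)
have [d d0 HU] : exists2 d, 0 < d & forall x, sqdist x0 x <= (2 * (2 * d)) ^+ 2 -> U x.
  have /nbhs_ballP[r r0 Hr] := open_near oU Ux0 (fun y Uy => Uy); rewrite /= in r0.
  exists (r / 8); first exact: divr_gt0.
  move=> x; have q0 : 0 <= 2 * (2 * (r / 8)) := mulr_ge0 (ler0n R 2) (mulr_ge0 (ler0n R 2) (divr_ge0 (ltW r0) (ler0n R 8))).
  move=> /(sqdist_box q0)[h1 h2]; apply: Hr.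
  by split; rewrite /ball /= distrC; move: h1 h2 r0; clear; lra.
have d20 : 0 < 2 * d by rewrite mulr_gt0.
have HU1 x : sqdist x0 x <= (2 * d) ^+ 2 -> U x.
  move=> h; apply: HU; apply: le_trans h _.
  by rewrite ler_sqr ?nnegrE ?(ltW d20) ?mulr_ge0 ?(ltW d0)// ler_peMl ?(ltW d20)// ler1n.
pose w j := nseq (m - j) (@ord0 1) ++ nseq j ord_max.
pose T phi := \sum_(0 <= j < m.+1) (-1) ^+ j * F j (multi_partial (m - j) j phi).
have TE phi : T phi = \sum_(0 <= j < m.+1) (-1) ^+ j * F j (iter_partial (w j) phi).
  by apply: eq_bigr => j _; rewrite multi_partialE.
have cT : compact_distribution T.
  have -> : T = fun phi => \sum_(0 <= j < m.+1) (-1) ^+ j * F j (iter_partial (w j) phi) by apply/funext.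
  by apply: compact_dist_sum => j; apply: compact_distZ; exact: compact_iter_dist.
have TU psi : test_on U psi -> T psi = 0.
  by move=> tp; rewrite TE big1// => j _; rewrite FU ?mulr0//; exact: test_iter.
have Hl j := punctured_outer x0 d20 (lF j).
have lM a s (am : (a <= m)%N) : \sum_(0 <= j < m.+1)
    F j (fun y => outer x0 (2 * d) y * iter_partial s (mono x0 (a + j) (m - a + (m - j)) m.*2.+1) y) = 0.
  have [V [g [c c0 [oV Vx0 sg g0 Hg]]]] := HN a am.
  have cFU j phi (tp : test_on U phi) : c * F j phi = 0 by rewrite FU ?mulr0.
  have := vanishing_moments d20 HU (fun j => compact_distZ c (cF j)) cFU am oV Vx0 sg g0 Hg s.
  by rewrite -mulr_sumr => /eqP; rewrite mulf_eq0 (negbTE c0) /= => /eqP.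
have oO := @open_punctured R x0.
have Trinv s : T (fun y => outer x0 d y * iter_partial s (rinv x0) y) = 0.
  rewrite -[RHS](rinv_moments Hl lM s); apply: eq_bigr => j _; congr (_ * _).
  have ss := smooth_iter s (@smooth_rinv R x0).
  have so := smooth_outerM d0 ss.
  rewrite multi_partialE (dist_outer d20 (lF j) (FU j) HU (smooth_iter _ so)) multi_partialE.
  congr (F j); apply/funext => y.
  have [/outer0 ->|yd] := leP (sqdist x0 y) ((2 * d) ^+ 2) => //; first by rewrite !mul0r.
  have oW := @open_sqdist_gt R x0 ((2 * d) ^+ 2).
  have yx : punctured x0 y.
    by move=> yx; move: yd; rewrite yx /sqdist !subrr expr0n addr0 ltNge exprn_ge0// ltW.
  congr (_ * _); rewrite -(iter_partial_swap _ _ oO (@smooth_rinv R x0) yx).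
  apply: (iter_partial_eq_on _ oW _ yd) => z /= /ltW zd.
  by rewrite outer1// mul1r.
have Tmono b c : T (fun y => outer x0 d y * mono x0 b c (b + c).*2.+1 y) = 0.
  have lT := ((compact_distributionP _).1 cT).1.
  exact: (punctured_mono (punctured_outer x0 d0 lT) Trinv b c [::]).
exact: (vanish_of_mono d0 HU1 cT TU Tmono).
Qed.

End combine.

(** * Tensors *)

Section tuples.
Context {R : realType}.

Lemma big_I2 (X : 'I_2 -> R) : \sum_(i < 2) X i = X ord0 + X ord_max.
Proof.
rewrite big_ord_recl big_ord1; congr (_ + X _); exact: val_inj.
Qed.

Lemma behead_cons n (i : 'I_2) (M : n.-tuple 'I_2) : [tuple of behead [tuple of i :: M]] = M.
Proof. exact: val_inj. Qed.

Lemma big_tuple_cons n (X : n.+1.-tuple 'I_2 -> R) :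
  \sum_M X M = \sum_(i < 2) \sum_(M : n.-tuple 'I_2) X [tuple of i :: M].
Proof.
rewrite pair_big /= (reindex (fun p : 'I_2 * n.-tuple 'I_2 => [tuple of p.1 :: p.2])) //=.
exists (fun M => (thead M, [tuple of behead M])) => [[i M] _|M _] /=.
  by rewrite theadE behead_cons.
by rewrite [RHS]tuple_eta.
Qed.

Lemma ones_cons n (i : 'I_2) (M : n.-tuple 'I_2) : ones [tuple of i :: M] = ((i == ord0) + ones M)%N.
Proof. by []. Qed.

Lemma twos_cons n (i : 'I_2) (M : n.-tuple 'I_2) : twos [tuple of i :: M] = ((i == ord_max) + twos M)%N.
Proof. by []. Qed.

Lemma ones_permute n p (I : n.-tuple 'I_2) : ones (permute p I) = ones I.
Proof. by apply: seq.permP; apply/tuple_permP; exists p. Qed.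

Lemma twos_permute n p (I : n.-tuple 'I_2) : twos (permute p I) = twos I.
Proof. by apply: seq.permP; apply/tuple_permP; exists p. Qed.

Lemma ones_twos n (I : n.-tuple 'I_2) : (ones I + twos I)%N = n.
Proof.
rewrite -[RHS](size_tuple I) /ones /twos; elim: (tval I) => [//|i s IH] /=.
by rewrite addnACA IH; case: (I2P i) => ->.
Qed.

Lemma ones_le n (I : n.-tuple 'I_2) : (ones I <= n)%N.
Proof. by rewrite -[leqRHS](ones_twos I) leq_addr. Qed.

Lemma twos_le n (I : n.-tuple 'I_2) : (twos I <= n)%N.
Proof. by rewrite -[leqRHS](ones_twos I) leq_addl. Qed.

Lemma permute_ones n (I M : n.-tuple 'I_2) : ones I = ones M -> exists p, I = permute p M.
Proof.
move=> E; have E2 : twos I = twos M.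
  by apply/eqP; rewrite -(eqn_add2l (ones I)) {2}E !ones_twos.
have /tuple_permP[p Hp] : perm_eq I M.
  by apply/allP => i _ /=; case: (I2P i) => ->; apply/eqP; [exact: E|exact: E2].
by exists p; exact: val_inj.
Qed.

Lemma permuteM n (p q : 'S_n) (I : n.-tuple 'I_2) : permute p (permute q I) = permute (p * q)%g I.
Proof. by apply: eq_from_tnth => i; rewrite !tnth_mktuple permM. Qed.

Lemma permute_inj n (p : 'S_n) : injective (permute p).
Proof.
by apply: (can_inj (g := permute p^-1%g)) => I; rewrite permuteM mulVg; apply: eq_from_tnth => i; rewrite tnth_mktuple perm1.
Qed.

(** The [minn] makes the length n for p > n too, so that every p has a word. *)
Lemma block_word_size n p : size (nseq (minn p n) (@ord0 1) ++ nseq (n - p) ord_max) == n.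
Proof. by rewrite size_cat !size_nseq minnC minnE subnK ?leq_subr. Qed.

Definition block_word n p : n.-tuple 'I_2 := Tuple (block_word_size n p).

Lemma ones_block_word n p : (p <= n)%N -> ones (block_word n p) = p.
Proof.
by move=> pn; rewrite /ones /= count_cat !count_nseq /= mul1n mul0n addn0; exact/minn_idPl.
Qed.

Lemma words_of_degree k l a : (a <= k + l)%N ->
  exists (I : k.-tuple 'I_2) (J : l.-tuple 'I_2), (ones I + twos J = a)%N.
Proof.
move=> am; exists (block_word k (minn a k)), (block_word l (l - (a - k))).
have -> : twos (block_word l (l - (a - k))) = (a - k)%N.
  have := ones_twos (block_word l (l - (a - k))); rewrite ones_block_word ?leq_subr//.
  move=> /(congr1 (subn^~ (l - (a - k))%N)).
  by rewrite addKn subKn// leq_subLR.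
by rewrite ones_block_word ?geq_minr// minnE subnK// leq_subr.
Qed.

(** The position 0 may be exchanged for any j by a transposition; summing over j turns each
    permutation into a reindexing of the full sum of [G]. *)
Lemma perm_average n (G : 'I_n.+1 -> R) :
  (n.+1`!%:R)^-1 * \sum_(p : 'S_n.+1) G (p ord0) = n.+1%:R^-1 * \sum_i G i.
Proof.
have E j : \sum_(p : 'S_n.+1) G (p ord0) = \sum_(p : 'S_n.+1) G (p j).
  rewrite (reindex_inj (mulgI (tperm ord0 j))); apply: eq_bigr => p _.
  by rewrite permM tpermL.
have H : n.+1%:R * \sum_(p : 'S_n.+1) G (p ord0) = n.+1`!%:R * \sum_i G i.
  transitivity (\sum_(j < n.+1) \sum_(p : 'S_n.+1) G (p j)).
    rewrite [RHS](eq_bigr (fun=> \sum_(p : 'S_n.+1) G (p ord0))); last by move=> j _; rewrite -E.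
    by rewrite sumr_const card_ord -[RHS]mulr_natl.
  rewrite exchange_big /= (eq_bigr (fun=> \sum_i G i)).
    by rewrite sumr_const card_Sn -[LHS]mulr_natl.
  by move=> p _; rewrite [RHS](reindex_inj (@perm_inj _ p)).
have n0 : n.+1%:R != 0 :> R by rewrite pnatr_eq0.
have f0 : n.+1`!%:R != 0 :> R by rewrite pnatr_eq0 -lt0n fact_gt0.
by apply: (mulfI n0); rewrite mulrCA H !mulrA mulVf// mulfV.
Qed.

Lemma sum_tnth n (I : n.-tuple 'I_2) (G : 'I_2 -> R) :
  \sum_(i < n) G (tnth I i) = (ones I)%:R * G ord0 + (twos I)%:R * G ord_max.
Proof.
rewrite -(big_tuple _ _ I xpredT G) /ones /twos; elim: (tval I) => [|i s IH] /=.
  by rewrite big_nil !mul0r addr0.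
rewrite big_cons IH !natrD; case: (I2P i) => -> /=; ring.
Qed.

End tuples.

Section alt_contraction.
Context {R : realType}.
Implicit Types (phi : R * R -> R) (k l j : nat).

(* The kernel of the normal operator depends on (M, N) only through the sign (-1)^(ones N) and
   the degree ones M + twos N, so that N f is determined by these contractions. *)
Definition alt_contraction k l (f : tensor R k l) j : functional R := fun phi =>
  \sum_(M : k.-tuple 'I_2) \sum_(N : l.-tuple 'I_2 | (ones M + twos N == j)%N)
     (-1) ^+ ones N * f M N phi.

Lemma compact_alt_contraction k l (f : tensor R k l) j :
  (forall I J, compact_distribution (f I J)) -> compact_distribution (alt_contraction f j).
Proof.
move=> cf; apply: compact_dist_sum => M; apply: compact_dist_sum => N; exact: compact_distZ.
Qed.

Lemma alt_contraction_sym_left k l (g : tensor R k l) j phi :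
  alt_contraction (sym_left g) j phi = alt_contraction g j phi.
Proof.
have E p : alt_contraction (fun M => g (permute p M)) j phi = alt_contraction g j phi.
  rewrite [RHS](reindex_inj (@permute_inj _ p)); apply: eq_bigr => M _.
  by rewrite ones_permute.
have -> : alt_contraction (sym_left g) j phi =
    (k`!%:R)^-1 * \sum_(p : 'S_k) alt_contraction (fun M => g (permute p M)) j phi.
  rewrite exchange_big /= mulr_sumr; apply: eq_bigr => M _.
  rewrite exchange_big /= mulr_sumr; apply: eq_bigr => N _.
  by rewrite -mulr_sumr mulrCA.
by rewrite (eq_bigr _ (fun p _ => E p)) sumr_const card_Sn -[X in _ * X = _]mulr_natl mulrA mulVf ?mul1r//.
Qed.

Lemma alt_contraction_sym_right k l (g : tensor R k l) j phi :
  alt_contraction (sym_right g) j phi = alt_contraction g j phi.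
Proof.
have E q : alt_contraction (fun M N => g M (permute q N)) j phi = alt_contraction g j phi.
  apply: eq_bigr => M _; rewrite [RHS](reindex_inj (@permute_inj _ q)).
  by apply: eq_big => N; rewrite ?twos_permute ?ones_permute.
have -> : alt_contraction (sym_right g) j phi =
    (l`!%:R)^-1 * \sum_(q : 'S_l) alt_contraction (fun M N => g M (permute q N)) j phi.
  rewrite exchange_big /= mulr_sumr; apply: eq_bigr => M _.
  rewrite exchange_big /= mulr_sumr; apply: eq_bigr => N _.
  by rewrite -mulr_sumr mulrCA.
by rewrite (eq_bigr _ (fun p _ => E p)) sumr_const card_Sn -[X in _ * X = _]mulr_natl mulrA mulVf ?mul1r//.
Qed.

(** After removing the symmetrizations, the leading pairs (1, 1) and (2, 2) remain. Both raise the
    degree by one, the first through [ones M] and the second through [twos N], but only the first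
    changes the sign, so they cancel. *)
Lemma alt_contraction_lambda k l (w : tensor R k l) j phi : alt_contraction (lambda w) j phi = 0.
Proof.
rewrite /lambda alt_contraction_sym_left alt_contraction_sym_right /alt_contraction.
rewrite big_tuple_cons big_I2 -big_split /= big1// => M _.
rewrite big_mkcond [X in _ + X]big_mkcond /= !big_tuple_cons !big_I2.
rewrite [X in _ + X + _]big1; last first.
  by move=> N _; rewrite !theadE /= mul0r mulr0; case: ifP.
rewrite [X in _ + _ + (X + _)]big1; last first.
  by move=> N _; rewrite !theadE /= mul0r mulr0; case: ifP.
rewrite addr0 add0r -big_split big1// => N _.
rewrite !theadE !behead_cons !ones_cons !twos_cons /= !add0n !add1n addSn addnS exprS !mul1r.
by case: ifP => _; rewrite ?addr0//; ring.
Qed.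

(** A leading index 1 raises the degree by one and brings d1; a leading index 2 keeps it and brings
    d2. This is the shape of the conclusion of [division]. *)
Lemma alt_contraction_d' k l (u : tensor R k l) j phi : alt_contraction (d' u) j phi =
  (if j is j'.+1 then - alt_contraction u j' (partial ord0 phi) else 0)
  - alt_contraction u j (partial ord_max phi).
Proof.
rewrite /d' alt_contraction_sym_left /alt_contraction big_tuple_cons big_I2; congr (_ + _).
  case: j => [|j].
    by rewrite big1// => M _; rewrite big_pred0// => N; rewrite ones_cons.
  rewrite -sumrN; apply: eq_bigr => M _; rewrite -sumrN; apply: eq_big => N.
    by rewrite ones_cons add1n addSn eqSS.
  by move=> _; rewrite theadE behead_cons /partial_dist mulrN.
rewrite -sumrN; apply: eq_bigr => M _; rewrite -sumrN; apply: eq_big => N.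
  by rewrite ones_cons add0n.
by move=> _; rewrite theadE behead_cons /partial_dist mulrN.
Qed.

Lemma alt_contractionB k l (f g : tensor R k l) j phi :
  alt_contraction (fun I J phi => f I J phi - g I J phi) j phi = alt_contraction f j phi - alt_contraction g j phi.
Proof.
rewrite -sumrB; apply: eq_bigr => M _; rewrite -sumrB; apply: eq_bigr => N _.
by rewrite mulrBr.
Qed.

End alt_contraction.

Section normal.
Context {R : realType}.
Implicit Types (phi : R * R -> R) (k l j : nat).

Lemma normal_kernelE k l (I M : k.-tuple 'I_2) (J N : l.-tuple 'I_2) (x : R * R) :
  let a := (ones I + twos J)%N in let j := (ones M + twos N)%N in let m := (k + l)%N in
  normal_kernel (R := R) I J M N x = (-1) ^+ (ones J + ones N) *
    mono (0, 0) (a + j) (m - a + (m - j)) m.*2.+1 x.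
Proof.
move=> a j m; rewrite /normal_kernel -mulrA; congr (_ * _).
rewrite /mono /cc /xcoord /rinv /sqdist /= !subr0 exprVn.
have e3 : (2 * k + 2 * l + 1 = m.*2.+1)%N by rewrite addn1 -mulnDr mul2n.
have split (P : k.-tuple 'I_2) (X : l.-tuple 'I_2) :
    (m - (ones P + twos X) = twos P + ones X)%N.
  have E : (twos P + ones X + (ones P + twos X) = m)%N.
    by rewrite addnACA (addnC (twos P)) !ones_twos.
  by rewrite -E addnK.
have e1 : (ones I + twos J + ones M + twos N = a + j)%N by rewrite /a /j !addnA.
have e2 : (twos I + ones J + twos M + ones N = m - a + (m - j))%N.
  by rewrite /a /j !split// !addnA.
by rewrite e1 e2 e3.
Qed.

Lemma alt_contraction_sum k l (X : k.-tuple 'I_2 -> l.-tuple 'I_2 -> nat -> R) :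
  \sum_(0 <= j < (k + l).+1) \sum_M \sum_(N | (ones M + twos N == j)%N) X M N j =
  \sum_M \sum_N X M N (ones M + twos N)%N.
Proof.
rewrite exchange_big /=; apply: eq_bigr => M _.
under eq_bigr do rewrite big_mkcond /=.
rewrite exchange_big /=; apply: eq_bigr => N _.
have lt : (ones M + twos N < (k + l).+1)%N.
  by rewrite ltnS leq_add ?ones_le ?twos_le.
by rewrite big_mkord -big_mkcond /= (big_pred1 (Ordinal lt)).
Qed.

Lemma normal_operatorE k l (f : tensor R k l) (I : k.-tuple 'I_2) (J : l.-tuple 'I_2) V phi :
  (forall I J, compact_distribution (f I J)) -> test_on V phi ->
  let a := (ones I + twos J)%N in let m := (k + l)%N in
  normal_operator f I J phi = \sum_(0 <= j < m.+1) (2 * (-1) ^+ ones J) *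
    alt_contraction f j (plane_conv (mono (0, 0) (a + j) (m - a + (m - j)) m.*2.+1) phi).
Proof.
move=> cf tp a m; have [r r0 v] := vanishes_off_box_test tp.
have [sp _ _] := tp.
have am : (a <= m)%N by rewrite leq_add ?ones_le ?twos_le.
rewrite -mulr_sumr [in RHS]/alt_contraction.
rewrite (alt_contraction_sum (fun M N j => (-1) ^+ ones N * f M N
   (plane_conv (mono (0, 0) (a + j) (m - a + (m - j)) m.*2.+1) phi))).
rewrite /normal_operator -mulrA; congr (2 * _).
rewrite mulr_sumr; apply: eq_bigr => M _; rewrite mulr_sumr; apply: eq_bigr => N _.
set j := (ones M + twos N)%N; have jm : (j <= m)%N.
  by rewrite leq_add ?ones_le ?twos_le.
set L := mono _ _ _ _.
have mL : measurable_fun (setT : set (measurableTypeR R * measurableTypeR R)) L by exact: measurable_mono.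
have iL t : 0 < t -> ((@lebesgue_measure R) \x (@lebesgue_measure R))%E.-integrable (plane_box t) (EFin \o L).
  apply: integrable_mono; congr S.
  by rewrite addnACA !subnKC// addnn.
have lf := ((compact_distributionP _).1 (cf M N)).1.
rewrite mulrA -exprD -(linear_distZ _ lf (smooth_plane_conv mL iL sp r0 v)).
rewrite -(plane_convZ mL iL _ sp r0 v) /convolution; congr (f M N).
apply/funext => y; apply: eq_Rintegral => x _.
by rewrite normal_kernelE.
Qed.

Lemma alt_contraction_vanish k l (f : tensor R k l) U x0 phi :
  open U -> U x0 -> (forall I J, compact_distribution (f I J)) ->
  (forall j psi, test_on U psi -> alt_contraction f j psi = 0) ->
  tensor_vanishes_infinite_order (normal_operator f) x0 -> smooth phi ->
  \sum_(0 <= j < (k + l).+1) (-1) ^+ j * alt_contraction f j (multi_partial (k + l - j) j phi) = 0.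
Proof.
move=> oU Ux0 cf fU Nf; move: phi; apply: (moments_vanish oU Ux0 _ fU) => [j|a am].
  exact: compact_alt_contraction.
have [I [J aE]] := words_of_degree am.
have [V [g [oV Vx0 sg Hg g0]]] := Nf I J.
exists V, g, (2 * (-1) ^+ ones J); first by rewrite mulf_neq0 ?pnatr_eq0// signr_eq0.
split; [exact: oV|exact: Vx0|exact: sg|exact: g0|] => phi tp.
 rewrite -(Hg _ tp) (normal_operatorE I J cf tp) aE; reflexivity.
Qed.

End normal.

(** * Recovering tensors from their contractions *)

Section reconstruct.
Context {R : realType}.
Implicit Types (phi : R * R -> R) (k l j : nat).

Lemma sym_left_permute k l (g : tensor R k l) p I J phi :
  sym_left g (permute p I) J phi = sym_left g I J phi.
Proof.
rewrite /sym_left; congr (_ * _); rewrite [RHS](reindex_inj (mulIg p)) /=.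
by apply: eq_bigr => q _; rewrite permuteM.
Qed.

Lemma sym_right_permute k l (g : tensor R k l) q I J phi :
  sym_right g I (permute q J) phi = sym_right g I J phi.
Proof.
rewrite /sym_right; congr (_ * _); rewrite [RHS](reindex_inj (mulIg q)) /=.
by apply: eq_bigr => p _; rewrite permuteM.
Qed.

Definition count_symmetric k l (f : tensor R k l) := forall I J M N phi, smooth phi ->
  ones I = ones M -> ones J = ones N -> f I J phi = f M N phi.

Lemma permute_count_symmetric k l (f : tensor R k l) :
  (forall p q I J phi, smooth phi -> f (permute p I) (permute q J) phi = f I J phi) ->
  count_symmetric f.
Proof.
move=> H I J M N phi sp /permute_ones[p ->] /permute_ones[q ->]; exact: H.
Qed.

Lemma compact_tensor_d' k l (u : tensor R k l) : compact_tensor u -> compact_tensor (d' u).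
Proof.
move=> [cu su]; split=> [I J|p q I J phi sp].
  by apply: compact_distZ; apply: compact_dist_sum => p; exact: compact_partial_dist.
rewrite /d' sym_left_permute; congr (_ * _); apply: eq_bigr => r _.
rewrite /partial_dist; congr (- _).
(* [su] permutes both groups of indices, so the identity is inserted on the group that stays
   fixed. *)
set T := [tuple of _]; have E : permute 1%g T = T.
  by apply: eq_from_tnth => i; rewrite tnth_mktuple perm1.
by rewrite -{1}E (su _ _ _ _ _ (smooth_partial _ sp)).
Qed.

Lemma lambda_permute k l (w : tensor R k l) p q I J phi :
  lambda w (permute p I) (permute q J) phi = lambda w I J phi.
Proof.
rewrite /lambda sym_left_permute; congr (_ * _); apply: eq_bigr => r _.
exact: sym_right_permute.
Qed.

(** Symmetrizing amounts to drawing one entry of I and one of J uniformly; the Kronecker delta keeps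
    the draws (1, 1) and (2, 2). The truncated predecessors are harmless, being multiplied by the
    counts themselves. *)
Lemma lambda_counts k l (w : nat -> nat -> functional R) (I : k.+1.-tuple 'I_2) (J : l.+1.-tuple 'I_2) phi :
  lambda (fun (I : k.-tuple 'I_2) (J : l.-tuple 'I_2) => w (ones I) (ones J)) I J phi =
  (k.+1%:R * l.+1%:R)^-1 *
    ((ones I)%:R * (ones J)%:R * w (ones I).-1 (ones J).-1 phi +
     (twos I)%:R * (twos J)%:R * w (ones I) (ones J) phi).
Proof.
pose H (i j : 'I_2) := (i == j)%:R * w (ones I - (i == ord0))%N (ones J - (j == ord0))%N phi.
have onesB n (T : n.+1.-tuple 'I_2) : ones [tuple of behead T] = (ones T - (thead T == ord0))%N.
  by case/tupleP: T => i M; rewrite behead_cons theadE ones_cons addKn.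
have theadP n (p : 'S_n.+1) (T : n.+1.-tuple 'I_2) : thead (permute p T) = tnth T (p ord0).
  by rewrite /thead tnth_mktuple.
transitivity ((k.+1`!%:R)^-1 * \sum_(p : 'S_k.+1) ((l.+1`!%:R)^-1 *
    \sum_(q : 'S_l.+1) H (tnth I (p ord0)) (tnth J (q ord0)))).
  congr (_ * _); apply: eq_bigr => p _; congr (_ * _); apply: eq_bigr => q _.
  by rewrite !onesB !theadP !ones_permute.
rewrite (perm_average (fun i => (l.+1`!%:R)^-1 * \sum_(q : 'S_l.+1) H (tnth I i) (tnth J (q ord0)))).
rewrite (eq_bigr (fun i => l.+1%:R^-1 * ((ones J)%:R * H (tnth I i) ord0 +
  (twos J)%:R * H (tnth I i) ord_max))); last first.
  by move=> i _; rewrite (perm_average (fun i' => H (tnth I i) (tnth J i'))) (sum_tnth J).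
rewrite (sum_tnth I (fun i => l.+1%:R^-1 * ((ones J)%:R * H i ord0 + (twos J)%:R * H i ord_max))).
by rewrite /H /= !subn1 !subn0 invfM; ring.
Qed.

(* Solves lambda w = h in the form [lambda_counts], by recursion on the number p of 1's among
   the first indices; this is possible as long as p < K and q < L. *)
Fixpoint weights (K L : nat) (h : nat -> nat -> functional R) (p q : nat) {struct p} : functional R :=
  fun phi => (((K - p) * (L - q))%:R)^-1 * ((K * L)%:R * h p q phi +
    (if p is p'.+1 then - (p * q)%:R * weights K L h p' q.-1 phi else 0)).

Lemma compact_weights K L h p q : (forall p q, compact_distribution (h p q)) ->
  compact_distribution (weights K L h p q).
Proof.
move=> ch; elim: p q => [|p IH] q; apply: compact_distZ; apply: compact_distD;
  try exact: compact_distZ.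
exact: compact_dist0.
Qed.

Lemma weightsE K L h p q phi : (p < K)%N -> (q < L)%N ->
  (K%:R * L%:R)^-1 * (p%:R * q%:R * weights K L h p.-1 q.-1 phi +
     (K - p)%:R * (L - q)%:R * weights K L h p q phi) = h p q phi.
Proof.
move=> pK qL.
have K0 : K%:R != 0 :> R by rewrite pnatr_eq0 -lt0n (leq_ltn_trans _ pK).
have L0 : L%:R != 0 :> R by rewrite pnatr_eq0 -lt0n (leq_ltn_trans _ qL).
have KL0 : ((K - p) * (L - q))%:R != 0 :> R by rewrite pnatr_eq0 -lt0n muln_gt0 !subn_gt0 pK.
have -> : (K - p)%:R * (L - q)%:R * weights K L h p q phi = (K * L)%:R * h p q phi +
    (if p is p'.+1 then - (p * q)%:R * weights K L h p' q.-1 phi else 0).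
  by rewrite -natrM; case: p pK KL0 => [|p] pK KL0 /=; rewrite mulVKf.
case: p pK KL0 => [|p] pK KL0 /=.
  by rewrite !mul0r add0r addr0 natrM mulKf// mulf_neq0.
by rewrite (natrM _ p.+1 q) mulNr addrCA subrr addr0 natrM mulKf// mulf_neq0.
Qed.

Lemma alt_contraction_gt k l (f : tensor R k l) j phi : (k + l < j)%N -> alt_contraction f j phi = 0.
Proof.
move=> jm; apply: big1 => M _; apply: big1 => N /eqP E.
by move: jm; rewrite -E ltnNge leq_add ?ones_le ?twos_le.
Qed.

Lemma words_count_neq0 k l (P : k.-tuple 'I_2 -> l.-tuple 'I_2 -> bool) I J : P I J ->
  \sum_M \sum_(N | P M N) 1 != 0 :> R.
Proof.
move=> PIJ; rewrite gt_eqF// (bigD1 I)//= (bigD1 J)//= -addrA ltr_pwDl//.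
by rewrite addr_ge0// ?sumr_ge0// => M _; rewrite sumr_ge0.
Qed.

(** Each v_j is spread evenly over the pairs of words of degree j, with the sign of the contraction
    built in so that it squares to 1; [c] counts these pairs. *)
Lemma exists_potential k l (v : nat -> functional R) : (forall j, compact_distribution (v j)) ->
  exists2 u : tensor R k l, compact_tensor u &
  forall j phi, (j <= k + l)%N -> alt_contraction u j phi = v j phi.
Proof.
move=> cv; pose c j : R := \sum_(M : k.-tuple 'I_2) \sum_(N : l.-tuple 'I_2 | (ones M + twos N == j)%N) 1.
pose u : tensor R k l := fun I J phi => ((-1) ^+ ones J * (c (ones I + twos J)%N)^-1) * v (ones I + twos J)%N phi.
exists u; first split=> [I J|p q I J phi _].
- exact: compact_distZ.
- by rewrite /u !ones_permute !twos_permute.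
move=> j phi jm; have [I [J /eqP IJ]] := words_of_degree jm.
have c0 : c j != 0 by exact: (@words_count_neq0 k l (fun M N => ones M + twos N == j)%N I J IJ).
transitivity (c j * ((c j)^-1 * v j phi)); last by rewrite mulrA mulfV// mul1r.
rewrite {1}/c mulr_suml; apply: eq_bigr => M _; rewrite mulr_suml; apply: eq_bigr => N /eqP E.
by rewrite /u E mul1r !mulrA -exprD addnn -signr_odd odd_double mul1r.
Qed.

(** A degree fixes the difference [ones M - ones N], a diagonal in the rectangle of counts, and each
    diagonal meets the edges [ones M = k], [ones N = l] in exactly one pair. All other counts being
    killed by hypothesis, the contraction is a nonzero multiple of the component at that pair. *)
Lemma alt_contraction_inj k l (h : tensor R k l) : count_symmetric h ->
  (forall j phi, smooth phi -> alt_contraction h j phi = 0) ->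
  (forall I J phi, smooth phi -> (ones I < k)%N -> (ones J < l)%N -> h I J phi = 0) ->
  forall I J phi, smooth phi -> h I J phi = 0.
Proof.
move=> sh ah zh I J phi sp.
have [/andP[Ik Jl]|nIJ] := boolP ((ones I < k) && (ones J < l))%N; first exact: zh.
pose P (M : k.-tuple 'I_2) (N : l.-tuple 'I_2) := (ones M == ones I) && (ones N == ones J).
have c0 : \sum_M \sum_(N | P M N) 1 != 0 :> R.
  by apply: (@words_count_neq0 _ _ _ I J); rewrite /P !eqxx.
have E : alt_contraction h (ones I + twos J)%N phi =
    (\sum_M \sum_(N | P M N) 1) * ((-1) ^+ ones J * h I J phi).
  rewrite mulr_suml; apply: eq_bigr => M _; rewrite mulr_suml.
  rewrite big_mkcond [RHS]big_mkcond; apply: eq_bigr => N _.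
  have eN := ones_twos N; have eJ := ones_twos J.
  have lM := ones_le M; have lI := ones_le I.
  rewrite /P; case: ifPn => [/eqP EMN|nMN]; last first.
    by case: ifP => // /andP[/eqP E1 /eqP E2]; move: nMN; lia.
  case: ifPn => [/andP[/eqP E1 /eqP E2]|nE]; first by rewrite E2 mul1r (sh M N I J).
  rewrite zh ?mulr0//; lia.
have := ah (ones I + twos J)%N phi sp; rewrite E => /eqP.
by rewrite !mulf_eq0 (negbTE c0) signr_eq0 /= => /eqP.
Qed.

End reconstruct.

Theorem theorem2p3 (R : realType) (k l : nat) (U : set (R * R))
    (f : tensor R k.+1 l.+1) (w' : tensor R k l) (x0 : R * R)
    (U_open : open U) (U_nonempty : U !=set0)
    (f_compact : compact_tensor f)
    (w'_compact : compact_tensor w')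
    (f_on_U : tensor_eq_on U f (lambda w'))
    (x0_in_U : U x0)
    (Nf_vanishes : tensor_vanishes_infinite_order (normal_operator f) x0) :
  exists (u : tensor R k l.+1) (w : tensor R k l),
    [/\ compact_tensor u, compact_tensor w
      & tensor_eq f (tensor_add (d' u) (lambda w))].
Proof.
have [cf sf] := f_compact.
have fU j psi : test_on U psi -> alt_contraction f j psi = 0.
  move=> tp; rewrite -[RHS](alt_contraction_lambda w' j psi).
  by apply: eq_bigr => M _; apply: eq_bigr => N _; rewrite f_on_U.
have [v [cv Ev]] := division (fun j => compact_alt_contraction j cf)
  (fun phi => alt_contraction_vanish U_open x0_in_U cf fU Nf_vanishes (phi := phi)).
have [u cu Eu] := exists_potential k l.+1 cv.
have [cd sd] := compact_tensor_d' cu.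
pose h : tensor R k.+1 l.+1 := fun I J phi => f I J phi - d' u I J phi.
have ch I J : compact_distribution (h I J).
  have := compact_distD (cf I J) (compact_distZ (-1) (cd I J)).
  by congr compact_distribution; apply/funext => phi; rewrite mulN1r.
have ah j phi : smooth phi -> alt_contraction h j phi = 0.
  move=> sp; have [jm|jm] := leqP j (k.+1 + l.+1)%N; last exact: alt_contraction_gt.
  rewrite alt_contractionB alt_contraction_d' (Ev _ _ jm sp); apply/eqP; rewrite subr_eq0; apply/eqP.
  congr (_ + _); first by case: j jm => // j jm; rewrite Eu// -ltnS -addSn.
  (* The degrees of [u] stop at k + l + 1, so for j = k + l + 2 its contraction is 0, matching the
     missing term in [division]. *)
  case: ltnP => [jm'|mj]; first by rewrite Eu// -ltnS -addSn.
  by rewrite alt_contraction_gt ?oppr0// -addSn.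
(* Symmetry makes [h] a function of the two counts, read off on block words, as [weights]
   expects. *)
pose hc p q := h (block_word k.+1 p) (block_word l.+1 q).
pose W := weights k.+1 l.+1 hc.
pose w : tensor R k l := fun I J => W (ones I) (ones J).
exists u, w; split=> //.
  split=> [I J|p q I J phi _]; last by rewrite /w !ones_permute.
  by apply: compact_weights => p q; exact: ch.
have sh : count_symmetric h.
  by apply: permute_count_symmetric => p q I J phi sp; rewrite /h sf// sd.
pose h' : tensor R k.+1 l.+1 := fun I J phi => h I J phi - lambda w I J phi.
(* [w] solves the equation only where both counts are below their maximum; the remaining components
   are forced to vanish by the contractions. *)
have h'0 : forall I J phi, smooth phi -> h' I J phi = 0.
  apply: alt_contraction_inj => [I J M N phi sp E1 E2|j phi sp|I J phi sp Ik Jl].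
  - rewrite /h' (sh I J M N)//; congr (_ - _).
    exact: (permute_count_symmetric (fun p q I J phi _ => lambda_permute w p q I J phi) sp E1 E2).
  - by rewrite alt_contractionB ah// alt_contraction_lambda subrr.
  have tE n (T : n.-tuple 'I_2) : (n - ones T)%N = twos T by rewrite -{1}(ones_twos T) addKn.
  rewrite /h' /w (lambda_counts W) -!tE -/W (weightsE _ _ Ik Jl) /hc.
  by rewrite (sh I J (block_word k.+1 (ones I)) (block_word l.+1 (ones J))) ?subrr// ones_block_word// ltnW.
move=> I J phi sp; have := h'0 I J phi sp; rewrite /h' /h /tensor_add => /eqP.
by rewrite subr_eq0 subr_eq addrC => /eqP.
Qed.
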